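(* Let $n\ge 1$ be an integer, let $A\subseteq\mathbb{N}$, let $\ell$ be a line in $\mathbb{R}^n$, and let $s\in\mathbb{R}$. Assume that $s$ is random relative to $A$ and that $$K^{A}_r(\ell \mid s)\geq K^A_r(\ell) - O(\log r),$$ i.e. there is a constant $C$ (independent of $r$) such that $K^{A}_r(\ell\mid s)\ge K^A_r(\ell)-C\log r$ for all integers $r\ge 2$. Then $$K^A_r(\ell(s))\geq \frac{K^A_r(\ell)}{2} + r - o(r),$$ i.e. for every $\varepsilon>0$ there is $r_0$ (which may depend on $\varepsilon, n, A,\ell,s$) such that $K^A_r(\ell(s))\geq \frac{1}{2}K^A_r(\ell) + r - \varepsilon r$ for all integers $r\ge r_0$.
   Context: Lines are affine lines (not necessarily through the origin); $\mathcal{A}(n,1)$ denotes the set of all of them. For a line $\ell\subseteq\mathbb{R}^n$, let $i$ be the least index such that the orthogonal projection of $\ell$ onto the $i$-th coordinate axis is the whole axis (equivalently, a direction vector of $\ell$ has nonzero $i$-th entry). For $s\in\mathbb{R}$, $\ell(s)\in\mathbb{R}^n$ denotes the unique point of $\ell$ whose $i$-th coordinate equals $s$. Fix a universal prefix-free oracle Turing machine. For finite-data objects $\sigma,\tau$ (rationals, rational vectors, rational matrices, etc., identified with binary strings by a fixed standard computable encoding), $K^A(\sigma)$ and $K^A(\sigma\mid\tau)$ denote prefix-free Kolmogorov complexity, respectively conditional prefix-free Kolmogorov complexity, relative to the oracle $A$. Precisions $r$ range over positive integers; $\log=\log_2$. For $x\in\mathbb{R}^m$, the Kolmogorov complexity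 at precision $r$ relative to $A$ is $$K^A_r(x)=\min\{K^A(p): p\in B_{2^{-r}}(x)\cap\mathbb{Q}^m\}.$$ For lines: a line $\ell$ is identified with the pair $(P_\ell,t_\ell)$, where $P_\ell$ is the $n\times n$ matrix of the orthogonal projection onto the linear direction of $\ell$, and $t_\ell\in\mathbb{R}^n$ is the point of $\ell$ closest to the origin. The distance between lines is $\|P_\ell-P_{\ell'}\|+|t_\ell-t_{\ell'}|$ (operator norm and Euclidean norm), and a line is rational if $P_\ell$ and $t_\ell$ have rational entries. Then $$K^A_r(\ell)=\min\{K^A(p): p \text{ a rational line within distance } 2^{-r} \text{ of } \ell\},$$ $$K^A_r(\ell\mid s)=\max_{q\in B_{2^{-r}}(s)\cap\mathbb{Q}}\ \min\{K^A(p\mid q): p \text{ a rational line within distance } 2^{-r}\text{ of }\ell\}.$$ (Up to an additive error $O(\log r)$, $K^A_r(\ell)$ equals the complexity at precision $r$ of the vector of slopes and intercepts $(a_1,\dots,a_{n-1},b_1,\dots,b_{n-1})$ when $\ell$ is written as $\ell(s)=(s,a_1s+b_1,\dots,a_{n-1}s+b_{n-1})$, with implied constant depending on $\ell$.) A real number $s$ is random relative to $A$ if it is Martin-Löf random relative to $A$: there is a constant $c$ such that for all $r$, the string of the first $r$ bits of the binary expansion of the fractional part of $s$ has $K^A$-complexity at least $r-c$. *)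

(* Defs.v *)
From HB Require Import structures.
From mathcomp Require Import all_boot all_order all_algebra.
From mathcomp Require Import all_classical all_reals all_analysis.

Set Implicit Arguments.
Unset Strict Implicit.
Unset Printing Implicit Defensive.

Import Order.TTheory GRing.Theory Num.Theory.

Local Open Scope classical_set_scope.
Local Open Scope ring_scope.

(* Both default to 0 when the extremum does not exist. Every set of
   complexities below on which they are used is nonempty (and bounded, for
   [greatest]) as soon as the reference machine is universal. *)
Definition least (X : set nat) : nat :=
  xget 0%N [set m | X m /\ forall k, X k -> (m <= k)%N].

Definition greatest (X : set nat) : nat :=
  xget 0%N [set m | X m /\ forall k, X k -> (k <= m)%N].

(* Cantor's bijection nat * nat -> nat: (a + b)(a + b + 1)/2 + b. *)
Definition cpair (a b : nat) : nat := ('C((a + b).+1, 2) + b)%N.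

(* Kleene's partial recursive functionals of an oracle, i.e. the functions
   computed by oracle Turing machines. They are unary; tuples of arguments are
   passed through [cpair]. *)
Inductive machine : Type :=
| Zero
| Succ
| Fst
| Snd
| Query
| Pair of machine & machine
| Comp of machine & machine
| PrimRec of machine & machine
| Mu of machine.

(* [eval A e x y]: with oracle [A], the machine [e] halts on [x] with
   output [y]. As [cpair] is a bijection, the rules for [Fst], [Snd] and
   [PrimRec] apply to every input. *)
Inductive eval (A : set nat) : machine -> nat -> nat -> Prop :=
| eval_Zero x : eval A Zero x 0
| eval_Succ x : eval A Succ x x.+1
| eval_Fst a b : eval A Fst (cpair a b) a
| eval_Snd a b : eval A Snd (cpair a b) b
| eval_Query x : eval A Query x (x \in A)
| eval_Pair f g x a b :
    eval A f x a -> eval A g x b -> eval A (Pair f g) x (cpair a b)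
| eval_Comp f g x y z :
    eval A g x y -> eval A f y z -> eval A (Comp f g) x z
| eval_PrimRec0 f g a y :
    eval A f a y -> eval A (PrimRec f g) (cpair a 0) y
| eval_PrimRecS f g a m y z :
    eval A (PrimRec f g) (cpair a m) y ->
    eval A g (cpair a (cpair m y)) z ->
    eval A (PrimRec f g) (cpair a m.+1) z
| eval_Mu f a m (y : nat -> nat) :
    eval A f (cpair a m) 0 ->
    (forall k, (k < m)%N -> eval A f (cpair a k) (y k).+1) ->
    eval A (Mu f) a m.

(* Binary strings are identified with natural numbers by bijective binary
   numeration: [::], 0, 1, 00, 01, ... are 0, 1, 2, 3, 4, ... *)
Definition code_str (p : seq bool) : nat :=
  foldl (fun m (b : bool) => (m.*2 + b).+1) 0%N p.

(* Machine [M] with oracle [A], program [p] and condition [tau] outputs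
   [sigma]; the strings [tau] and [sigma] are given by their codes. *)
Definition outputs (A : set nat) (M : machine) (p : seq bool)
  (tau sigma : nat) : Prop := eval A M (cpair (code_str p) tau) sigma.

Definition prefix_free (M : machine) : Prop :=
  forall (A : set nat) (tau : nat) (p p' : seq bool) (sigma sigma' : nat),
    outputs A M p tau sigma -> outputs A M p' tau sigma' ->
    prefix p p' -> p = p'.

Definition universal_prefix_free (U : machine) : Prop :=
  prefix_free U /\
  forall M : machine, prefix_free M ->
    exists rho : seq bool, forall (A : set nat) (p : seq bool) (tau sigma : nat),
      outputs A U (rho ++ p) tau sigma <-> outputs A M p tau sigma.

Definition condK (U : machine) (A : set nat) (sigma tau : nat) : nat :=
  least [set size p | p in [set p | outputs A U p tau sigma]].

(* The condition 0 is the code of the empty string. *)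
Definition K (U : machine) (A : set nat) (sigma : nat) : nat :=
  condK U A sigma 0.

Definition code_int (z : int) : nat :=
  match z with Posz k => k.*2 | Negz k => k.*2.+1 end.

Definition code_rat (q : rat) : nat :=
  cpair (code_int (numq q)) (code_int (denq q)).

Definition code_seq (s : seq nat) : nat :=
  foldr (fun x c => (cpair x c).+1) 0%N s.

Definition code_mx (m n : nat) (M : 'M[rat]_(m, n)) : nat :=
  code_seq [seq code_rat (M i j) | i <- enum 'I_m, j <- enum 'I_n].

(* The library norm on matrices is the sup norm, hence these definitions. *)
Definition enorm (R : realType) (m : nat) (x : 'cV[R]_m) : R :=
  Num.sqrt (\sum_(i < m) x i 0 ^+ 2).

Definition opnorm (R : realType) (m : nat) (M : 'M[R]_m) : R :=
  sup [set enorm (M *m x) | x in [set x : 'cV[R]_m | enorm x <= 1]].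

Definition K_point (R : realType) (U : machine) (A : set nat) (m : nat)
    (r : nat) (x : 'cV[R]_m) : nat :=
  least [set K U A (code_mx p) |
    p in [set p : 'cV[rat]_m | enorm (map_mx ratr p - x) < 2 ^- r]].

Definition is_line (R : realType) (n : nat) (l : set 'cV[R]_n) : Prop :=
  exists p v : 'cV[R]_n, v != 0 /\ l = [set p + a *: v | a in [set: R]].

Definition direction (R : realType) (n : nat) (l : set 'cV[R]_n) :
    set 'cV[R]_n :=
  [set x - y | x in l & y in l].

Definition is_orth_proj (R : realType) (n : nat) (D : set 'cV[R]_n)
    (P : 'M[R]_n) : Prop :=
  forall x : 'cV[R]_n,
    D (P *m x) /\ forall w, D w -> w^T *m (x - P *m x) = 0.

Definition line_proj (R : realType) (n : nat) (l : set 'cV[R]_n) : 'M[R]_n :=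
  xget 0 [set P | is_orth_proj (direction l) P].

Definition line_base (R : realType) (n : nat) (l : set 'cV[R]_n) : 'cV[R]_n :=
  xget 0 [set t | l t /\ forall x, l x -> enorm t <= enorm x].

Definition line_dist (R : realType) (n : nat) (l l' : set 'cV[R]_n) : R :=
  opnorm (line_proj l - line_proj l') + enorm (line_base l - line_base l').

(* The pair (P, t) of projection matrix and point closest to the origin. *)
Definition rat_line (n : nat) : Type := ('M[rat]_n * 'cV[rat]_n)%type.

Definition code_line (n : nat) (p : rat_line n) : nat :=
  cpair (code_mx p.1) (code_mx p.2).

Definition represents (R : realType) (n : nat) (p : rat_line n)
    (l : set 'cV[R]_n) : Prop :=
  [/\ is_line l, line_proj l = map_mx ratr p.1 &
      line_base l = map_mx ratr p.2].

Definition rat_lines_within (R : realType) (n : nat) (r : nat)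
    (l : set 'cV[R]_n) : set (rat_line n) :=
  [set p | exists2 l' : set 'cV[R]_n,
             represents p l' & line_dist l' l <= 2 ^- r].

Definition K_line (R : realType) (U : machine) (A : set nat) (n : nat)
    (r : nat) (l : set 'cV[R]_n) : nat :=
  least [set K U A (code_line p) | p in rat_lines_within r l].

Definition condK_line (R : realType) (U : machine) (A : set nat) (n : nat)
    (r : nat) (l : set 'cV[R]_n) (s : R) : nat :=
  greatest [set least [set condK U A (code_line p) (code_rat q) |
                         p in rat_lines_within r l] |
              q in [set q : rat | `|ratr q - s| < 2 ^- r]].

Definition covers_axis (R : realType) (n : nat) (l : set 'cV[R]_n)
    (i : 'I_n) : Prop :=
  [set x i 0 | x in l] = [set: R].

(* Single-valued: a line covers axis i iff its direction has a nonzero i-th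
   entry, and then x i 0 determines x on it. *)
Definition line_at (R : realType) (n : nat) (l : set 'cV[R]_n) (s : R) :
    'cV[R]_n :=
  xget 0 [set x | l x /\ exists i : 'I_n,
    [/\ covers_axis l i, forall j : 'I_n, covers_axis l j -> (i <= j)%N &
        x i 0 = s]].

Definition frac_part (R : realType) (s : R) : R := s - (Num.floor s)%:~R.

(* The k-th bit (from k = 0) has weight 2 ^- k.+1. *)
Definition binary_prefix (R : realType) (s : R) (r : nat) : seq bool :=
  [seq odd (Num.truncn (frac_part s * 2 ^+ k.+1)) | k <- iota 0 r].

Definition random (R : realType) (U : machine) (A : set nat) (s : R) : Prop :=
  exists c : nat, forall r : nat,
    (r <= K U A (code_str (binary_prefix s r)) + c)%N.

Definition log2 (R : realType) (x : R) : R := ln x / ln 2.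

(* Main.v *)
(* The proof goes by slicing the line at two heights. Write x for the point of
   the line at height s. Since s is random and independent of the line, many
   heights j behave like s: about 2^r of the 2^r heights j at scale 2^-r admit
   a point u_j near the line with K(u_j | j) <= k, where k = K(x | s), which is
   about K(x) - r. Among them is a second height j' that is far from s and
   random relative to s and the line. The two heights and the two points
   determine the line up to 2^(O(log r)) grid lines, so that
   K(line) + 2r <= K(line, s, j') <= 2r + 2k, up to O(log r).

   All upper bounds on complexity come from one machine, which describes an
   element of an enumerated set by its rank in the order of enumeration. *)
Require Import Defs.
From HB Require Import structures.
From mathcomp Require Import all_boot all_order all_algebra.
From mathcomp Require Import all_classical all_reals all_analysis.
From mathcomp Require Import zify ring lra.
Require Import Defs.

Set Implicit Arguments.
Unset Strict Implicit.
Unset Printing Implicit Defensive.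

Import Order.TTheory GRing.Theory Num.Theory.

Local Open Scope classical_set_scope.
Local Open Scope ring_scope.

(** * Computable functions of an oracle *)

(** That many heights behave like s is forced by counting. Symmetry of information gives K(s | line)
    at least r - O(log r), whereas lying in a set of at most 2^e heights enumerable from the line
    gives K(s | line) at most e + O(log r); for e = r - f D, with D the logarithmic error and f a
    large constant, this is a contradiction. The surplus also provides j': fewer than 2^e heights
    are closer than 2^(e-2) to s or have complexity below e - 2 given s and the line. The separation
    2^(e-2) confines each end coordinate of a line through the two points to a window of length
    2^(O(log r)), so a short residue picks out the right value. The complexity argument takes place
    in the natural numbers: a line is given by two grid points at heights one unit apart. Real
    geometry only has to show that passing between rational lines and grid lines costs O(log r).
    Going back is the delicate direction, since grid points at scale 2^-r fix the line only up to a
    constant multiple of 2^-r; bounded corrections then lead to a finer grid. *)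

Fixpoint unpair (x : nat) : nat * nat :=
  if x is x'.+1 then
    let: (a, b) := unpair x' in if a is a'.+1 then (a', b.+1) else (b.+1, 0%N)
  else (0%N, 0%N).

Definition cfst x := (unpair x).1.
Definition csnd x := (unpair x).2.

(** [unpair] walks along the antidiagonals: [(a.+1, b)] is followed by [(a, b.+1)] and [(0, b)] by
    [(b.+1, 0)]. Each move raises [cpair] by one. *)
Lemma cpairK x : cpair (cfst x) (csnd x) = x.
Proof.
rewrite /cfst /csnd; elim: x => //= x; case: (unpair x) => -[|a] b /= <-.
  by rewrite /cpair !addn0 !add0n [in LHS]binS bin1 addnC addSn addnC.
by rewrite /cpair addnS addSn addnS.
Qed.

Lemma cpair_inj a b a' b' : cpair a b = cpair a' b' -> a = a' /\ b = b'.
Proof.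
wlog le_ab : a b a' b' / (a + b <= a' + b')%N.
  move=> W e; case: (leqP (a + b) (a' + b')) => le; first exact: W.
  by have [] := W a' b' a b (ltnW le) (esym e).
rewrite /cpair => e; have [eab|ne] := eqVneq (a + b)%N (a' + b')%N.
  by move: e; rewrite eab => /eqP; rewrite eqn_add2l => /eqP; lia.
have lt : ((a + b).+2 <= (a' + b').+1)%N by lia.
have := leq_bin2l 2 lt; rewrite binS bin1; lia.
Qed.

Lemma cfstK a b : cfst (cpair a b) = a.
Proof. by have [] := cpair_inj (cpairK (cpair a b)). Qed.

Lemma csndK a b : csnd (cpair a b) = b.
Proof. by have [] := cpair_inj (cpairK (cpair a b)). Qed.

Definition cpairE := (cfstK, csndK).

(** One machine serves all oracles, because [prefix_free] and [universal_prefix_free] quantify over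
    the oracle after the machine. *)
Definition comp (f : set nat -> nat -> nat) : Prop :=
  exists e, forall A x, eval A e x (f A x).

Definition compb (f : set nat -> nat -> bool) : Prop :=
  comp (fun A x => nat_of_bool (f A x)).

Lemma comp_ext f g : (forall A x, f A x = g A x) -> comp f -> comp g.
Proof. by move=> fg [e ef]; exists e => A x; rewrite -fg. Qed.

Lemma comp_id : comp (fun _ x => x).
Proof.
exists (Pair Fst Snd) => A x; rewrite -{2}(cpairK x).
by apply: eval_Pair; rewrite -{1}(cpairK x); constructor.
Qed.

Lemma comp_comp f g : comp f -> comp g -> comp (fun A x => f A (g A x)).
Proof. by move=> [e ef] [e' eg]; exists (Comp e e') => A x; econstructor. Qed.

Lemma comp_fst f : comp f -> comp (fun A x => cfst (f A x)).
Proof.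
apply: (@comp_comp (fun _ => cfst)); exists Fst => A x.
by rewrite -{1}(cpairK x); constructor.
Qed.

Lemma comp_snd f : comp f -> comp (fun A x => csnd (f A x)).
Proof.
apply: (@comp_comp (fun _ => csnd)); exists Snd => A x.
by rewrite -{1}(cpairK x); constructor.
Qed.

Lemma comp_pair f g : comp f -> comp g -> comp (fun A x => cpair (f A x) (g A x)).
Proof. by move=> [e ef] [e' eg]; exists (Pair e e') => A x; constructor. Qed.

Lemma comp_succ f : comp f -> comp (fun A x => (f A x).+1).
Proof. by apply: (@comp_comp (fun _ => S)); exists Succ => A x; constructor. Qed.

Lemma comp_const k : comp (fun _ _ => k).
Proof. by elim: k => [|k]; [exists Zero; constructor|apply: comp_succ]. Qed.

Lemma comp_query f : comp f -> compb (fun A x => f A x \in A).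
Proof.
by apply: (@comp_comp (fun A x => nat_of_bool (x \in A))); exists Query; constructor.
Qed.

(* A function of two arguments [x], [y] is read off the pair [z] of both. *)
Lemma comp_iteri f g h :
  comp (fun A z => g A (cfst z) (cfst (csnd z)) (csnd (csnd z))) ->
  comp f -> comp h ->
  comp (fun A x => iteri (h A x) (g A x) (f A x)).
Proof.
move=> [eg Hg] [ef Hf] ch.
pose F A z := iteri (csnd z) (g A (cfst z)) (f A (cfst z)).
apply: (@comp_ext (fun A x => F A (cpair x (h A x)))).
  by move=> A x; rewrite /F !cpairE.
apply: comp_comp; last by apply: comp_pair => //; exact: comp_id.
exists (PrimRec ef eg) => A z; rewrite -{1}(cpairK z) /F.
elim: (csnd z) => [|m IH]; first exact: eval_PrimRec0.
apply: (eval_PrimRecS IH); rewrite iteriS.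
by have := Hg A (cpair (cfst z) (cpair m (iteri m (g A (cfst z)) (f A (cfst z)))));
  rewrite !cpairE.
Qed.

Lemma comp_lam2 (f : set nat -> nat -> nat -> nat) g h :
  comp (fun A z => f A (cfst z) (csnd z)) -> comp g -> comp h ->
  comp (fun A x => f A (g A x) (h A x)).
Proof.
move=> cf cg ch; apply: comp_ext (comp_comp cf (comp_pair cg ch)) => A x.
by rewrite !cpairE.
Qed.


Lemma compb_comp f : compb f -> comp (fun A x => nat_of_bool (f A x)).
Proof. by []. Qed.

(* Hooks, redefined as more closure properties become available. *)
Ltac comp_lib := fail.
Ltac comp_user := fail.

Ltac comp_step := cbv beta; first [comp_lib | comp_user | match goal with
  | H : comp ?f |- comp ?f => exact H
  | H : compb ?f |- compb ?f => exact H
  | |- comp (fun _ x => x) => exact comp_id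
  | |- comp (fun _ _ => ?k) => exact (comp_const k)
  | |- compb (fun _ _ => ?k) => exact (comp_const (nat_of_bool k))
  | |- comp (fun A x => cfst (@?f A x)) => refine (@comp_fst f _)
  | |- comp (fun A x => csnd (@?f A x)) => refine (@comp_snd f _)
  | |- comp (fun A x => cpair (@?f A x) (@?g A x)) => refine (@comp_pair f g _ _)
  | |- comp (fun A x => S (@?f A x)) => refine (@comp_succ f _)
  | |- comp (fun A x => iteri (@?h A x) (@?g A x) (@?f A x)) =>
      refine (@comp_iteri f g h _ _ _)
  | H : comp ?f |- comp (fun A x => ?f A (@?g A x)) => refine (comp_comp H _)
  | H : comp (fun _ x => ?f x) |- comp (fun A x => ?f (@?g A x)) =>
      refine (@comp_comp (fun _ => f) g H _)
  | |- comp (fun A x => nat_of_bool (@?f A x)) => refine (@compb_comp f _)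
  end].
Ltac comp_tac := repeat comp_step.

Lemma comp_pred f : comp f -> comp (fun A x => (f A x).-1).
Proof.
move=> cf; apply: (@comp_ext (fun A x => iteri (f A x) (fun m _ => m) 0%N)).
  by move=> A x; case: (f A x).
by comp_tac.
Qed.
Ltac comp_lib ::= match goal with
  | |- comp (fun A x => (@?f A x).-1) => refine (@comp_pred f _) end.

Lemma comp_add f g : comp f -> comp g -> comp (fun A x => f A x + g A x)%N.
Proof.
move=> cf cg; apply: (@comp_ext (fun A x => iteri (f A x) (fun _ y => y.+1) (g A x))).
  by move=> A x; elim: (f A x) => //= m ->.
by comp_tac.
Qed.

Lemma comp_sub f g : comp f -> comp g -> comp (fun A x => f A x - g A x)%N.
Proof.
move=> cf cg; apply: (@comp_ext (fun A x => iteri (g A x) (fun _ y => y.-1) (f A x))).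
  by move=> A x; elim: (g A x) => [|m /= ->]; rewrite ?subn0 // subnS.
by comp_tac.
Qed.

Ltac comp_lib ::= match goal with
  | |- comp (fun A x => (@?f A x).-1) => refine (@comp_pred f _)
  | |- comp (fun A x => (@?f A x + @?g A x)%N) => refine (@comp_add f g _ _)
  | |- comp (fun A x => (@?f A x - @?g A x)%N) => refine (@comp_sub f g _ _)
  end.

Lemma comp_mul f g : comp f -> comp g -> comp (fun A x => f A x * g A x)%N.
Proof.
move=> cf cg; apply: (@comp_ext (fun A x => iteri (f A x) (fun _ y => g A x + y)%N 0%N)).
  by move=> A x; elim: (f A x) => //= m ->; rewrite mulSn.
by comp_tac.
Qed.

Lemma comp_exp2 f : comp f -> comp (fun A x => 2 ^ f A x)%N.
Proof.
move=> cf; apply: (@comp_ext (fun A x => iteri (f A x) (fun _ y => y + y)%N 1%N)).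
  by move=> A x; elim: (f A x) => //= m ->; rewrite expnS mul2n addnn.
by comp_tac.
Qed.

Lemma comp_if b f g : compb b -> comp f -> comp g ->
  comp (fun A x => if b A x then f A x else g A x).
Proof.
move=> cb cf cg.
apply: (@comp_ext (fun A x => iteri (b A x) (fun _ _ => f A x) (g A x))).
  by move=> A x; case: (b A x).
by comp_tac.
Qed.

Lemma compb_ext f g : (forall A x, f A x = g A x) -> compb f -> compb g.
Proof. by move=> fg; apply: comp_ext => A x; rewrite fg. Qed.

Lemma compb_not f : compb f -> compb (fun A x => ~~ f A x).
Proof.
move=> cf; apply: (@comp_ext (fun A x => 1 - f A x)%N).
  by move=> A x; case: (f A x).
by comp_tac.
Qed.

Lemma compb_and f g : compb f -> compb g -> compb (fun A x => f A x && g A x).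
Proof.
move=> cf cg; apply: (@comp_ext (fun A x => if f A x then nat_of_bool (g A x) else 0%N)).
  by move=> A x; case: (f A x).
by apply: comp_if => //; apply: comp_const.
Qed.

Lemma compb_or f g : compb f -> compb g -> compb (fun A x => f A x || g A x).
Proof.
move=> cf cg; apply: (@comp_ext (fun A x => if f A x then 1%N else nat_of_bool (g A x))).
  by move=> A x; case: (f A x).
by apply: comp_if => //; apply: comp_const.
Qed.

Lemma compb_leq f g : comp f -> comp g -> compb (fun A x => f A x <= g A x)%N.
Proof.
move=> cf cg; apply: (@comp_ext (fun A x => 1 - (f A x - g A x))%N).
  by move=> A x; rewrite leqNgt -subn_gt0; case: (f A x - g A x)%N.
by comp_tac.
Qed.

Lemma compb_eq f g : comp f -> comp g -> compb (fun A x => f A x == g A x).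
Proof.
move=> cf cg.
apply: (@compb_ext (fun A x => (f A x <= g A x) && (g A x <= f A x))%N).
  by move=> A x; rewrite eqn_leq.
by apply: compb_and; apply: compb_leq.
Qed.

Lemma comp_count (b : set nat -> nat -> nat -> bool) g :
  compb (fun A z => b A (cfst z) (csnd z)) -> comp g ->
  comp (fun A x => count (b A x) (iota 0 (g A x))).
Proof.
move=> cb cg.
apply: (@comp_ext (fun A x => iteri (g A x) (fun m y => b A x m + y)%N 0%N)).
  move=> A x; elim: (g A x) => // m IH.
  by rewrite -addn1 iotaD count_cat addn1 iteriS IH /= addnC addn0.
apply: comp_iteri cg; last exact: comp_const.
by apply: comp_add; first apply: (comp_lam2 (f := fun A x y => nat_of_bool (b A x y)));
  comp_tac.
Qed.

Lemma compb_has (b : set nat -> nat -> nat -> bool) g :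
  compb (fun A z => b A (cfst z) (csnd z)) -> comp g ->
  compb (fun A x => has (b A x) (iota 0 (g A x))).
Proof.
move=> cb cg; apply: (@compb_ext (fun A x => 1 <= count (b A x) (iota 0 (g A x)))%N).
  by move=> A x; rewrite has_count.
by apply: compb_leq; [apply: comp_const|apply: comp_count].
Qed.

Lemma compb_all (b : set nat -> nat -> nat -> bool) g :
  compb (fun A z => b A (cfst z) (csnd z)) -> comp g ->
  compb (fun A x => all (b A x) (iota 0 (g A x))).
Proof.
move=> cb cg; apply: (@compb_ext (fun A x => ~~ has (fun y => ~~ b A x y) (iota 0 (g A x)))).
  by move=> A x; rewrite has_predC negbK.
by apply: compb_not; apply: compb_has => //; apply: compb_not.
Qed.

(** The position of the first hit is the number of positions up to which no hit has occurred, so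
    bounded search reduces to counting. *)
Lemma find_iota (p : pred nat) n :
  find p (iota 0 n) = count (fun m => ~~ has p (iota 0 m.+1)) (iota 0 n).
Proof.
have iotaS k : iota 0 k.+1 = rcons (iota 0 k) k by rewrite -addn1 iotaD cats1.
elim: n => // n IH; rewrite iotaS -cats1 find_cat size_iota count_cat -IH /=.
rewrite -/(iota 0 n.+1) -[_ || _]/(has p (iota 0 n.+1)) iotaS has_rcons !addn0.
case: ifP => [h|h]; first by rewrite orbT addn0.
have -> : find p (iota 0 n) = n by rewrite hasNfind ?h // size_iota.
by rewrite orbF; case: (p n).
Qed.

Lemma comp_find (b : set nat -> nat -> nat -> bool) g :
  compb (fun A z => b A (cfst z) (csnd z)) -> comp g ->
  comp (fun A x => find (b A x) (iota 0 (g A x))).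
Proof.
move=> cb cg; apply: comp_ext (fun A x => esym (find_iota _ _)) _.
apply: comp_count => //; apply: compb_not; apply: compb_has.
  apply: compb_ext (comp_lam2 (f := fun A x y => nat_of_bool (b A x y)) cb _ _);
  first by move=> A x.
all: by comp_tac.
Qed.

Lemma count_ltn n m : (n <= m)%N -> count (fun k => k < n)%N (iota 0 m) = n.
Proof.
move=> le; rewrite -(subnKC le) iotaD count_cat (eq_in_count (a2 := xpredT)); last first.
  by move=> k; rewrite mem_iota add0n => /andP[_ /= ->].
rewrite count_predT size_iota (eq_in_count (a2 := xpred0)) ?count_pred0 ?addn0 //.
by move=> k; rewrite mem_iota add0n => /andP[h _] /=; rewrite ltnNge h.
Qed.

Lemma comp_div f g : (forall A x, 0 < g A x)%N -> comp f -> comp g ->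
  comp (fun A x => f A x %/ g A x)%N.
Proof.
move=> g0 cf cg.
apply: (@comp_ext (fun A x => count (fun k => k.+1 * g A x <= f A x)%N (iota 0 (f A x)))).
  move=> A x; rewrite (eq_count (a2 := fun k => k < f A x %/ g A x)%N); last first.
    by move=> k; rewrite leq_divRL ?g0.
  exact/count_ltn/leq_div.
by apply: comp_count => //; apply: compb_leq; comp_tac; apply: comp_mul; comp_tac.
Qed.

Ltac comp_lib ::= match goal with
  | |- comp (fun A x => (@?f A x).-1) => refine (@comp_pred f _)
  | |- comp (fun A x => (@?f A x + @?g A x)%N) => refine (@comp_add f g _ _)
  | |- comp (fun A x => (@?f A x - @?g A x)%N) => refine (@comp_sub f g _ _)
  | |- comp (fun A x => (@?f A x * @?g A x)%N) => refine (@comp_mul f g _ _)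
  | |- comp (fun A x => (2 ^ @?f A x)%N) => refine (@comp_exp2 f _)
  | |- comp (fun A x => (@?f A x %/ @?g A x)%N) => refine (@comp_div f g _ _ _)
  | |- comp (fun A x => if _ then _ else _) => refine (@comp_if _ _ _ _ _ _)
  | |- compb (fun A x => ~~ @?f A x) => refine (@compb_not f _)
  | |- compb (fun A x => @?f A x && @?g A x) => refine (@compb_and f g _ _)
  | |- compb (fun A x => @?f A x || @?g A x) => refine (@compb_or f g _ _)
  | |- compb (fun A x => (@?f A x <= @?g A x)%N) => refine (@compb_leq f g _ _)
  | |- compb (fun A x => (@?f A x) == (@?g A x)) => refine (@compb_eq f g _ _)
  | |- comp (fun A x => count (@?b A x) (iota 0 (@?g A x))) =>
      refine (@comp_count b g _ _)
  | |- compb (fun A x => has (@?b A x) (iota 0 (@?g A x))) =>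
      refine (@compb_has b g _ _)
  | |- compb (fun A x => all (@?b A x) (iota 0 (@?g A x))) =>
      refine (@compb_all b g _ _)
  | |- comp (fun A x => find (@?b A x) (iota 0 (@?g A x))) =>
      refine (@comp_find b g _ _)
  end.

Lemma comp_half f : comp f -> comp (fun A x => (f A x)./2).
Proof.
move=> cf; apply: (@comp_ext (fun A x => f A x %/ 2)%N); first by move=> A x; rewrite divn2.
by comp_tac.
Qed.

Lemma compb_odd f : comp f -> compb (fun A x => odd (f A x)).
Proof.
move=> cf; apply: (@compb_ext (fun A x => f A x != f A x %/ 2 * 2)%N).
  by move=> A x; rewrite divn2 muln2 -{1}(odd_double_half (f A x)); case: odd => //=;
    [lia|rewrite eqxx].
by comp_tac.
Qed.

Lemma comp_trunc_log2 f : comp f -> comp (fun A x => trunc_log 2 (f A x)).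
Proof.
move=> cf; apply: (@comp_ext (fun A x => count (fun k => 2 ^ k.+1 <= f A x)%N (iota 0 (f A x)))).
  move=> A x; have [->|n0] := posnP (f A x); first by rewrite trunc_log0.
  rewrite (eq_count (a2 := fun k => k < trunc_log 2 (f A x))%N); last first.
    move=> k /=; apply/idP/idP; first exact: trunc_log_max.
    by move=> le; apply: leq_trans (trunc_logP (isT : 1 < 2)%N n0); rewrite leq_exp2l.
  have le : (trunc_log 2 (f A x) <= f A x)%N.
    by apply: leq_trans (trunc_logP (isT : 1 < 2)%N n0); apply: ltnW; apply: ltn_expl.
  exact: count_ltn.
by comp_tac.
Qed.

(* Evaluation with all unbounded searches cut at [t]: [0] means no result
   and [y.+1] means the result [y]. *)
Fixpoint beval (A : set nat) (e : machine) (t x : nat) : nat :=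
  match e with
  | Zero => 1
  | Succ => x.+2
  | Fst => (cfst x).+1
  | Snd => (csnd x).+1
  | Query => (x \in A).+1
  | Pair f g =>
      if (beval A f t x == 0) || (beval A g t x == 0) then 0
      else (cpair (beval A f t x).-1 (beval A g t x).-1).+1
  | Comp f g => if beval A g t x == 0 then 0 else beval A f t (beval A g t x).-1
  | PrimRec f g =>
      iteri (csnd x) (fun m y =>
        if y == 0 then 0 else beval A g t (cpair (cfst x) (cpair m y.-1)))
        (beval A f t (cfst x))
  | Mu f =>
      let m := find (fun m => beval A f t (cpair x m) <= 1) (iota 0 t) in
      if (m.+1 <= t) && (beval A f t (cpair x m) == 1) then m.+1 else 0
  end%N.

Lemma comp_beval e t x : comp t -> comp x -> comp (fun A z => beval A e (t A z) (x A z)).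
Proof.
elim: e t x => [||||| f IHf g IHg | f IHf g IHg | f IHf g IHg | f IHf] t x ct cx /=;
  comp_tac; first exact: comp_query;
  repeat first [refine (IHf _ _ _ _); comp_tac | refine (IHg _ _ _ _); comp_tac].
Qed.

Lemma beval_sound A e t x y : beval A e t x = y.+1 -> eval A e x y.
Proof.
elim: e x y => [||||| f IHf g IHg | f IHf g IHg | f IHf g IHg | f IHf] x y /=.
- by case=> <-; constructor.
- by case=> <-; constructor.
- by case=> <-; rewrite -{1}(cpairK x); constructor.
- by case=> <-; rewrite -{1}(cpairK x); constructor.
- by case=> <-; constructor.
- case E : (beval A f t x) => [|a] //; case E' : (beval A g t x) => [|b] //= -[<-].
  by constructor; [apply: IHf|apply: IHg].
- case E : (beval A g t x) => [|a] //= h.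
  by econstructor; [apply: IHg E|apply: IHf].
- rewrite -[X in eval _ _ X _]cpairK; elim: (csnd x) y => [|m IH] y /=.
    by move=> /IHf; constructor.
  move: IH; case: (iteri m _ _) => [|a] //= IH /IHg; apply: eval_PrimRecS.
  exact: IH.
(* The search stops at the first [m] with result 0 or with no result at all; the test against 1
   excludes the latter. Every smaller [k] has a positive result, read off as [.-2]. *)
- set m := find _ _; case: ifP => // /andP[mt /eqP e1] [<-].
  apply: (@eval_Mu _ _ _ _ (fun k => (beval A f t (cpair x k)).-2)).
    exact: IHf.
  move=> k km; apply: IHf; have := before_find 0 km.
  rewrite nth_iota ?add0n; last exact: ltn_trans km mt.
  by case: beval => [|[|?]].
Qed.

(** The result is claimed for all large [t], since subcomputations have different thresholds and
    must run with a common bound. *)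
Lemma beval_complete A e x y : eval A e x y ->
  exists t0, forall t, (t0 <= t)%N -> beval A e t x = y.+1.
Proof.
elim=> {e x y} /=.
- by exists 0%N.
- by exists 0%N.
- by exists 0%N => t _; rewrite cpairE.
- by exists 0%N => t _; rewrite cpairE.
- by exists 0%N.
- move=> f g x a b _ [t1 H1] _ [t2 H2]; exists (maxn t1 t2) => t.
  by rewrite geq_max => /andP[/H1 -> /H2 ->].
- move=> f g x y z _ [t1 H1] _ [t2 H2]; exists (maxn t1 t2) => t.
  by rewrite geq_max => /andP[/H1 -> /H2 /= ->].
- by move=> f g a y _ [t1 H1]; exists t1 => t /H1; rewrite !cpairE.
- move=> f g a m y z _ [t1 H1] _ [t2 H2]; exists (maxn t1 t2) => t.
  by rewrite geq_max => /andP[/H1 + /H2]; rewrite !cpairE /= => -> /=.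
- move=> f a m y _ [t1 H1] _ H.
  have [t2 H2] : exists t2, forall k, (k < m)%N -> forall t, (t2 <= t)%N ->
      beval A f t (cpair a k) = (y k).+2.
    elim: m H {H1} => [|m IH] H; first by exists 0%N.
    have [t2 H2] := IH (fun k km => H k (ltnW km)); have [t3 H3] := H m (ltnSn m).
    exists (maxn t2 t3) => k; rewrite ltnS leq_eqVlt => km t.
    rewrite geq_max => /andP[h2 h3]; case/orP: km => [/eqP->|km]; first exact: H3.
    exact: H2.
  exists (maxn m.+1 (maxn t1 t2)) => t; rewrite !geq_max => /and3P[mt h1 h2].
  suff -> : find (fun k => beval A f t (cpair a k) <= 1)%N (iota 0 t) = m.
    by rewrite mt H1.
  have -> : iota 0 t = iota 0 m ++ m :: iota m.+1 (t - m.+1).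
    by rewrite -[in LHS](subnKC mt) addSnnS iotaD.
  rewrite find_cat size_iota; case: hasP => /= [[k]|_]; last by rewrite H1 // addn0.
  by rewrite mem_iota => /andP[_ /= km]; rewrite H2.
Qed.

Lemma eval_det A e x y y' : eval A e x y -> eval A e x y' -> y = y'.
Proof.
move=> /beval_complete[t1 H1] /beval_complete[t2 H2].
have := H1 _ (leq_maxl t1 t2); rewrite (H2 _ (leq_maxr t1 t2)) => -[].
by [].
Qed.

(** * A prefix-free machine for enumerated sets *)

(** Number of binary digits, with value 1 at 0. It stands for the logarithm and, being positive,
    absorbs additive constants. *)
Definition ell (x : nat) : nat := (trunc_log 2 x + 1)%N.

Lemma ltn_ell x : (x < 2 ^ ell x)%N.
Proof. by rewrite /ell addn1 trunc_log_ltn. Qed.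

Lemma comp_ell f : comp f -> comp (fun A x => ell (f A x)).
Proof. by move=> cf; rewrite /ell; comp_tac; apply: comp_trunc_log2. Qed.

Fixpoint bin (a v : nat) : seq bool :=
  if a is a'.+1 then rcons (bin a' v./2) (odd v) else [::].

Lemma size_bin a v : size (bin a v) = a.
Proof. by elim: a v => //= a IH v; rewrite size_rcons IH. Qed.

Lemma code_str_rcons s b : (code_str (rcons s b)).+1 = ((code_str s).+1.*2 + b)%N.
Proof. by rewrite /code_str -cats1 foldl_cat /=; lia. Qed.

(** In bijective numeration [(code_str s).+1] has the binary expansion 1 followed by [s], so
    appending [a] digits is a shift and an addition. *)
Lemma code_str_bin s a v : (v < 2 ^ a)%N ->
  (code_str (s ++ bin a v)).+1 = ((code_str s).+1 * 2 ^ a + v)%N.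
Proof.
elim: a v => [|a IH] v /= va; first by move: va; rewrite cats0; lia.
rewrite -rcons_cat code_str_rcons IH; last by move: va; rewrite expnS; lia.
by rewrite expnS; have := odd_double_half v; lia.
Qed.

Lemma code_str_size p : (2 ^ size p <= (code_str p).+1 < 2 ^ (size p).+1)%N.
Proof.
elim/last_ind: p => // p b; rewrite code_str_rcons size_rcons !expnS.
by case: b => /=; lia.
Qed.

Lemma code_str_inj : injective code_str.
Proof.
elim/last_ind=> [|p b IH]; elim/last_ind=> [|p' b' _] // /(congr1 S);
  rewrite !code_str_rcons; first by case: b' => /=; rewrite /code_str /=; lia.
  by case: b => /=; rewrite /code_str /=; lia.
by move=> e; have [/IH -> ->] : code_str p = code_str p' /\ b = b';
  case: b b' e => -[] //=; lia.
Qed.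

Lemma bin_inj a v v' : (v < 2 ^ a)%N -> (v' < 2 ^ a)%N -> bin a v = bin a v' -> v = v'.
Proof. by move=> va va' e; have := code_str_bin [::] va; rewrite e code_str_bin //; lia. Qed.

(* A program consists of the length of [v] in unary, then [v] and finally [i]
   written with [cfst v] bits. *)
Definition program (v i : nat) : seq bool :=
  nseq (ell v) false ++ true :: bin (ell v) v ++ bin (cfst v) i.

Lemma size_program v i : size (program v i) = ((ell v).*2.+1 + cfst v)%N.
Proof. by rewrite /program size_cat /= size_cat size_nseq !size_bin; lia. Qed.

Lemma code_program v i : (i < 2 ^ cfst v)%N ->
  (code_str (program v i)).+1 =
  (((2 ^ ell v * 2 + 1) * 2 ^ ell v + v) * 2 ^ cfst v + i)%N.
Proof.
move=> iv; rewrite /program -cat_rcons catA code_str_bin // code_str_bin ?ltn_ell //.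
suff E a : (code_str (nseq a false)).+1 = (2 ^ a)%N by rewrite code_str_rcons E -muln2.
elim: a => // a IH; rewrite -[a.+1]addn1 nseqD cats1 code_str_rcons IH addn1 expnS /=.
by rewrite addn0 mul2n.
Qed.

(** A program delimits itself: the first [true] reveals the length of [v], and [v] reveals the
    length of the rest. *)
Lemma program_prefix v i v' i' : (i < 2 ^ cfst v)%N -> (i' < 2 ^ cfst v')%N ->
  prefix (program v i) (program v' i') -> v = v' /\ i = i'.
Proof.
move=> iv iv' /prefixP[s]; rewrite /program -!catA /=.
have H a a' t t' : nseq a false ++ true :: t = nseq a' false ++ true :: t' ->
    a = a' /\ t = t'.
  elim: a a' => [|a IH] [|a'] //=; first by case.
  by case=> /IH[-> ->].
move=> /H[ea /eqP]. rewrite -catA eqseq_cat ?size_bin // => /andP[/eqP e1 e2].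
move: e1; rewrite -ea => /bin_inj; rewrite {2}ea !ltn_ell => /(_ isT isT) e1.
subst v'; split=> //; move: e2; rewrite -[bin _ i']cats0 eqseq_cat ?size_bin //.
by case/andP=> /eqP/bin_inj->.
Qed.

Section Coding.

(** [D A v tau y w]: the number [w] witnesses that [y] belongs to the set enumerated with parameter
    [v] and condition [tau]. *)
Variable D : set nat -> nat -> nat -> nat -> nat -> bool.

(** Here [w] codes an element together with a witness. Keeping only the least code for each element
    makes ranks count elements rather than witnesses. *)
Definition first_witness A v tau w : bool :=
  D A v tau (cfst w) (csnd w) &&
  all (fun w' => ~~ (D A v tau (cfst w') (csnd w') && (cfst w' == cfst w))) (iota 0 w).

Lemma first_witness_inj A v tau w w' :
  first_witness A v tau w -> first_witness A v tau w' -> cfst w = cfst w' -> w = w'.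
Proof.
wlog le : w w' / (w <= w')%N.
  by move=> W; case: (leqP w w') => [|/ltnW] /W H h h' e; last symmetry; apply: H.
move=> /andP[d _] /andP[_ /allP a] e; move: le; rewrite leq_eqVlt => /orP[/eqP//|lt].
by have := a w; rewrite mem_iota lt d e eqxx => /(_ isT).
Qed.

Lemma first_witness_ex A v tau y w : D A v tau y w ->
  exists w', first_witness A v tau w' /\ cfst w' = y.
Proof.
move=> d; have ex : exists w', D A v tau (cfst w') (csnd w') && (cfst w' == y).
  by exists (cpair y w); rewrite !cpairE d eqxx.
case: (ex_minnP ex) => m /andP[dm /eqP em] min; exists m; split=> //.
rewrite /first_witness dm; apply/allP => w'; rewrite mem_iota em => /andP[_ lt].
by apply/negP => /min; rewrite leqNgt lt.
Qed.

Lemma count_first_witness_lt A v tau w w' : first_witness A v tau w -> (w < w')%N ->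
  (count (first_witness A v tau) (iota 0 w) < count (first_witness A v tau) (iota 0 w'))%N.
Proof.
move=> f lt; rewrite -(subnKC lt) iotaD count_cat -[w.+1]addn1 iotaD count_cat /= f.
by rewrite addn0 -addnA -[X in (X < _)%N]addn0 ltn_add2l.
Qed.

(* [x] codes a program, and [m] its parameters followed by the first witness of
   the element it describes: the one of rank [i] in order of enumeration. *)
Definition decodes A x tau m : bool :=
  let v := cfst (cfst m) in let i := csnd (cfst m) in
  [&& x.+1 == ((2 ^ ell v * 2 + 1) * 2 ^ ell v + v) * 2 ^ cfst v + i,
      i.+1 <= 2 ^ cfst v, first_witness A (csnd v) tau (csnd m) &
      count (first_witness A (csnd v) tau) (iota 0 (csnd m)) == i]%N.

Lemma decodesP A p tau m : decodes A (code_str p) tau m ->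
  let v := cfst (cfst m) in let i := csnd (cfst m) in
  [/\ p = program v i, (i < 2 ^ cfst v)%N, first_witness A (csnd v) tau (csnd m) &
      count (first_witness A (csnd v) tau) (iota 0 (csnd m)) = i].
Proof.
case/and4P=> /eqP e lt f /eqP c; split=> //.
by apply: code_str_inj; apply: succn_inj; rewrite e code_program.
Qed.

Hypothesis compD : forall v tau y w, comp v -> comp tau -> comp y -> comp w ->
  compb (fun A x => D A (v A x) (tau A x) (y A x) (w A x)).

Lemma comp_first_witness v tau w : comp v -> comp tau -> comp w ->
  compb (fun A x => first_witness A (v A x) (tau A x) (w A x)).
Proof.
move=> cv ct cw; rewrite /first_witness; comp_tac; apply: compD; comp_tac.
Qed.

Lemma comp_decodes : compb (fun A x => decodes A (cfst (cfst x)) (csnd (cfst x)) (csnd x)).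
Proof.
rewrite /decodes; comp_tac; try apply: comp_ell; try apply: comp_first_witness; comp_tac.
Qed.

(** The machine searches for the least [m] accepted by [decodes] and extracts the element. It halts
    only on programs [program v i] with [i] in range, and these are prefix-free whatever the
    oracle. *)
Lemma decoderP : exists M, prefix_free M /\
  forall A p tau m, decodes A (code_str p) tau m ->
    exists2 m', decodes A (code_str p) tau m' & outputs A M p tau (cfst (csnd m')).
Proof.
have [eT HT] := compb_not comp_decodes.
have [eP HP] : comp (fun _ m => cfst (csnd m)) by comp_tac.
exists (Comp eP (Mu eT)); split.
  have sound A p tau sigma : outputs A (Comp eP (Mu eT)) p tau sigma ->
      exists m, decodes A (code_str p) tau m.
    move=> h; inversion h as [| | | | | |f g x y z hg hf| | |]; subst; exists y.
    have h0 : eval A eT (cpair (cpair (code_str p) tau) y) 0 by inversion hg.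
    have := HT A (cpair (cpair (code_str p) tau) y).
    by move=> /(eval_det h0); rewrite !cpairE; case: decodes.
  move=> A tau p p' sigma sigma' /sound[m /decodesP[-> i1 _ _]] /sound[m' /decodesP[-> i2 _ _]].
  by move=> /program_prefix => /(_ i1 i2)[-> ->].
move=> A p tau m dm; have ex : exists m, decodes A (code_str p) tau m by exists m.
case: (ex_minnP ex) => m' dm' min; exists m' => //; apply: eval_Comp (HP A m').
apply: (@eval_Mu _ _ _ _ (fun=> 0%N)).
  by have := HT A (cpair (cpair (code_str p) tau) m'); rewrite !cpairE dm'.
move=> k km; have := HT A (cpair (cpair (code_str p) tau) k); rewrite !cpairE.
by case: (boolP (decodes _ _ _ k)) => // /min; rewrite leqNgt km.
Qed.

End Coding.

(** * Complexity of the members of a small enumerated set *)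

Lemma least_le (X : set nat) k : X k -> (least X <= k)%N.
Proof.
move=> Xk; have ex : exists k, `[< X k >] by exists k; apply/asboolP.
rewrite /least; case: (ex_minnP ex) => m /asboolP Xm min.
have P : [set m | X m /\ forall k, X k -> (m <= k)%N] m.
  by split=> // j Xj; apply: min; apply/asboolP.
by case: (xgetI 0%N P) => _; apply.
Qed.

Lemma least_in (X : set nat) k : X k -> X (least X).
Proof.
move=> Xk; have ex : exists k, `[< X k >] by exists k; apply/asboolP.
rewrite /least; case: (ex_minnP ex) => m /asboolP Xm min.
have P : [set m | X m /\ forall k, X k -> (m <= k)%N] m.
  by split=> // j Xj; apply: min; apply/asboolP.
by case: (xgetI 0%N P).
Qed.

Lemma ell_gt0 x : (0 < ell x)%N.
Proof. by rewrite /ell addn1. Qed.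

Lemma ell_le x k : (0 < k)%N -> (x < 2 ^ k)%N -> (ell x <= k)%N.
Proof.
move=> k0 xk; rewrite /ell addn1; have [->|x0] := posnP x; first by rewrite trunc_log0.
by rewrite -(ltn_exp2l (m := 2)) // (leq_ltn_trans _ xk) // trunc_logP.
Qed.

Lemma ell_leq x y : (x <= y)%N -> (ell x <= ell y)%N.
Proof. by move=> xy; apply: ell_le (ell_gt0 y) _; apply: leq_ltn_trans xy (ltn_ell y). Qed.

Lemma ltn_add_mul x y a b : (x < a)%N -> (y < b)%N -> (x + y < a * b)%N.
Proof. by case: a b => [|a] [|b] // xa yb; rewrite mulSn mulnS; lia. Qed.

Lemma ell_add x y : (ell (x + y) <= ell x + ell y)%N.
Proof.
apply: ell_le; first by rewrite addn_gt0 ell_gt0.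
by rewrite expnD ltn_add_mul ?ltn_ell.
Qed.

Lemma ellS x : (ell x.+1 <= (ell x).+1)%N.
Proof. by have := ell_add 1 x; rewrite add1n. Qed.

Lemma ell_mul x y : (ell (x * y) <= ell x + ell y)%N.
Proof.
apply: ell_le; first by rewrite addn_gt0 ell_gt0.
by rewrite expnD ltn_mul ?ltn_ell.
Qed.

Lemma ell_le_id x : (ell x <= x.+1)%N.
Proof. by apply: ell_le => //; apply: ltn_trans (ltn_expl x.+1 (isT : 1 < 2)%N). Qed.

Lemma ell_cpair a b : (ell (cpair a b) <= 2 * (ell a + ell b))%N.
Proof.
apply: ell_le; first by rewrite muln_gt0 addn_gt0 ell_gt0.
have le : (a + b < 2 ^ (ell a + ell b))%N.
  by rewrite expnD ltn_add_mul ?ltn_ell.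
apply: leq_ltn_trans (_ : (a + b) ^ 2 + (a + b) < _)%N.
  have := odd_double_half ((a + b).+1 * (a + b)); rewrite /cpair bin2 /= expnS expn1.
  by case: (a + b)%N (leq_addl a b) => [|k]; nia.
rewrite mulnC expnM; case: (2 ^ _)%N le => // N; rewrite ltnS => le; nia.
Qed.

(** Counting by labels, where a label determines its element. A relation suffices, as one label per
    element can be chosen. The labels below are programs, heights and residues. *)
Lemma card_key (T : finType) (P : nat -> T -> Prop) (ys : seq nat) :
  (forall y, y \in ys -> exists k, P y k) ->
  (forall y y' k, P y k -> P y' k -> y = y') ->
  uniq ys -> (size ys <= #|T|)%N.
Proof.
move=> ex inj u; pose key y := [pick k | `[< P y k >]].
have keyP y : y \in ys -> exists2 k, key y = Some k & P y k.
  move=> /ex[k Pk]; rewrite /key; case: pickP => [k' /asboolP Pk'|/(_ k)/asboolP//].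
  by exists k'.
have -> : #|T| = size [seq Some k | k <- enum T] by rewrite size_map cardT.
rewrite -(size_map key); apply: uniq_leq_size.
  rewrite map_inj_in_uniq // => y y' /keyP[k -> Pk] /keyP[k' -> Pk'] [e].
  by apply: inj Pk _; rewrite e.
by move=> _ /mapP[y /keyP[k -> _] ->]; rewrite map_f ?mem_enum.
Qed.

Section Complexity.

Variables (U : machine) (hU : universal_prefix_free U).

(** The element of rank [i] gets the program [program (cpair e v) i], which ends with [e] bits for
    [i]. The rank is below [2 ^ e] because the elements enumerated so far are distinct. The constant
    depends only on [U] and [D]; the parameters pay for themselves by their lengths. *)
Lemma coding_program (D : set nat -> nat -> nat -> nat -> nat -> bool) :
  (forall v tau y w, comp v -> comp tau -> comp y -> comp w ->
    compb (fun A x => D A (v A x) (tau A x) (y A x) (w A x))) ->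
  exists c, forall A v tau e y w,
    (forall ys, uniq ys -> (forall y', y' \in ys -> exists w', D A v tau y' w') ->
      (size ys <= 2 ^ e)%N) ->
    D A v tau y w ->
    exists2 p, outputs A U p tau y & (size p <= e + c * (ell v + ell e))%N.
Proof.
move=> compD; have [M [Mpf HM]] := decoderP compD; have [rho Hrho] := hU.2 M Mpf.
exists (size rho + 5)%N => A v tau e y w bound d.
have [m [fm my]] := first_witness_ex d.
pose i := count (first_witness D A v tau) (iota 0 m).
have ie : (i < 2 ^ e)%N.
  pose ws := [seq w' <- iota 0 m.+1 | first_witness D A v tau w'].
  have <- : size (map cfst ws) = i.+1.
    rewrite size_map size_filter -addn1 iotaD count_cat /= fm.
    by rewrite addn0 addn1.
  apply: bound.
    rewrite map_inj_in_uniq ?filter_uniq ?iota_uniq // => w1 w2.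
    by rewrite !mem_filter => /andP[f1 _] /andP[f2 _]; apply: first_witness_inj f1 f2.
  move=> y' /mapP[w']; rewrite mem_filter => /andP[/andP[dw' _] _] ->.
  by exists (csnd w').
pose V := cpair e v.
have dec : decodes D A (code_str (program V i)) tau (cpair (cpair V i) m).
  by apply/and4P; rewrite !cpairE code_program ?cpairE.
have [m' /decodesP dm' out] := HM _ _ _ _ dec.
case: dm' => ep im' fm' cm'.
have [eV ei] : V = cfst (cfst m') /\ i = csnd (cfst m').
  by apply: program_prefix; rewrite -?ep ?prefix_refl // cpairE.
(* Both are first witnesses of rank [i], and rank strictly increases along first witnesses. *)
have em : csnd m' = m.
  move: fm' cm'; rewrite -eV -ei {1 2}/V cpairE => fm' cm'.
  have [lt|gt|//] := ltngtP m (csnd m').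
    by have := count_first_witness_lt fm lt; rewrite cm' ltnn.
  by have := count_first_witness_lt fm' gt; rewrite cm' ltnn.
exists (rho ++ program V i); first by apply/Hrho; rewrite -my -em.
rewrite size_cat size_program cpairE; have := ell_cpair e v; have := ell_gt0 v.
by have := ell_gt0 e; rewrite /V; nia.
Qed.

(** A singleton is enumerated with its element as parameter. Hence [condK] is always a genuine
    minimum and never the default of [least]. *)
Lemma outputs_ex A tau y : exists p, outputs A U p tau y.
Proof.
have [|c H] := @coding_program (fun _ v _ y _ => y == v); first by move=> *; comp_tac.
have [||p] := H A y tau 0%N y 0%N; [|exact: eqxx|by exists p].
move=> [|a [|b ys]] //= /andP[+ _] ab; rewrite inE negb_or => /andP[/eqP[]].
have [_ /eqP->] := ab a (mem_head _ _).
by have [|_ /eqP->] := ab b; rewrite // !inE eqxx orbT.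
Qed.

Lemma condK_le A tau y p : outputs A U p tau y -> (condK U A y tau <= size p)%N.
Proof. by move=> o; apply: least_le; exists p. Qed.

Lemma condK_outputs A tau y : exists2 p, outputs A U p tau y & size p = condK U A y tau.
Proof.
have [p0 o0] := outputs_ex A tau y.
have [p o e] : [set size p | p in [set p | outputs A U p tau y]] (condK U A y tau).
  by apply: (@least_in _ (size p0)); exists p0.
by exists p.
Qed.

Lemma coding (D : set nat -> nat -> nat -> nat -> nat -> bool) :
  (forall v tau y w, comp v -> comp tau -> comp y -> comp w ->
    compb (fun A x => D A (v A x) (tau A x) (y A x) (w A x))) ->
  exists c, forall A v tau e y w,
    (forall ys, uniq ys -> (forall y', y' \in ys -> exists w', D A v tau y' w') ->
      (size ys <= 2 ^ e)%N) ->
    D A v tau y w ->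
    (condK U A y tau <= e + c * (ell v + ell e))%N.
Proof.
move=> /coding_program[c H]; exists c => A v tau e y w bound d.
by have [p /condK_le] := H A v tau e y w bound d; apply: leq_trans.
Qed.

Definition hit A T tau p y : bool := beval A U T (cpair p tau) == y.+1.

Lemma comp_hit T tau p y : comp T -> comp tau -> comp p -> comp y ->
  compb (fun A x => hit A (T A x) (tau A x) (p A x) (y A x)).
Proof. by move=> cT ct cp cy; rewrite /hit; comp_tac; apply: comp_beval; comp_tac. Qed.

Lemma hit_inj A T T' tau p y y' : hit A T tau p y -> hit A T' tau p y' -> y = y'.
Proof. by move=> /eqP/beval_sound h /eqP/beval_sound; apply: eval_det. Qed.

(** Programs of length at most [m] have codes below [2 ^ m.+1], and the bound on the code replaces
    the one on the length. Asking for all large [T] lets several descriptions share one time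
    bound. *)
Definition described A m tau y : Prop :=
  exists2 p, (p < 2 ^ m.+1)%N & exists T0, forall T, (T0 <= T)%N -> hit A T tau p y.

Lemma hit_described A m T tau p y :
  (p < 2 ^ m.+1)%N -> hit A T tau p y -> described A m tau y.
Proof.
move=> pm /eqP/beval_sound/beval_complete[T0 H]; exists p => //.
by exists T0 => T' /H e; apply/eqP.
Qed.

Lemma condK_described A tau y m : (condK U A y tau <= m)%N -> described A m tau y.
Proof.
have [p o <-] := condK_outputs A tau y => le; exists (code_str p).
  have /andP[_ h] := code_str_size p; apply: leq_trans (ltnW h) _.
  by rewrite leq_exp2l.
by have [T0 H] := beval_complete o; exists T0 => T /H e; apply/eqP.
Qed.

Lemma hit_count A tau m (ys : seq nat) : uniq ys ->
  (forall y, y \in ys -> exists T p, (p < 2 ^ m.+1)%N /\ hit A T tau p y) ->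
  (size ys <= 2 ^ m.+1)%N.
Proof.
move=> u h; rewrite -[X in (_ <= X)%N]card_ord.
apply: (@card_key _ (fun y (k : 'I_(2 ^ m.+1)) => exists T, hit A T tau k y)) => //.
  by move=> y /h[T [p [lt hp]]]; exists (Ordinal lt), T.
by move=> y y' k [T h1] [T' h2]; apply: hit_inj h1 h2.
Qed.

End Complexity.

(** * Symmetry of information *)

Ltac comp_user ::= match goal with
  | |- compb (fun A x => hit _ _ _ _ _ _) => refine (@comp_hit _ _ _ _ _ _ _ _ _)
  end.

Section Calculus.

Variables (U : machine) (hU : universal_prefix_free U).

(** A value of [f] is labelled by a program for [s] run on condition [g v tau 0]. The length bound
    [m] of that program is part of the parameter, which is where [ell] of the complexity comes
    from. *)
Lemma K_map (f g : nat -> nat -> nat -> nat) :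
  (forall v tau s, comp v -> comp tau -> comp s ->
    comp (fun A x => f (v A x) (tau A x) (s A x))) ->
  (forall v tau, comp v -> comp tau -> comp (fun A x => g (v A x) (tau A x) 0%N)) ->
  exists c, forall A v tau s,
    (condK U A (f v tau s) tau <=
     condK U A s (g v tau 0) + c * (ell v + ell (condK U A s (g v tau 0))))%N.
Proof.
move=> cf cg; pose D A v tau y w :=
  [&& (csnd (csnd w)).+1 <= 2 ^ (cfst v).+1,
      hit U A (cfst (csnd w)) (g (csnd v) tau 0) (csnd (csnd w)) (cfst w) &
      y == f (csnd v) tau (cfst w)]%N.
have [|c H] := coding hU (D := D).
  by move=> v tau y w cv ct cy cw; rewrite /D; comp_tac; [apply: cg|apply: cf]; comp_tac.
exists (6 * c + 1)%N => A v tau s; set m := condK _ _ s _.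
have [p pm [T hp]] := condK_described hU (leqnn m).
have {}H := H A (cpair m v) tau m.+1 (f v tau s) (cpair s (cpair T p)).
apply: leq_trans (H _ _) _.
- move=> ys u h; rewrite -[X in (_ <= X)%N]card_ord.
  apply: (@card_key _ (fun y (k : 'I_(2 ^ m.+1)) =>
    exists T s, hit U A T (g v tau 0) k s /\ y = f v tau s)) => //.
    move=> y /h[w]; rewrite /D !cpairE => /and3P[lt h1 /eqP ->].
    by exists (Ordinal lt), (cfst (csnd w)), (cfst w).
  by move=> y y' k [T1 [s1 [h1 ->]]] [T2 [s2 [/(hit_inj h1) <- ->]]].
- by rewrite /D !cpairE pm eqxx hp.
have := ell_cpair m v; have := ellS m.
by have := ell_gt0 m; have := ell_gt0 v; nia.
Qed.

(** A pair is labelled by a program for [a] and a program that yields [b] on condition [a]. Their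
    length bounds are the parameter, hence the logarithmic error. *)
Lemma K_chain : exists c, forall A a b,
  (K U A (cpair a b) <= K U A a + condK U A b a +
    c * (ell (K U A a) + ell (condK U A b a)))%N.
Proof.
pose D (A : set nat) v (tau : nat) y w :=
  [&& (cfst (csnd w)).+1 <= 2 ^ (cfst v).+1, (csnd (csnd w)).+1 <= 2 ^ (csnd v).+1,
      hit U A (cfst w) 0 (cfst (csnd w)) (cfst y) &
      hit U A (cfst w) (cfst y) (csnd (csnd w)) (csnd y)]%N.
have [|c H] := coding hU (D := D).
  by move=> v tau y w cv ct cy cw; rewrite /D; comp_tac.
exists (8 * c + 2)%N => A a b; set m1 := K U A a; set m2 := condK U A b a.
have [p1 lt1 [T1 h1]] := condK_described hU (leqnn m1).
have [p2 lt2 [T2 h2]] := condK_described hU (leqnn m2).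
have {}H := H A (cpair m1 m2) 0%N (m1.+1 + m2.+1)%N (cpair a b)
  (cpair (maxn T1 T2) (cpair p1 p2)).
apply: leq_trans (H _ _) _.
- move=> ys u h.
  have -> : (2 ^ (m1.+1 + m2.+1) = #|{: 'I_(2 ^ m1.+1) * 'I_(2 ^ m2.+1)}|)%N.
    by rewrite card_prod !card_ord expnD.
  apply: (@card_key _ (fun y (k : 'I_(2 ^ m1.+1) * 'I_(2 ^ m2.+1)) => exists T,
    hit U A T 0 k.1 (cfst y) /\ hit U A T (cfst y) k.2 (csnd y))) => //.
    move=> y /h[w]; rewrite /D !cpairE => /and4P[l1 l2 d1 d2].
    by exists (Ordinal l1, Ordinal l2), (cfst w).
  move=> y y' k [T [d1 d2]] [T' [/(hit_inj d1) e]]; rewrite -e => /(hit_inj d2) e'.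
  by rewrite -(cpairK y) -(cpairK y') e e'.
- by rewrite /D !cpairE lt1 lt2 h1 ?leq_maxl // h2 ?leq_maxr.
have := ell_cpair m1 m2; have := ellS m1; have := ellS m2.
have := ell_add m1.+1 m2.+1.
by have := ell_gt0 m1; have := ell_gt0 m2; nia.
Qed.

(** The Kolmogorov-Levin argument. Call [b'] a partner of [a] if [cpair a b'] has a program with
    code below [2 ^ m.+1], and let [e] be least such that [a] has at most [2 ^ e] partners. Then [b]
    costs [e] bits given [a]. As there are at most [2 ^ m.+1] such pairs, at most
    [2 ^ (m.+1 - e.-1)] numbers have [2 ^ e.-1] partners, and [a] is one of them. *)
Lemma K_pair_ge : exists c, forall A a b,
  (K U A a + condK U A b a <= K U A (cpair a b) + c * ell (K U A (cpair a b)))%N.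
Proof.
pose D1 (A : set nat) (m a b w : nat) :=
  [&& (csnd w).+1 <= 2 ^ m.+1 & hit U A (cfst w) 0 (csnd w) (cpair a b)]%N.
have [|c1 H1] := coding hU (D := D1).
  by move=> v tau y w cv ct cy cw; rewrite /D1; comp_tac.
(* Partners found within time [T]. Having [2 ^ e.-1] of them below [T] is decidable, with [T] as the
   witness for [a]. *)
pose sec A m T a b := has (fun p => hit U A T 0 p (cpair a b)) (iota 0 (2 ^ m.+1)).
pose D2 (A : set nat) v (tau a T : nat) :=
  (2 ^ csnd v <= count (sec A (cfst v) T a) (iota 0 T))%N.
have [|c2 H2] := coding hU (D := D2).
  by move=> v tau y w cv ct cy cw; rewrite /D2 /sec; comp_tac.
exists (10 * c1 + 10 * c2 + 4)%N => A a b; set m := K U A (cpair a b).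
pose sm e := forall ys, uniq ys ->
  (forall b', b' \in ys -> exists w, D1 A m a b' w) -> (size ys <= 2 ^ e)%N.
have pairs (ys : seq nat) : uniq ys -> (forall y, y \in ys -> exists w, D1 A m (cfst y) (csnd y) w) ->
    (size ys <= 2 ^ m.+1)%N.
  move=> u h; apply: (@hit_count U A 0%N) => // y /h[w /andP[lt hw]].
  by exists (cfst w), (csnd w); rewrite cpairK in hw.
have sm_m : sm m.+1.
  move=> ys u h; rewrite -(size_map (cpair a)); apply: pairs.
    by rewrite map_inj_uniq // => b1 b2 /cpair_inj[].
  by move=> _ /mapP[b' /h[w d] ->]; rewrite !cpairE; exists w.
have exsm : exists e, `[< sm e >] by exists m.+1; apply/asboolP.
case: (ex_minnP exsm) => e /asboolP sme emin.
have em : (e <= m.+1)%N by apply: emin; apply/asboolP.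
have [p pm [T0 hp]] := condK_described hU (leqnn m).
have D1b : D1 A m a b (cpair T0 p) by rewrite /D1 !cpairE pm hp.
have Kb := H1 A m a e b _ sme D1b.
(* Minimality of [e] provides the partners; for [e = 0] the single partner [b] is enough, as
   [0.-1 = 0]. *)
have [ys [uys hys lys]] : exists ys, [/\ uniq ys,
    forall b', b' \in ys -> exists w, D1 A m a b' w & (2 ^ e.-1 <= size ys)%N].
  case: e emin {sme em Kb} => [|e] emin.
    by exists [:: b]; split=> // b'; rewrite inE => /eqP->; exists (cpair T0 p).
  apply: contrapT => no; have /emin : `[< sm e >]; last by rewrite ltnn.
  apply/asboolP => ys u h; rewrite leqNgt; apply/negP => lt.
  by apply: no; exists ys; split=> //; apply: ltnW.
have [T TP] : exists T, D2 A (cpair m e.-1) 0%N a T.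
  have [T HT] : exists T, forall b', b' \in ys -> (b' < T)%N && sec A m T a b'.
    have Tb b' : exists T0, b' \in ys ->
        forall T, (T0 <= T)%N -> (b' < T)%N && sec A m T a b'.
      have [/hys[w /andP[lt h]]|_] := boolP (b' \in ys); last by exists 0%N.
      have [T1 HT1] := beval_complete (beval_sound (eqP h)).
      exists (maxn b'.+1 T1) => _ T; rewrite geq_max => /andP[-> /HT1 hT].
      by apply/hasP; exists (csnd w); rewrite ?mem_iota // /hit hT.
    have [TT HTT] := choice Tb; exists (\max_(b' <- ys) TT b') => b' b'ys.
    by apply: HTT => //; apply: leq_bigmax_seq.
  exists T; rewrite /D2 !cpairE -size_filter; apply: leq_trans lys _.
  apply: uniq_leq_size => // b' /HT/andP[lt h].
  by rewrite mem_filter h mem_iota.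
have Ka : (K U A a <= (m.+1 - e.-1) + c2 * (ell (cpair m e.-1) + ell (m.+1 - e.-1)))%N.
  apply: (H2 A (cpair m e.-1) 0%N (m.+1 - e.-1)%N a T) TP => xs uxs hxs.
  have Tx x : exists T, x \in xs -> D2 A (cpair m e.-1) 0%N x T.
    by have [/hxs[w hw]|_] := boolP (x \in xs); [exists w|exists 0%N].
  have [TT HTT] := choice Tx.
  pose Y x := [seq y <- iota 0 (TT x) | sec A m (TT x) x y].
  pose zs := [seq cpair x y | x <- xs, y <- Y x].
  have zs_le : (size zs <= 2 ^ m.+1)%N.
    apply: pairs => [|z /allpairsPdep[x [y [xxs + ->]]]].
      apply: allpairs_uniq_dep => // [x _|]; first by rewrite filter_uniq ?iota_uniq.
      by move=> [x y] [x' y'] _ _ /= /cpair_inj[-> ->].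
    rewrite mem_filter => /andP[/hasP[q + hq] _]; rewrite mem_iota => /andP[_ ltq].
    by exists (cpair (TT x) q); rewrite /D1 !cpairE hq andbT.
  have zs_ge : (size xs * 2 ^ e.-1 <= size zs)%N.
    rewrite size_allpairs_dep sumnE big_map -sum1_size big_distrl /= big_seq [leqRHS]big_seq.
    apply: leq_sum => x /HTT; rewrite /D2 !cpairE mul1n size_filter; apply.
  rewrite -(leq_pmul2r (m := 2 ^ e.-1)) ?expn_gt0 // -expnD subnK.
    exact: leq_trans zs_ge zs_le.
  by apply: leq_trans em; apply: leq_pred.
have := ell_cpair m e.-1; have := ell_leq em; have := ellS m.
have : (ell (m.+1 - e.-1) <= ell m.+1)%N by apply: ell_leq; apply: leq_subr.
have : (ell e.-1 <= ell e)%N by apply: ell_leq; apply: leq_pred.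
have := ell_gt0 m; rewrite -/(K U A (cpair a b)) -/m; move: Ka Kb.
move: (condK U A b a) (K U A a) (ell _) (ell _) (ell _) (ell _).
nia.
Qed.

End Calculus.

(** * Rational arithmetic by machines *)

(** Reading past the end gives 0, because [cfst 0 = csnd 0 = 0]; this agrees with the default of
    [nth]. *)
Definition entry (c k : nat) : nat := cfst (iter k (fun c' => csnd c'.-1) c).-1.

Lemma entry_code_seq s k : entry (code_seq s) k = nth 0%N s k.
Proof.
rewrite /entry; elim: k s => [|k IH] s; first by case: s => //= x s; rewrite cpairE.
rewrite iterSr; case: s => [|x s]; first by have := IH [::]; rewrite nth_nil.
by rewrite /= cpairE IH.
Qed.

Lemma comp_entry f k : comp f -> comp (fun A x => entry (f A x) k).
Proof.
move=> cf; rewrite /entry; comp_tac; elim: k => [|k IH] //=.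
by comp_tac.
Qed.

Lemma comp_code_seq (T : Type) (f : set nat -> nat -> T -> nat) s :
  (forall i, comp (fun A x => f A x i)) -> comp (fun A x => code_seq [seq f A x i | i <- s]).
Proof. by move=> cf; elim: s => [|i s IH] /=; comp_tac; apply: cf. Qed.

Definition dec_int (c : nat) : int := if odd c then Negz c./2 else Posz c./2.

Lemma code_intK : cancel code_int dec_int.
Proof. by case=> k; rewrite /dec_int /= odd_double /= ?uphalf_double ?doubleK. Qed.

Definition dec_rat (c : nat) : rat := (dec_int (cfst c))%:~R / (dec_int (csnd c))%:~R.

Lemma code_ratK : cancel code_rat dec_rat.
Proof. by move=> q; rewrite /dec_rat /code_rat !cpairE !code_intK divq_num_den. Qed.

(* Computable rational functions, represented by two numerators and a
   denominator: a natural number stands for the argument. *)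
Definition ratc (f : set nat -> nat -> rat) : Prop :=
  exists a b d, [/\ comp a, comp b, comp d &
    forall A x, (0 < d A x)%N /\ f A x = ((a A x)%:R - (b A x)%:R) / (d A x)%:R].

Lemma ratc_nat f : comp f -> ratc (fun A x => (f A x)%:R).
Proof.
move=> cf; exists f, (fun _ _ => 0%N), (fun _ _ => 1%N); split; comp_tac.
by move=> A x; rewrite divr1 subr0.
Qed.

Lemma ratc_opp f : ratc f -> ratc (fun A x => - f A x).
Proof.
move=> [a [b [d [ca cb cd H]]]]; exists b, a, d; split=> // A x.
by have [d0 ->] := H A x; rewrite -mulNr opprB.
Qed.

Lemma natr_gt0_neq0 n : (0 < n)%N -> n%:R != 0 :> rat.
Proof. by rewrite pnatr_eq0 lt0n. Qed.

Lemma ratc_add f g : ratc f -> ratc g -> ratc (fun A x => f A x + g A x).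
Proof.
move=> [a [b [d [ca cb cd H]]]] [a' [b' [d' [ca' cb' cd' H']]]].
exists (fun A x => a A x * d' A x + a' A x * d A x)%N,
  (fun A x => b A x * d' A x + b' A x * d A x)%N, (fun A x => d A x * d' A x)%N.
split; comp_tac => A x; have [d0 ->] := H A x; have [d0' ->] := H' A x.
rewrite muln_gt0 d0 d0'; split=> //; rewrite !natrD !natrM; field.
by rewrite !natr_gt0_neq0.
Qed.

Lemma ratc_mul f g : ratc f -> ratc g -> ratc (fun A x => f A x * g A x).
Proof.
move=> [a [b [d [ca cb cd H]]]] [a' [b' [d' [ca' cb' cd' H']]]].
exists (fun A x => a A x * a' A x + b A x * b' A x)%N,
  (fun A x => a A x * b' A x + b A x * a' A x)%N, (fun A x => d A x * d' A x)%N.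
split; comp_tac => A x; have [d0 ->] := H A x; have [d0' ->] := H' A x.
rewrite muln_gt0 d0 d0'; split=> //; rewrite !natrD !natrM; field.
by rewrite !natr_gt0_neq0.
Qed.

Lemma ratc_inv f : ratc f -> ratc (fun A x => (f A x)^-1).
Proof.
move=> [a [b [d [ca cb cd H]]]].
(* The sign of [a - b] decides which numerator receives [d], and the two truncated differences add
   up to the absolute value. At 0 the denominator 1 stays positive and yields the conventional
   inverse 0. *)
exists (fun A x => if (b A x).+1 <= a A x then d A x else 0)%N,
  (fun A x => if (a A x).+1 <= b A x then d A x else 0)%N,
  (fun A x => if a A x == b A x then 1 else (a A x - b A x) + (b A x - a A x))%N.
split; comp_tac => A x; have [d0 ->] := H A x; rewrite invf_div.
case: (ltngtP (a A x) (b A x)) => [lt|gt|->].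
- rewrite (eqP (ltnW lt)) add0n subn_gt0; split=> //.
  by rewrite natrB ?(ltnW lt) // sub0r -[in RHS]opprB invrN mulrNN.
- rewrite (eqP (ltnW gt)) addn0 subn_gt0; split=> //.
  by rewrite natrB ?(ltnW gt) // subr0.
- by split=> //; rewrite !subrr invr0 mulr0 mul0r.
Qed.

Lemma ratc_ext f g : (forall A x, f A x = g A x) -> ratc f -> ratc g.
Proof.
move=> e [a [b [d [ca cb cd H]]]]; exists a, b, d; split=> // A x.
by rewrite -e; apply: H.
Qed.

Lemma ratc_int f : comp f -> ratc (fun A x => (dec_int (f A x))%:~R).
Proof.
move=> cf; exists (fun A x => if odd (f A x) then 0 else (f A x)./2)%N,
  (fun A x => if odd (f A x) then (f A x)./2.+1 else 0)%N, (fun _ _ => 1%N).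
split; comp_tac; try (by apply: compb_odd); try (by apply: comp_half).
by move=> A x; split=> //; rewrite /dec_int divr1; case: odd; rewrite ?sub0r ?subr0.
Qed.

Lemma ratc_dec_rat f : comp f -> ratc (fun A x => dec_rat (f A x)).
Proof.
move=> cf; rewrite /dec_rat.
by apply: ratc_mul; [|apply: ratc_inv]; apply: ratc_int; comp_tac.
Qed.

Lemma ratc_const (q : rat) : ratc (fun _ _ => q).
Proof.
by apply: (ratc_ext (f := fun _ _ => dec_rat (code_rat q))) => [A x|];
  [exact: code_ratK|apply: ratc_dec_rat; comp_tac].
Qed.

Lemma ratc_sum (T : Type) (s : seq T) (f : set nat -> nat -> T -> rat) :
  (forall i, ratc (fun A x => f A x i)) -> ratc (fun A x => \sum_(i <- s) f A x i).
Proof.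
move=> cf; elim: s => [|i s IH].
  by apply: ratc_ext (ratc_const 0) => A x; rewrite big_nil.
by apply: ratc_ext (ratc_add (cf i) IH) => A x; rewrite big_cons.
Qed.

Lemma comp_truncn f : ratc f -> comp (fun A x => Num.truncn (f A x)).
Proof.
move=> [a [b [d [ca cb cd H]]]].
apply: (@comp_ext (fun A x => (a A x - b A x) %/ d A x)%N); last first.
  by comp_tac => A x; have [] := H A x.
move=> A x; have [d0 ->] := H A x; set t := Num.truncn _; set q := (_ %/ _)%N.
have E n : (n < q)%N = (n < t)%N.
  rewrite /q /t leq_divRL // truncn_gt_nat ler_pdivlMr ?ltr0n //.
  by rewrite lerBrDr -natrM -natrD ler_nat; apply/idP/idP; nia.
have := E q; have := E t; rewrite !ltnn; lia.
Qed.

Lemma coprime_div_gcd m d : (0 < d)%N -> coprime (m %/ gcdn m d) (d %/ gcdn m d).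
Proof.
move=> d0; have g0 : (0 < gcdn m d)%N by rewrite gcdn_gt0 d0 orbT.
rewrite /coprime -(eqn_pmul2r g0) muln_gcdl !divnK ?dvdn_gcdl ?dvdn_gcdr //.
by rewrite mul1n.
Qed.

(** [d] divides [m * k] exactly when the reduced denominator divides [k], so a bounded search finds
    it without a machine for the gcd. *)
Lemma find_reduced_den m d : (0 < d)%N ->
  find (fun k => d %| m * k.+1)%N (iota 0 d) = (d %/ gcdn m d).-1.
Proof.
move=> d0; have g0 : (0 < gcdn m d)%N by rewrite gcdn_gt0 d0 orbT.
have q0 : (0 < d %/ gcdn m d)%N by rewrite divn_gt0 // dvdn_leq // dvdn_gcdr.
have qd : (d %/ gcdn m d <= d)%N by apply: leq_div.
have E k : (d %| m * k)%N = (d %/ gcdn m d %| k)%N.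
  have ed := divnK (dvdn_gcdr m d); have em := divnK (dvdn_gcdl m d).
  rewrite -[X in (X %| _)%N = _]ed -[X in (_ %| X * _)%N]em mulnAC dvdn_pmul2r //.
  by rewrite Gauss_dvdr // coprime_sym coprime_div_gcd.
have -> : iota 0 d = iota 0 (d %/ gcdn m d).-1 ++
    (d %/ gcdn m d).-1 :: iota (d %/ gcdn m d) (d - d %/ gcdn m d).
  rewrite -[in LHS](subnKC qd) -{1}(prednK q0) addSnnS iotaD add0n /=.
  by rewrite prednK.
rewrite find_cat size_iota; case: hasP => [[k]|_] /=; last by rewrite E prednK ?dvdnn ?addn0.
by rewrite mem_iota add0n E => /andP[_ lt] /dvdn_leq; lia.
Qed.

(** [code_rat] uses lowest terms, so the fraction is reduced first. A numerator [- n'] with [n' > 0]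
    is [Negz n'.-1], with code [2 * n' - 1]. *)
Lemma comp_code_rat f : ratc f -> comp (fun A x => code_rat (f A x)).
Proof.
move=> [a [b [d [ca cb cd H]]]].
pose m A x := (a A x - b A x + (b A x - a A x))%N.
pose den A x := (find (fun k => m A x * k.+1 == m A x * k.+1 %/ d A x * d A x)
  (iota 0 (d A x))).+1%N.
pose num A x := (m A x * den A x %/ d A x)%N.
apply: (@comp_ext (fun A x =>
  cpair (if a A x < b A x then 2 * num A x - 1 else 2 * num A x) (2 * den A x))%N); last first.
  by rewrite /num /den /m; comp_tac => A x; have [] := H A (cfst x); have [] := H A x.
move=> A x; have [d0 ->] := H A x; set g := gcdn (m A x) (d A x).
have g0 : (0 < g)%N by rewrite gcdn_gt0 d0 orbT.
have q0 : (0 < d A x %/ g)%N by rewrite divn_gt0 // dvdn_leq // dvdn_gcdr.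
have eden : den A x = (d A x %/ g)%N.
  rewrite -(prednK q0) -find_reduced_den //; congr S; apply: eq_find => k.
  by rewrite dvdn_eq eq_sym.
have enum_ : num A x = (m A x %/ g)%N.
  rewrite /num eden -[X in (X * _)%N](divnK (dvdn_gcdl (m A x) (d A x))) -/g.
  by rewrite mulnAC -mulnA divnK ?dvdn_gcdr // mulnK.
rewrite eden enum_; set n' := (m A x %/ g)%N; set d' := (d A x %/ g)%N.
have co : coprime n' d' by apply: coprime_div_gcd.
have ed : (d A x)%:R = d'%:R * g%:R :> rat by rewrite -natrM divnK ?dvdn_gcdr.
have em : (m A x)%:R = n'%:R * g%:R :> rat by rewrite -natrM divnK ?dvdn_gcdl.
have g1 := natr_gt0_neq0 g0; have d1 : d'%:R != 0 :> rat by apply: natr_gt0_neq0.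
have red (z : int) : `|z|%N = n' -> code_rat (z%:~R / (Posz d')%:~R) =
    cpair (code_int z) (2 * d')%N.
  move=> ez; rewrite /code_rat coprimeq_num ?coprimeq_den ?ez //=.
  by rewrite gtr0_sg ?mul1r ?ltz_nat // eqz_nat (gtn_eqF q0) mul2n.
have [lt|ge] := ltnP (a A x) (b A x).
  have em' : (b A x)%:R - (a A x)%:R = n'%:R * g%:R :> rat.
    by rewrite -em /m (eqP (ltnW lt)) add0n natrB ?(ltnW lt).
  have n0 : (0 < n')%N.
    by rewrite lt0n; apply/eqP => n0; move: em'; rewrite n0 mul0r => /eqP;
      rewrite subr_eq0 eqr_nat gtn_eqF.
  have -> : ((a A x)%:R - (b A x)%:R) / (d A x)%:R = (- Posz n')%:~R / (Posz d')%:~R :> rat.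
    by rewrite ed -opprB em' mulrNz -!pmulrn; field; rewrite g1 d1.
  rewrite red ?abszN //; congr cpair.
  by case: n' n0 {em em' co red} => // k _ /=; lia.
have -> : ((a A x)%:R - (b A x)%:R) / (d A x)%:R = (Posz n')%:~R / (Posz d')%:~R :> rat.
  have em' : (a A x)%:R - (b A x)%:R = n'%:R * g%:R :> rat.
    by rewrite -em /m (eqP ge) addn0 natrB.
  by rewrite ed em' -!pmulrn; field; rewrite g1 d1.
by rewrite red //= mul2n.
Qed.

(** * Lines on an integer grid *)

Definition tuple_code (n : nat) (f : 'I_n -> nat) : nat := code_seq [seq f k | k <- enum 'I_n].

Lemma entry_tuple n (f : 'I_n -> nat) (k : 'I_n) : entry (tuple_code f) k = f k.
Proof.
rewrite /tuple_code entry_code_seq (nth_map k) ?nth_ord_enum //.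
by rewrite size_enum_ord.
Qed.

Lemma comp_tuple n (f : set nat -> nat -> 'I_n -> nat) :
  (forall i, comp (fun A x => f A x i)) -> comp (fun A x => tuple_code (f A x)).
Proof. exact: comp_code_seq. Qed.

Lemma compb_all_seq (T : Type) (f : set nat -> nat -> T -> bool) s :
  (forall i, compb (fun A x => f A x i)) -> compb (fun A x => all (f A x) s).
Proof. by move=> cf; elim: s => [|i s IH] /=; comp_tac; apply: cf. Qed.

(* A line is given by its points at the two ends of a unit interval of heights,
   and [j] is a height in this interval, all at scale [2 ^- r]. *)
Definition incident (n E r j u lam : nat) : bool :=
  all (fun k : 'I_n =>
    let m := ((2 ^ r - j) * entry (cfst lam) k + j * entry (csnd lam) k)%N in
    (m <= 2 ^ r * entry u k + E * 2 ^ r) && (2 ^ r * entry u k <= m + E * 2 ^ r))%N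
  (enum 'I_n).

(** Different numbers may share their first [n] entries; validity singles out the canonical code,
    which the entries determine. *)
Definition valid_line (n lam : nat) : bool :=
  lam == cpair (tuple_code (fun k : 'I_n => entry (cfst lam) k))
               (tuple_code (fun k : 'I_n => entry (csnd lam) k)).

Lemma comp_incident n E r j u lam : comp r -> comp j -> comp u -> comp lam ->
  compb (fun A x => incident n E (r A x) (j A x) (u A x) (lam A x)).
Proof.
move=> cr cj cu cl; apply: compb_all_seq => k /=; comp_tac; apply: comp_entry; comp_tac.
Qed.

Lemma comp_valid_line n lam : comp lam -> compb (fun A x => valid_line n (lam A x)).
Proof.
by move=> cl; rewrite /valid_line; comp_tac; apply: comp_tuple => k;
  apply: comp_entry; comp_tac.
Qed.

Lemma valid_line_inj n lam lam' : valid_line n lam -> valid_line n lam' ->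
  (forall k : 'I_n, entry (cfst lam) k = entry (cfst lam') k) ->
  (forall k : 'I_n, entry (csnd lam) k = entry (csnd lam') k) -> lam = lam'.
Proof.
move=> /eqP vl /eqP vl' ec ed; rewrite vl vl' /tuple_code.
by congr (cpair (code_seq _) (code_seq _)); apply/eq_map => k.
Qed.

(** Cramer's rule: eliminating one unknown leaves the other with factor [P * (j2 - j1)], up to sign,
    and the multipliers used are at most [P]. *)
Lemma cross_bound (P j1 j2 g M x y : int) : 0 < P -> 0 <= j1 <= P -> 0 <= j2 <= P ->
  g <= `|j2 - j1| ->
  `|(P - j1) * x + j1 * y| <= M * P -> `|(P - j2) * x + j2 * y| <= M * P ->
  g * `|x| <= 2 * M * P /\ g * `|y| <= 2 * M * P.
Proof.
move=> P0 /andP[j10 j1P] /andP[j20 j2P] gj h1 h2.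
have MP : 0 <= M * P by apply: le_trans (normr_ge0 _) h1.
have key (a b z : int) : 0 <= a <= P -> 0 <= b <= P ->
    a * ((P - j1) * x + j1 * y) - b * ((P - j2) * x + j2 * y) = P * ((j2 - j1) * z) ->
    g * `|z| <= 2 * M * P.
  move=> /andP[a0 aP] /andP[b0 bP] e; rewrite -(ler_pM2l P0).
  apply: le_trans (_ : P * `|(j2 - j1) * z| <= _).
    by rewrite ler_pM2l // normrM ler_wpM2r.
  rewrite -[X in X * _](gtr0_norm P0) -normrM -e; apply: le_trans (ler_normB _ _) _.
  rewrite !normrM (ger0_norm a0) (ger0_norm b0).
  have -> : P * (2 * M * P) = P * (M * P) + P * (M * P) by ring.
  by apply: lerD; apply: ler_pM.
split; first by apply: (key j2 j1); rewrite ?j10 ?j20 //; ring.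
rewrite -normrN; apply: (key (P - j2) (P - j1)); last by ring.
  by rewrite subr_ge0 j2P gerBl.
by rewrite subr_ge0 j1P gerBl.
Qed.

Lemma incident_norm n E r j u lam lam' (k : 'I_n) :
  (j <= 2 ^ r)%N -> incident n E r j u lam -> incident n E r j u lam' ->
  `|((2 ^ r)%:Z - j%:Z) * ((entry (cfst lam) k)%:Z - (entry (cfst lam') k)%:Z) +
     j%:Z * ((entry (csnd lam) k)%:Z - (entry (csnd lam') k)%:Z)|
    <= (2 * E)%:Z * (2 ^ r)%:Z.
Proof.
move=> jr /allP/(_ k (mem_enum _ _))/= /andP[a b] /allP/(_ k (mem_enum _ _))/= /andP[a' b'].
rewrite ler_norml; move: a b a' b'; move: (entry _ _) (entry _ _) (entry _ _) (entry _ _) (entry _ _).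
move: (2 ^ r)%N jr => P jr v1 v2 v3 v4 v5.
by move=> *; apply/andP; split; nia.
Qed.

(** The bounds force the distance of [x] and [y] below [W], where residues modulo [W] separate
    numbers. *)
Lemma ltn_window (g W x y : nat) (M : nat) : (M < g * W)%N ->
  g%:Z * `|x%:Z - y%:Z| <= M%:Z -> x = y %[mod W] -> x = y.
Proof.
move=> MgW; wlog le : x y / (y <= x)%N.
  move=> H; case: (leqP y x) => [|/ltnW] le; first exact: H.
  by rewrite distrC => /(H _ _ le) h /esym /h.
move=> h /eqP; rewrite eqn_mod_dvd // => /dvdn_leq d.
apply/eqP; rewrite eqn_leq le andbT -subn_eq0; apply/eqP.
case: (posnP (x - y)%N) => // /d {d} lt.
have : (g * (x - y) <= M)%N by move: h; rewrite subzn // normr_nat; lia.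
by move: MgW lt; nia.
Qed.

Ltac comp_user ::= match goal with
  | |- compb (fun A x => hit _ _ _ _ _ _) => refine (@comp_hit _ _ _ _ _ _ _ _ _)
  | |- compb (fun A x => incident _ _ _ _ _ _) => refine (@comp_incident _ _ _ _ _ _ _ _ _ _)
  | |- compb (fun A x => valid_line _ _) => refine (@comp_valid_line _ _ _)
  end.

Section IntegerLines.

Variables (U : machine) (hU : universal_prefix_free U) (n E : nat).

Definition far (e j1 j2 : nat) : bool :=
  ((2 ^ (e - 2) + j1 <= j2) || (2 ^ (e - 2) + j2 <= j1))%N.

(** Two candidates differ by at most [2 * E] grid units at both heights, hence by at most
    [4 * E * 2 ^ r / 2 ^ (e - 2)], that is [16 * E * 2 ^ (r - e)], at the ends. This is less than
    [W]. *)
Lemma line_through_two_points r e j1 j2 u1 u2 lam lam' (k : 'I_n) :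
  (2 <= e <= r)%N -> (j1 < 2 ^ r)%N -> (j2 < 2 ^ r)%N -> far e j1 j2 ->
  incident n E r j1 u1 lam -> incident n E r j2 u2 lam ->
  incident n E r j1 u1 lam' -> incident n E r j2 u2 lam' ->
  let W := (2 ^ (r - e + ell (16 * E)))%N in
  (entry (cfst lam) k = entry (cfst lam') k %[mod W] ->
     entry (cfst lam) k = entry (cfst lam') k) /\
  (entry (csnd lam) k = entry (csnd lam') k %[mod W] ->
     entry (csnd lam) k = entry (csnd lam') k).
Proof.
move=> /andP[e2 er] lt1 lt2 fr i1 i2 i1' i2' W.
have n1 := incident_norm k (ltnW lt1) i1 i1'.
have n2 := incident_norm k (ltnW lt2) i2 i2'.
have gj : (2 ^ (e - 2))%:Z <= `|j2%:Z - j1%:Z| 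
  by case/orP: fr => le; [|rewrite distrC]; rewrite subzn ?normr_nat ?lez_nat; lia.
have lt : (2 * (2 * E) * 2 ^ r < 2 ^ (e - 2) * W)%N.
  rewrite /W -expnD (_ : (e - 2 + _)%N = (r - 2 + ell (16 * E))%N); last by lia.
  have er2 : (2 ^ r = 4 * 2 ^ (r - 2))%N by rewrite -(expnD 2 2); congr expn; lia.
  rewrite expnD er2; have := ltn_ell (16 * E); have : (0 < 2 ^ (r - 2))%N by rewrite expn_gt0.
  by move: (2 ^ (r - 2))%N (2 ^ ell _)%N => a b; nia.
have Pr : (0 < (2 ^ r)%:Z :> int) by rewrite ltz_nat expn_gt0.
have [||bx by_] := cross_bound Pr _ _ gj n1 n2; try by rewrite lez_nat ltnW.
by split=> h; apply: (ltn_window lt) h; rewrite !PoszM.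
Qed.

(** The label consists of two heights, two programs and the residues of the [2 * n] end coordinates,
    [X] bits in all. The points are outputs of the programs and cost nothing further. *)
Lemma K_two_points : exists c, forall A r e k j1 j2 u1 u2 lam,
  (2 <= e <= r)%N -> (j1 < 2 ^ r)%N -> (j2 < 2 ^ r)%N -> far e j1 j2 -> valid_line n lam ->
  incident n E r j1 u1 lam -> incident n E r j2 u2 lam ->
  described U A k j1 u1 -> described U A k j2 u2 ->
  forall X, X = (r + r + (k.+1 + k.+1) +
    (r - e + ell (16 * E) + (r - e + ell (16 * E))) * n)%N ->
  (K U A (cpair (cpair j1 lam) j2) <= X + c * ell X)%N.
Proof.
pose good e r k A j1 j2 lam T p1 u1 p2 u2 :=
  [&& 2 <= e, e <= r, j1.+1 <= 2 ^ r, j2.+1 <= 2 ^ r, (2 ^ (e - 2) + j1 <= j2) || (2 ^ (e - 2) + j2 <= j1),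
    valid_line n lam, incident n E r j1 u1 lam, incident n E r j2 u2 lam,
    p1.+1 <= 2 ^ k.+1, p2.+1 <= 2 ^ k.+1, hit U A T j1 p1 u1 & hit U A T j2 p2 u2]%N.
pose D (A : set nat) v (tau : nat) y w := good (csnd (cfst v)) (cfst (cfst v)) (csnd v) A
  (cfst (cfst y)) (csnd y) (csnd (cfst y)) (cfst w)
  (cfst (cfst (csnd w))) (csnd (cfst (csnd w)))
  (cfst (csnd (csnd w))) (csnd (csnd (csnd w))).
have [|c H] := coding hU (D := D).
  by move=> v tau y w cv ct cy cw; rewrite /D /good; comp_tac.
exists (20 * c)%N => A r e k j1 j2 u1 u2 lam /andP[e2 er] l1 l2 fr val i1 i2 d1 d2 X eX.
case: d1 d2 => p1 lp1 [T1 h1] [p2 lp2 [T2 h2]].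
have {}H := H A (cpair (cpair r e) k) 0%N X (cpair (cpair j1 lam) j2)
  (cpair (maxn T1 T2) (cpair (cpair p1 u1) (cpair p2 u2))).
apply: leq_trans (H _ _) _.
- move=> ys u h; pose W := (2 ^ (r - e + ell (16 * E)))%N.
  have W0 : (0 < W)%N by rewrite expn_gt0.
  pose KT := ('I_(2 ^ r) * 'I_(2 ^ r) * ('I_(2 ^ k.+1) * 'I_(2 ^ k.+1)) *
    {ffun 'I_n -> 'I_W * 'I_W})%type.
  have -> : (2 ^ X = #|{: KT}|)%N.
    rewrite !card_prod card_ffun card_prod !card_ord eX.
    by rewrite !expnD [in LHS]expnM expnD.
  pose R y (q : KT) := exists T u1 u2,
    [/\ cfst (cfst y) = q.1.1.1, csnd y = q.1.1.2,
     good e r k A (cfst (cfst y)) (csnd y) (csnd (cfst y)) T q.1.2.1 u1 q.1.2.2 u2 &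
     forall i : 'I_n,
       entry (cfst (csnd (cfst y))) i %% W = (q.2 i).1 /\
       entry (csnd (csnd (cfst y))) i %% W = (q.2 i).2]%N.
  apply: (@card_key _ R) => //.
    move=> y /h[w]; rewrite /D !cpairE => g; have := g.
    case/and5P=> _ _ lj1 lj2 /and5P[_ _ _ _ /andP[lq1 /andP[lq2 _]]].
    exists (Ordinal lj1, Ordinal lj2, (Ordinal lq1, Ordinal lq2),
      [ffun i : 'I_n => (Ordinal (ltn_pmod (entry (cfst (csnd (cfst y))) i) W0),
                Ordinal (ltn_pmod (entry (csnd (csnd (cfst y))) i) W0))]).
    exists (cfst w), (csnd (cfst (csnd w))), (csnd (csnd (csnd w))); split=> //= i.
    by rewrite ffunE.
  move=> y y' q [T [v1 [v2 [ej1 ej2 g eq]]]] [T' [v1' [v2' [ej1' ej2' g' eq']]]].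
  case/and5P: g => _ _ lj1 lj2 /and5P[gfr gv gi1 gi2 /and4P[_ _ gh1 gh2]].
  case/and5P: g' => _ _ _ _ /and5P[_ gv' gi1' gi2' /and4P[_ _ gh1' gh2']].
  move: gh1' gh2' gi1' gi2'; rewrite ej1' ej2' -ej1 -ej2.
  move=> /(hit_inj gh1) <- /(hit_inj gh2) <- gi1' gi2'.
  rewrite -(cpairK y) -(cpairK y') -(cpairK (cfst y)) -(cpairK (cfst y')).
  rewrite ej1' ej2' -ej1 -ej2; congr (cpair (cpair _ _) _).
  have e2r : (2 <= e <= r)%N by rewrite e2.
  have P i := line_through_two_points i e2r lj1 lj2 gfr gi1 gi2 gi1' gi2'.
  apply: (valid_line_inj gv gv') => i; have [Pc Pd] := P i;
    have [ec ed] := eq i; have [ec' ed'] := eq' i.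
    by apply: Pc; rewrite -/W ec ec'.
  by apply: Pd; rewrite -/W ed ed'.
- rewrite /D /good !cpairE -/(far e j1 j2) fr e2 er l1 l2 val i1 i2 lp1 lp2 /=.
  by rewrite h1 ?leq_maxl // h2 ?leq_maxr.
have le1 : (ell r <= ell X)%N by apply: ell_leq; rewrite eX; lia.
have le2 : (ell e <= ell X)%N by apply: ell_leq; rewrite eX; lia.
have le3 : (ell k <= ell X)%N by apply: ell_leq; rewrite eX; lia.
have := ell_cpair (cpair r e) k; have := ell_cpair r e.
by have := ell_gt0 X; nia.
Qed.

End IntegerLines.

(** * The lower bound for a point on a grid line *)

Section MainInteger.

Variables (U : machine) (hU : universal_prefix_free U).

Lemma K_ltn : exists c, forall A tau r y, (y < 2 ^ r)%N ->
  (condK U A y tau <= r + c * ell r)%N.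
Proof.
pose D (A : set nat) (r tau y w : nat) := (y.+1 <= 2 ^ r)%N.
have [|c H] := coding hU (D := D).
  by move=> v tau y w cv ct cy cw; rewrite /D; comp_tac.
exists (2 * c)%N => A tau r y yr.
apply: leq_trans (H A r tau r y 0%N _ yr) _; last by nia.
move=> ys u h; rewrite -(size_iota 0 (2 ^ r)); apply: uniq_leq_size => // z /h[w].
by rewrite mem_iota.
Qed.

Lemma K_swap : exists c, forall A a b,
  (K U A (cpair b a) <= K U A (cpair a b) + c * ell (K U A (cpair a b)))%N.
Proof.
have [||c H] := K_map hU (f := fun _ _ s => cpair (csnd s) (cfst s)) (g := fun _ _ _ => 0%N).
- by move=> v tau s cv ct cs; comp_tac.
- by move=> v tau cv ct; comp_tac.
exists (2 * c)%N => A a b; have := H A 0%N 0%N (cpair a b); rewrite !cpairE.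
have : ell 0 = 1%N by []; rewrite -!/(K U A _); have := ell_gt0 (K U A (cpair a b)); nia.
Qed.

(** Errors are logarithms of complexities that already carry errors. As long as these are linear in
    [Y] and [D], the new error is again a multiple of [D]. *)
Lemma ell_linear a b Y D x : (ell Y <= D)%N -> (x <= a * Y + b * D)%N ->
  (ell x <= (a + b + 5) * D)%N.
Proof.
move=> YD /ell_leq h; have := ell_add (a * Y) (b * D); have := ell_mul a Y.
have := ell_mul b D; have := ell_le_id a; have := ell_le_id b; have := ell_le_id D.
by have := ell_gt0 Y; nia.
Qed.

Variables (n E : nat).

(** The candidates for the second height. They can be enumerated from the line, [r] and [k]. *)
Definition slice A r k lam j : Prop :=
  exists u, [/\ (j < 2 ^ r)%N, described U A k j u & incident n E r j u lam].

Lemma K_slice : exists c, forall A r k lam e j,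
  (forall js, uniq js -> (forall j', j' \in js -> slice A r k lam j') ->
    (size js <= 2 ^ e)%N) ->
  slice A r k lam j ->
  (condK U A j lam <= e + c * (ell r + ell k + ell e))%N.
Proof.
pose D (A : set nat) v lam j w :=
  [&& j.+1 <= 2 ^ cfst v, (csnd (csnd w)).+1 <= 2 ^ (csnd v).+1,
    hit U A (cfst (csnd w)) j (csnd (csnd w)) (cfst w) & incident n E (cfst v) j (cfst w) lam]%N.
have [|c H] := coding hU (D := D).
  by move=> v tau y w cv ct cy cw; rewrite /D; comp_tac.
exists (2 * c)%N => A r k lam e j bound [u [jr [p pk [T hT]] inc]].
apply: leq_trans (H A (cpair r k) lam e j (cpair u (cpair T p)) _ _) _.
- move=> js ujs h; apply: bound => // j' /h[w]; rewrite /D !cpairE.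
  move=> /and4P[lj lp hh ii]; exists (cfst w); split=> //.
  exact: hit_described lp hh.
- by rewrite /D !cpairE jr pk hT.
by have := ell_cpair r k; nia.
Qed.

(** At most [2 * 2 ^ (e - 2)] heights are near [J] and at most [2 ^ (e - 2)] have complexity at most
    [e - 3]: together three quarters of [2 ^ e]. *)
Lemma far_complex A e J c (js : seq nat) : (3 <= e)%N -> uniq js -> (2 ^ e < size js)%N ->
  exists j, [/\ j \in js, far e J j & (e - 2 <= condK U A j c)%N].
Proof.
move=> e3 ujs lt; apply: contrapT => no.
have sub : {subset js <= iota (J - 2 ^ (e - 2)) (2 * 2 ^ (e - 2)) ++
    [seq j <- js | (condK U A j c <= e - 3)%N]}.
  move=> j jjs; rewrite mem_cat mem_iota mem_filter jjs andbT.
  have [le|gt] := leqP (condK U A j c) (e - 3); first by rewrite orbT.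
  rewrite orbF; apply: contrapT => h; apply: no; exists j; split=> //; last by lia.
  by rewrite /far; lia.
have := uniq_leq_size ujs sub; rewrite size_cat size_iota.
have : (size [seq j <- js | condK U A j c <= e - 3] <= 2 ^ (e - 3).+1)%N.
  apply: (@hit_count U A c); first exact: filter_uniq.
  move=> y; rewrite mem_filter => /andP[/(condK_described hU)[p lp [T h]] _].
  by exists T, p; split=> //; apply: h.
have e4 : (2 ^ e = 4 * 2 ^ (e - 2))%N by rewrite -(expnD 2 2); congr expn; lia.
have -> : (e - 3).+1 = (e - 2)%N by lia.
have : (0 < 2 ^ (e - 2))%N by rewrite expn_gt0.
move: lt; rewrite e4; move: (2 ^ (e - 2))%N => g l1 g0 h1 h2.
by have := leq_trans l1 (leq_trans h2 (leq_add (leqnn _) h1)); lia.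
Qed.

(** [N] bounds three defects: of randomness of the height, of independence of line and height, and
    of recovering the height from the point. The condition [C * D <= r] leaves room for
    [e = r - f * D] to be at least 3. *)
Lemma K_line_point : exists C, forall A N r J u lam,
  (J < 2 ^ r)%N -> valid_line n lam -> incident n E r J u lam ->
  (r <= K U A J + N)%N -> (K U A lam <= condK U A lam J + N)%N ->
  (K U A (cpair J u) <= K U A u + N)%N ->
  let D := (N + ell (r + K U A u + K U A lam))%N in
  (C * D <= r)%N -> (K U A lam + 2 * r <= 2 * K U A u + C * D)%N.
Proof.
have [c1 Kpair] := K_pair_ge hU; have [c2 Kchain] := K_chain hU.
have [c3 Kswap] := K_swap; have [c4 Kltn] := K_ltn; have [c5 Kslice] := K_slice.
have [c6 Ktwo] := K_two_points hU n E.
pose b0 := (7 * c1 + 2)%N; pose a0 := (6 + c4)%N; pose a1 := (c2 * (1 + a0))%N.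
pose a2 := (a1 + c3 * (2 + (c4 + a1) + 5))%N; pose a3 := (c4 + a2 + 7)%N.
pose a4 := (2 + c1 * a3)%N; pose a6 := (c5 * (b0 + 8))%N.
(* The sum of the errors in [B2], in [B4] and in the cost of a member of a small slice, plus 1 to
   make the contradiction below strict. *)
pose f := (a2 + a4 + a6 + 1)%N; pose w0 := ell (16 * E).
pose a7 := (2 + 2 * (f + w0) * n)%N; pose a8 := (4 + (a7 + 2 * b0) + 5)%N.
pose a9 := (4 + (a7 + 2 * b0 + c6 * a8) + 5)%N.
pose C := (2 * b0 + a4 + f + a7 + c6 * a8 + c1 * a9 + 5)%N; exists C.
move=> A N r J u lam Jr val inc KJ Klam KJu D CD.
set Ku := K U A u in KJu D CD *; set Kl := K U A lam in Klam D CD *.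
pose Y := (r + Ku + Kl)%N; have YD : (ell Y <= D)%N by rewrite /D leq_addl.
have D0 : (0 < D)%N by apply: leq_trans (ell_gt0 _) YD.
have ND : (N <= D)%N by rewrite /D leq_addr.
have ellr : (ell r <= D)%N by apply: leq_trans YD; apply: ell_leq; rewrite /Y; lia.
have ellKl : (ell Kl <= D)%N by apply: leq_trans YD; apply: ell_leq; rewrite /Y; lia.
set k := condK U A u J.
have mulD c x a : (x <= a * D)%N -> (c * x <= c * (a * D))%N.
  by move=> h; rewrite leq_mul2l h orbT.
have B0 : (r + k <= Ku + b0 * D)%N.
  have := Kpair A J u; rewrite -/k.
  have /(mulD c1) : (ell (K U A (cpair J u)) <= 7 * D)%N.
    by apply: (@ell_linear 1 1 Y) => //; rewrite /Y; lia.
  by rewrite /b0; lia.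
have ellk : (ell k <= (b0 + 6) * D)%N.
  have -> : (b0 + 6 = 1 + b0 + 5)%N by lia.
  by apply: (ell_linear YD); move: B0; rewrite /Y; lia.
set Q0 := condK U A J lam.
have Q0r : (Q0 <= r + c4 * D)%N.
  by apply: leq_trans (Kltn A lam r J Jr) _; rewrite leq_add2l leq_mul.
have ellQ0 : (ell Q0 <= a0 * D)%N.
  have -> : a0 = (1 + c4 + 5)%N by rewrite /a0; lia.
  by apply: (ell_linear YD); move: Q0r; rewrite /Y; lia.
have B1 : (K U A (cpair lam J) <= Kl + Q0 + a1 * D)%N.
  have := Kchain A lam J; rewrite -/Kl -/Q0 /a1.
  have /(mulD c2) : (ell Kl + ell Q0 <= (1 + a0) * D)%N by lia.
  by rewrite mulnA; lia.
have B2 : (K U A (cpair J lam) <= Kl + Q0 + a2 * D)%N.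
  have := Kswap A lam J.
  have /(mulD c3) : (ell (K U A (cpair lam J)) <= (2 + (c4 + a1) + 5) * D)%N.
    by apply: (ell_linear YD); move: B1 Q0r; rewrite /Y; lia.
  by rewrite /a2; lia.
set M := K U A (cpair J lam) in B2 *.
have B3 : (ell M <= a3 * D)%N.
  have -> : a3 = (2 + (c4 + a2) + 5)%N by rewrite /a3; lia.
  by apply: (ell_linear YD); move: B2 Q0r; rewrite /Y; lia.
(* Randomness of [J] and its independence of the line. With [B2] it follows that [Q0] is at least
   [r - (a2 + a4) * D]. *)
have B4 : (r + Kl <= M + a4 * D)%N.
  by have := Kpair A J lam; rewrite -/M /a4; move: (mulD c1 _ _ B3); lia.
have cD a b : (a <= b)%N -> (a * D <= b * D)%N by move=> h; rewrite leq_mul2r h orbT.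
pose e := (r - f * D)%N.
have fr : (f * D + 3 <= r)%N.
  apply: leq_trans CD; apply: leq_trans (cD (f + 3)%N _ _); first by rewrite mulnDl; lia.
  by rewrite /C; lia.
have er : (e <= r)%N by apply: leq_subr.
have [js [ujs hjs ljs]] : exists js, [/\ uniq js,
    forall j, j \in js -> slice A r k lam j & (2 ^ e < size js)%N].
  (* In a slice of at most [2 ^ e] heights, [J] would be too simple given the line. *)
  apply: contrapT => no; suff : (Q0 <= e + a6 * D)%N.
    by move: B2 B4 fr; rewrite /e /f; lia.
  apply: leq_trans (Kslice A r k lam e J _ _) _.
  - move=> js ujs hjs; rewrite leqNgt; apply/negP => lt.
    by apply: no; exists js.
  - by exists u; split=> //; exact: condK_described.
  have : (ell e <= D)%N by apply: leq_trans ellr; apply: ell_leq.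
  have /(mulD c5) : (ell r + ell k + ell e <= (b0 + 8) * D)%N.
    by have := leq_trans (ell_leq er) ellr; lia.
  by rewrite /a6 mulnA leq_add2l.
have e3 : (3 <= e)%N by rewrite /e; lia.
(* The condition is the pair of [J] and the line, so that [j2] adds [e - 2] bits to [M] up to a
   logarithm. *)
have [j2 [j2s fr2 Kj2]] := far_complex A J (cpair J lam) e3 ujs ljs.
have [u2 [j2r du2 inc2]] := hjs _ j2s.
have e2r : (2 <= e <= r)%N by rewrite er andbT; apply: leq_trans e3.
have du : described U A k J u by apply: condK_described.
have := Ktwo A r e k J j2 u u2 lam e2r Jr j2r fr2 val inc inc2 du du2.
move=> /(_ _ erefl); set X := (_ + _ * n)%N; set Q := K _ _ _ => KQ.
have re : (r - e = f * D)%N by rewrite /e subKn //; lia.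
have XB : (X <= 2 * r + 2 * k + a7 * D)%N.
  have := leq_mul (leqnn n) (leq_mul (leqnn w0) D0).
  by rewrite /X re /a7 -/w0 muln1; lia.
have ellX : (ell X <= a8 * D)%N.
  have -> : a8 = (4 + (a7 + 2 * b0) + 5)%N by rewrite /a8; lia.
  by apply: (ell_linear YD); move: XB B0; rewrite /Y; lia.
have KQ' : (Q <= X + c6 * (a8 * D))%N.
  by apply: leq_trans KQ _; rewrite leq_add2l mulD.
have ellQ : (ell Q <= a9 * D)%N.
  have -> : a9 = (4 + (a7 + 2 * b0 + c6 * a8) + 5)%N by rewrite /a9; lia.
  by apply: (ell_linear YD); move: XB B0 KQ'; rewrite /Y; lia.
have KM := Kpair A (cpair J lam) j2; rewrite -/M -/Q in KM.
have KM' : (M + (e - 2) <= X + c6 * (a8 * D) + c1 * (a9 * D))%N.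
  by move: (mulD c1 _ _ ellQ) Kj2 KM KQ'; lia.
have e' : (r <= e + f * D)%N by rewrite /e; lia.
have C' : (2 * b0 * D + a4 * D + f * D + a7 * D + c6 * (a8 * D) + c1 * (a9 * D) + 2 <= C * D)%N.
  rewrite /C; move: D0; lia.
by move: B4 XB B0 e' KM' C'; lia.
Qed.

End MainInteger.

(** * Lines, projections and base points *)

Section LineEntries.

Variables (F : fieldType) (n : nat).
Implicit Types c d : 'I_n -> F.

(** With [w = d - c] this is the matrix [w w^T / |w|^2]. It is stated over a field to serve rational
    and real lines alike, and sums over a list so that computability follows by induction. *)
Definition proj_entry c d (k l : 'I_n) : F :=
  (d k - c k) * (d l - c l) / \sum_(m <- enum 'I_n) (d m - c m) * (d m - c m).

Definition base_entry c d (k : 'I_n) : F :=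
  c k - \sum_(l <- enum 'I_n) proj_entry c d k l * c l.

End LineEntries.

Section Lines.

Variables (R : realType) (n : nat).
Implicit Types (x y c d w : 'cV[R]_n) (l : set 'cV[R]_n).

Definition dot x y : R := \sum_k x k 0 * y k 0.

Lemma trmx_mulE x y : x^T *m y = (dot x y)%:M.
Proof.
apply/matrixP => i j; rewrite !ord1 !mxE eqxx mulr1n; apply: eq_bigr => k _.
by rewrite mxE.
Qed.

Lemma dotDr x y z : dot x (y + z) = dot x y + dot x z.
Proof. by rewrite -big_split; apply: eq_bigr => k _; rewrite mxE mulrDr. Qed.

Lemma dotZr a x y : dot x (a *: y) = a * dot x y.
Proof. by rewrite mulr_sumr; apply: eq_bigr => k _; rewrite mxE mulrCA. Qed.

Lemma dotC x y : dot x y = dot y x.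
Proof. by apply: eq_bigr => k _; rewrite mulrC. Qed.

Lemma dotNr x y : dot x (- y) = - dot x y.
Proof. by rewrite -scaleN1r dotZr mulN1r. Qed.

Lemma dot_add_scale x w b :
  dot (x + b *: w) (x + b *: w) = dot x x + 2 * b * dot w x + b ^+ 2 * dot w w.
Proof.
by rewrite /dot !mulr_sumr -!big_split; apply: eq_bigr => k _; rewrite !mxE /=; ring.
Qed.

Lemma dot_gt0 w : w != 0 -> 0 < dot w w.
Proof.
move=> w0; rewrite lt_neqAle sumr_ge0 ?andbT => [|k _]; last by rewrite -expr2 sqr_ge0.
apply: contra_neq w0 => /esym/eqP; rewrite psumr_eq0 => [/allP w0|k _]; last by rewrite -expr2 sqr_ge0.
apply/matrixP => k j; rewrite ord1 mxE; apply/eqP.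
by have := w0 k (mem_index_enum _); rewrite mulf_eq0 orbb.
Qed.

Lemma enorm_sqr x : enorm x ^+ 2 = dot x x.
Proof. by rewrite sqr_sqrtr ?sumr_ge0 // => k _; rewrite sqr_ge0. Qed.

Lemma enorm_ge0 x : 0 <= enorm x.
Proof. exact: sqrtr_ge0. Qed.

Lemma enorm_le x y : (enorm x <= enorm y) = (dot x x <= dot y y).
Proof. by rewrite -!enorm_sqr ler_sqr ?nnegrE ?enorm_ge0. Qed.

Definition line_through c d : set 'cV[R]_n := [set c + a *: (d - c) | a in [set: R]].

Lemma line_through_two l c d : is_line l -> l c -> l d -> c != d -> l = line_through c d.
Proof.
move=> [p [v [v0 ->]]] [a _ <-] [b _ <-] cd.
have ab : b - a != 0 by apply: contra_neq cd => /eqP; rewrite subr_eq0 => /eqP ->.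
have e : p + b *: v - (p + a *: v) = (b - a) *: v.
  by rewrite opprD addrACA subrr add0r scalerBl.
rewrite /line_through e; apply/seteqP; split=> _ [t _ <-].
  exists ((t - a) / (b - a)) => //; rewrite scalerA divfK // -addrA -scalerDl.
  by congr (_ + _ *: _); ring.
exists (a + t * (b - a)) => //; by rewrite scalerDl -scalerA addrA.
Qed.

Lemma direction_through c d x :
  direction (line_through c d) x <-> exists a, x = a *: (d - c).
Proof.
split.
  case=> _ [a _ <-] [_ [b _ <-] <-]; exists (a - b).
  by rewrite opprD addrACA subrr add0r scalerBl.
case=> a ->; exists (c + a *: (d - c)); first by exists a.
by exists (c + 0 *: (d - c)); [exists 0|rewrite scale0r addr0 addrC addKr].
Qed.

Definition proj_mx_of c d : 'M[R]_n :=
  \matrix_(k, m) proj_entry (fun k => c k 0) (fun k => d k 0) k m.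
Definition base_of c d : 'cV[R]_n :=
  \col_k base_entry (fun k => c k 0) (fun k => d k 0) k.

Lemma sum_enum (f : 'I_n -> R) : \sum_(k <- enum 'I_n) f k = \sum_k f k.
Proof. by rewrite big_enum. Qed.

Lemma proj_mx_ofE c d x :
  proj_mx_of c d *m x = (dot (d - c) x / dot (d - c) (d - c)) *: (d - c).
Proof.
apply/matrixP => k j; rewrite ord1 !mxE /dot !mulr_suml.
apply: eq_bigr => m _; rewrite !mxE /proj_entry sum_enum.
under [\sum_k0 (d - c) k0 0 * _]eq_bigr do rewrite !mxE.
by rewrite -!mulrA; ring.
Qed.

Lemma base_ofE c d : base_of c d = c - proj_mx_of c d *m c.
Proof.
apply/matrixP => k j; rewrite ord1 !mxE /base_entry sum_enum.
by congr (_ - _); apply: eq_bigr => m _; rewrite mxE.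
Qed.

(** Orthogonal projections are unique: the image of [x] is a multiple of [d - c], and orthogonality
    fixes the factor. So [xget] can only pick the explicit matrix. *)
Lemma line_proj_through c d : c != d -> line_proj (line_through c d) = proj_mx_of c d.
Proof.
move=> cd; have w0 : d - c != 0 by rewrite subr_eq0 eq_sym.
have ww := dot_gt0 w0; have wn : dot (d - c) (d - c) != 0 by rewrite gt_eqF.
have orth : is_orth_proj (direction (line_through c d)) (proj_mx_of c d).
  move=> x; split; first by apply/direction_through; rewrite proj_mx_ofE; eexists.
  move=> _ /direction_through[a ->]; rewrite trmx_mulE proj_mx_ofE.
  rewrite dotC dotZr dotC dotDr dotNr dotZr divfK // subrr mulr0.
  by apply/matrixP => i j; rewrite !mxE mul0rn.
rewrite /line_proj; have := xgetI 0 orth; set P := xget _ _ => orthP.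
apply/matrixP => i j.
have E (M : 'M[R]_n) : is_orth_proj (direction (line_through c d)) M ->
    forall x, M *m x = (dot (d - c) x / dot (d - c) (d - c)) *: (d - c).
  move=> oM x; have [/direction_through[a e] o] := oM x.
  have /o : direction (line_through c d) (d - c).
    by apply/direction_through; exists 1; rewrite scale1r.
  rewrite e trmx_mulE => /matrixP/(_ 0 0); rewrite !mxE eqxx mulr1n dotDr dotNr dotZr.
  by move=> /eqP; rewrite subr_eq0 => /eqP ->; rewrite mulfK.
have := E _ orthP (delta_mx j 0); rewrite -(E _ orth (delta_mx j 0)).
by rewrite -!colE => /matrixP/(_ i 0); rewrite !mxE.
Qed.

(** [base_of c d] is orthogonal to [d - c], so by Pythagoras any other point of the line is strictly
    longer. *)
Lemma line_base_through c d : c != d -> line_base (line_through c d) = base_of c d.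
Proof.
move=> cd; have w0 : d - c != 0 by rewrite subr_eq0 eq_sym.
have ww := dot_gt0 w0; have wn : dot (d - c) (d - c) != 0 by rewrite gt_eqF.
set t := base_of c d.
have te : t = c - (dot (d - c) c / dot (d - c) (d - c)) *: (d - c).
  by rewrite /t base_ofE proj_mx_ofE.
have wt : dot (d - c) t = 0 by rewrite te dotDr dotNr dotZr divfK // subrr.
have on x : line_through c d x -> exists b, x = t + b *: (d - c).
  case=> a _ <-; exists (a + dot (d - c) c / dot (d - c) (d - c)).
  by rewrite te scalerDl (addrC (a *: _)) addrA subrK.
have len b : dot (t + b *: (d - c)) (t + b *: (d - c)) =
    dot t t + b ^+ 2 * dot (d - c) (d - c).
  by rewrite dot_add_scale wt mulr0 addr0.
have lt_ : line_through c d t.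
  by exists (- (dot (d - c) c / dot (d - c) (d - c))) => //; rewrite te scaleNr.
have min x : line_through c d x -> enorm t <= enorm x.
  by move=> /on[b ->]; rewrite enorm_le len lerDl mulr_ge0 ?sqr_ge0 // ltW.
have P : [set t | line_through c d t /\ forall x, line_through c d x -> enorm t <= enorm x] t.
  by [].
rewrite /line_base; case: (xgetI 0 P); set t' := xget _ _ => /on[b e] /(_ _ lt_).
rewrite e enorm_le len gerDl => h.
have : b ^+ 2 = 0.
  by apply/eqP; rewrite eq_le sqr_ge0 andbT -(ler_pM2r ww) mul0r.
by move=> /eqP; rewrite sqrf_eq0 => /eqP ->; rewrite scale0r addr0.
Qed.

Lemma covers_axisP c d (j : 'I_n) :
  covers_axis (line_through c d) j <-> c j 0 != d j 0.
Proof.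
split=> [h|ne].
  apply/negP => /eqP e; have : [set: R] (c j 0 + 1) by [].
  rewrite -h => -[_ [a _ <-]]; rewrite !mxE e subrr mulr0 addr0 => /eqP.
  by rewrite addrC -subr_eq subrr eq_sym oner_eq0.
apply/seteqP; split=> // y _; have ne' : d j 0 - c j 0 != 0 by rewrite subr_eq0 eq_sym.
exists (c + ((y - c j 0) / (d j 0 - c j 0)) *: (d - c)); first by eexists.
by rewrite !mxE divfK // addrC subrK.
Qed.

(** Agreement of [c] and [d] before [i] makes [i] the least covered axis, and the unit step along it
    turns the parameter into the height. *)
Lemma line_at_through c d (i : 'I_n) (z h : R) :
  c i 0 = z -> d i 0 = z + 1 -> (forall j : 'I_n, (j < i)%N -> c j 0 = d j 0) ->
  line_at (line_through c d) (z + h) = c + h *: (d - c).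
Proof.
move=> ci di small; have ne : c i 0 != d i 0.
  by rewrite ci di addrC -subr_eq subrr eq_sym oner_eq0.
have P : [set x | line_through c d x /\ exists i : 'I_n,
    [/\ covers_axis (line_through c d) i,
        forall j : 'I_n, covers_axis (line_through c d) j -> (i <= j)%N &
        x i 0 = z + h]] (c + h *: (d - c)).
  split; first by exists h.
  exists i; split; first exact/covers_axisP.
    move=> j /covers_axisP; apply: contra_neqT; rewrite -ltnNge; exact: small.
  by rewrite !mxE di ci; ring.
rewrite /line_at; case: (xgetI 0 P) => -[a _ <-] [i' [/covers_axisP ne' min e]].
have ei : i' = i.
  apply/val_inj/eqP; rewrite eqn_leq min /=; last exact/covers_axisP.
  by rewrite leqNgt; apply: contra_neqN ne' => /small.
congr (_ + _ *: _); move: e; rewrite ei !mxE ci di.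
by rewrite [z + 1]addrC addrK mulr1 => /addrI.
Qed.

Lemma enorm_le_sum x : enorm x <= \sum_k `|x k 0|.
Proof.
have s0 : 0 <= \sum_k `|x k 0| by apply: sumr_ge0.
rewrite -[leRHS]ger0_norm // -sqrtr_sqr ler_sqrt ?sqr_ge0 //.
rewrite expr2 [leRHS]mulr_suml; apply: ler_sum => k _.
rewrite -real_normK ?num_real // expr2 ler_wpM2l // (bigD1 k) //= lerDl.
exact: sumr_ge0.
Qed.

Lemma entry_le_enorm x k : `|x k 0| <= enorm x.
Proof.
rewrite -sqrtr_sqr ler_sqrt; last by apply: sumr_ge0 => *; rewrite sqr_ge0.
by rewrite (bigD1 k) //= lerDl; apply: sumr_ge0 => *; rewrite sqr_ge0.
Qed.

Lemma enorm_mulmx_le (M : 'M[R]_n) x : enorm x <= 1 ->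
  enorm (M *m x) <= \sum_k \sum_m `|M k m|.
Proof.
move=> x1; apply: le_trans (enorm_le_sum _) _; apply: ler_sum => k _; rewrite mxE.
apply: le_trans (ler_norm_sum _ _ _) _; apply: ler_sum => m _.
by rewrite normrM ler_piMr // (le_trans (entry_le_enorm _ _)).
Qed.

Lemma enorm0 : enorm (0 : 'cV[R]_n) = 0.
Proof. by rewrite /enorm big1 ?sqrtr0 // => k _; rewrite mxE expr0n. Qed.

Lemma opnorm_le (M : 'M[R]_n) : opnorm M <= \sum_k \sum_m `|M k m|.
Proof.
apply: ge_sup; first by exists (enorm (M *m 0)), 0 => //=; rewrite enorm0.
by move=> _ [x /= x1 <-]; apply: enorm_mulmx_le.
Qed.

Lemma entry_le_opnorm (M : 'M[R]_n) k m : `|M k m| <= opnorm M.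
Proof.
have -> : M k m = (M *m (delta_mx m 0 : 'cV[R]_n)) k 0 by rewrite -colE mxE.
apply: le_trans (entry_le_enorm _ _) _; apply: ub_le_sup.
  by exists (\sum_k \sum_m `|M k m|) => _ [x /= x1 <-]; apply: enorm_mulmx_le.
exists (delta_mx m 0) => //=.
rewrite /enorm (bigD1 m) //= big1 => [|j jm]; rewrite !mxE ?eqxx ?(negPf jm) ?expr0n //=.
by rewrite addr0 expr1n sqrtr1.
Qed.

(** Together with the next lemma it replaces [line_dist] by entrywise closeness, up to a constant
    depending on [n]. *)
Lemma line_dist_entries l l' (e : R) : line_dist l l' <= e ->
  (forall k m, `|line_proj l k m - line_proj l' k m| <= e) /\
  (forall k, `|line_base l k 0 - line_base l' k 0| <= e).
Proof.
move=> le; split=> [k m|k]; apply: le_trans le; rewrite /line_dist.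
  apply: le_trans (_ : _ <= opnorm (line_proj l - line_proj l')) _.
    by have := entry_le_opnorm (line_proj l - line_proj l') k m; rewrite !mxE.
  by rewrite lerDl enorm_ge0.
have := entry_le_enorm (line_base l - line_base l') k; rewrite !mxE => h.
apply: le_trans h _; rewrite lerDr.
exact: le_trans (normr_ge0 _) (entry_le_opnorm _ k k).
Qed.

Lemma line_dist_le l l' (e : R) :
  (forall k m, `|line_proj l k m - line_proj l' k m| <= e) ->
  (forall k, `|line_base l k 0 - line_base l' k 0| <= e) ->
  line_dist l l' <= (n * n + n)%:R * e.
Proof.
move=> hP ht; rewrite natrD mulrDl natrM; apply: lerD.
  apply: le_trans (opnorm_le _) _.
  apply: le_trans (_ : _ <= \sum_(k < n) \sum_(m < n) e) _.
    by apply: ler_sum => k _; apply: ler_sum => m _; rewrite !mxE.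
  by rewrite !sumr_const !card_ord -mulrnA -[leLHS]mulr_natl natrM.
apply: le_trans (enorm_le_sum _) _.
apply: le_trans (_ : _ <= \sum_(k < n) e) _.
  by apply: ler_sum => k _; rewrite !mxE.
by rewrite sumr_const card_ord mulr_natl.
Qed.

End Lines.

(* Recovers the points of a line at heights [z] and [z + 1] in coordinate [i]
   from its projection and its point closest to the origin. *)
Definition point_at_height (F : fieldType) (n : nat) (i : 'I_n) (z : F)
    (P : 'I_n -> 'I_n -> F) (t : 'I_n -> F) (k : 'I_n) : F :=
  t k + (z - t i) * (P k i / P i i).

(** Column [i] of the projection divided by its diagonal entry is the direction with [i]-th entry 1,
    which is [d - c]. *)
Lemma point_at_heightE (F : fieldType) (n : nat) (i : 'I_n) (z a : F) (c d : 'I_n -> F) k :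
  c i = z -> d i = z + 1 ->
  \sum_(m <- enum 'I_n) (d m - c m) * (d m - c m) != 0 ->
  point_at_height i (z + a) (proj_entry c d) (base_entry c d) k = c k + a * (d k - c k).
Proof.
move=> ci di w0; rewrite /point_at_height.
set S := \sum_(m <- _) _ in w0.
have PE m l : proj_entry c d m l = (d m - c m) * (d l - c l) / S by [].
set T := \sum_(m <- enum 'I_n) (d m - c m) * c m.
have tE m : base_entry c d m = c m - (d m - c m) * T / S.
  rewrite /base_entry; congr (_ - _); rewrite /T mulr_sumr mulr_suml.
  by apply: eq_bigr => l _; rewrite PE; ring.
have d1 : z + 1 - z = 1 by ring.
rewrite !tE !PE ci di d1; field.
by rewrite ?w0 ?oner_neq0.
Qed.

(** * Approximation at rate 2^-r *)

Section Approximation.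

Variable R : realType.
Implicit Types (f g : nat -> R) (x y : R).

(** The field operations preserve this rate, inversion away from 0, so a rational formula loses only
    boundedly many bits of precision. *)
Definition apx f x : Prop :=
  exists C r0, forall r, (r0 <= r)%N -> `|f r - x| <= C * 2 ^- r.

Lemma pow2V_gt0 r : 0 < 2 ^- r :> R.
Proof. by rewrite invr_gt0 exprn_gt0. Qed.

Lemma pow2V_le1 r : 2 ^- r <= 1 :> R.
Proof. by rewrite invf_le1 ?exprn_gt0 // exprn_ege1 // ler1n. Qed.

Lemma apx_const x : apx (fun=> x) x.
Proof. by exists 0, 0%N => r _; rewrite subrr normr0 mul0r. Qed.

Lemma apx_ext f g x : (exists r0, forall r, (r0 <= r)%N -> f r = g r) -> apx f x -> apx g x.
Proof.
move=> [r1 e] [C [r0 H]]; exists C, (maxn r0 r1) => r; rewrite geq_max => /andP[h h1].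
by rewrite -e //; apply: H.
Qed.

Lemma apx_add f g x y : apx f x -> apx g y -> apx (fun r => f r + g r) (x + y).
Proof.
move=> [C [r0 H]] [C' [r1 H']]; exists (C + C'), (maxn r0 r1) => r.
rewrite geq_max => /andP[/H h /H' h']; rewrite opprD addrACA mulrDl.
by apply: le_trans (ler_normD _ _) _; apply: lerD.
Qed.

Lemma apx_opp f x : apx f x -> apx (fun r => - f r) (- x).
Proof. by move=> [C [r0 H]]; exists C, r0 => r /H; rewrite -opprD normrN. Qed.

Lemma apx_sub f g x y : apx f x -> apx g y -> apx (fun r => f r - g r) (x - y).
Proof. by move=> af /apx_opp; apply: apx_add. Qed.

Lemma apx_ge0 f x : apx f x -> exists C r0, 0 <= C /\
  forall r, (r0 <= r)%N -> `|f r - x| <= C * 2 ^- r.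
Proof.
move=> [C [r0 H]]; exists `|C|, r0; split=> // r /H/le_trans; apply.
by rewrite ler_pM2r ?pow2V_gt0 // ler_norm.
Qed.

Lemma apx_bounded f x : apx f x -> exists M r0, forall r, (r0 <= r)%N -> `|f r| <= M.
Proof.
move=> /apx_ge0[C [r0 [C0 H]]]; exists (C + `|x|), r0 => r /H h.
rewrite -[f r](subrK x); apply: le_trans (ler_normD _ _) _; rewrite lerD2r.
by apply: le_trans h _; rewrite ler_piMr // pow2V_le1.
Qed.

Lemma apx_mul f g x y : apx f x -> apx g y -> apx (fun r => f r * g r) (x * y).
Proof.
move=> af ag; have [M [r1 HM]] := apx_bounded af.
move: af ag => /apx_ge0[C [r0 [C0 H]]] /apx_ge0[C' [r2 [C'0 H']]].
exists (`|M| * C' + C * `|y|), (maxn r0 (maxn r1 r2)) => r.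
rewrite !geq_max => /and3P[/H h /HM hM /H' h'].
have -> : f r * g r - x * y = f r * (g r - y) + (f r - x) * y by ring.
apply: le_trans (ler_normD _ _) _; rewrite !normrM mulrDl; apply: lerD.
  rewrite -mulrA; apply: ler_pM => //.
  by apply: le_trans hM (ler_norm _).
by rewrite mulrAC ler_wpM2r.
Qed.

Lemma apx_near f x e : 0 < e -> apx f x ->
  exists r0, forall r, (r0 <= r)%N -> `|f r - x| <= e.
Proof.
move=> e0 /apx_ge0[C [r0 [C0 H]]]; exists (maxn r0 (Num.truncn (C / e)).+1) => r.
rewrite geq_max => /andP[/H h hr]; apply: le_trans h _.
rewrite ler_pdivrMr ?exprn_gt0 // -ler_pdivrMl // mulrC.
apply: le_trans (ltW (truncnS_gt _)) _.
by rewrite -natrX ler_nat; apply: leq_trans hr _; apply: ltnW; apply: ltn_expl.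
Qed.

Lemma apx_inv f x : x != 0 -> apx f x -> apx (fun r => (f r)^-1) x^-1.
Proof.
move=> x0 af; have nx : 0 < `|x| / 2 by rewrite divr_gt0 // normr_gt0.
have [r1 H1] := apx_near nx af; move: af => /apx_ge0[C [r0 [C0 H]]].
exists (C * (2 / `|x| / `|x|)), (maxn r0 r1) => r; rewrite geq_max => /andP[/H h /H1 h1].
have fx : `|x| / 2 <= `|f r|.
  have : `|x| <= `|f r| + `|f r - x|.
    by have := ler_normB (f r) (f r - x); rewrite subKr.
  by move: h1; set a := `|x|; set b := `|f r|; lra.
have f0 : f r != 0 by rewrite -normr_gt0; apply: lt_le_trans fx.
have -> : (f r)^-1 - x^-1 = (x - f r) * ((f r)^-1 * x^-1) by field; rewrite f0 x0.
rewrite normrM distrC mulrAC; apply: ler_pM => //.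
rewrite normrM !normfV ler_pM2r ?invr_gt0 ?normr_gt0 //.
rewrite -[2 / `|x|]invrK invf_div lef_pV2 ?posrE // normr_gt0 //.
Qed.

Lemma apx_sum (T : Type) (s : seq T) (f : nat -> T -> R) (x : T -> R) :
  (forall i, apx (fun r => f r i) (x i)) ->
  apx (fun r => \sum_(i <- s) f r i) (\sum_(i <- s) x i).
Proof.
move=> H; elim: s => [|i s IH].
  by rewrite big_nil; apply: apx_ext (apx_const 0); exists 0%N => r _; rewrite big_nil.
rewrite big_cons; apply: apx_ext (apx_add (H i) IH).
by exists 0%N => r _; rewrite big_cons.
Qed.

Lemma apx_close f x : (forall r, `|f r - x| <= 2 ^- r) -> apx f x.
Proof. by move=> H; exists 1, 0%N => r _; rewrite mul1r. Qed.

Lemma apx_shift f x m : apx f x -> apx (fun r => f (r + m)%N) x.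
Proof.
move=> /apx_ge0[C [r0 [C0 H]]]; exists C, r0 => r h.
apply: le_trans (H _ _) _; first exact: leq_trans h (leq_addr _ _).
by rewrite ler_wpM2l // lef_pV2 ?posrE ?exprn_gt0 // ler_eXn2l ?ltr1n // leq_addr.
Qed.

Lemma apx_diff f g x : apx f x -> apx g x ->
  exists C r0, forall r, (r0 <= r)%N -> `|f r - g r| <= C%:R * 2 ^- r.
Proof.
move=> af ag; have [C [r0 H]] := apx_sub af ag.
exists (Num.truncn C).+1, r0 => r /H; rewrite subrr subr0 => /le_trans; apply.
by rewrite ler_pM2r ?pow2V_gt0 // ltW // truncnS_gt.
Qed.

Lemma exists_apx_diff (T : finType) (f g : T -> nat -> R) (x : T -> R) :
  (forall i, apx (f i) (x i)) -> (forall i, apx (g i) (x i)) ->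
  exists C r0, forall r, (r0 <= r)%N -> forall i, `|f i r - g i r| <= C%:R * 2 ^- r.
Proof.
move=> af ag; have [C HC] := choice (fun i => apx_diff (af i) (ag i)).
have [r0 Hr] := choice HC; exists (\max_i C i), (\max_i r0 i) => r h i.
apply: le_trans (Hr i r _) _; first exact: leq_trans (leq_bigmax i) h.
by rewrite ler_pM2r ?pow2V_gt0 // ler_nat leq_bigmax.
Qed.

End Approximation.

(** Rounding down to the grid of mesh [2 ^- r]. The shift by [B] makes the coordinates in question
    positive, hence natural numbers on the grid. *)
Definition quant (F : archiRealFieldType) (B r : nat) (x : F) : nat :=
  Num.truncn ((x + B%:R) * 2 ^+ r).

Lemma quant_close (F : archiRealFieldType) B r (x : F) : 0 <= x + B%:R ->
  (quant B r x)%:R <= (x + B%:R) * 2 ^+ r < (quant B r x).+1%:R.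
Proof. by move=> x0; apply: truncn_itv; rewrite mulr_ge0 // exprn_ge0. Qed.

Lemma apx_quant (R : realType) B (q : nat -> rat) (x : R) :
  apx (fun r => ratr (q r)) x -> 0 < x + B%:R ->
  apx (fun r => (quant B r (q r))%:R * 2 ^- r) (x + B%:R).
Proof.
move=> aq xB; have [r1 H1] := apx_near xB aq.
have aqB := apx_add aq (apx_const B%:R).
suff : apx (fun r => (quant B r (q r))%:R * 2 ^- r - (ratr (q r) + B%:R)) (0 : R).
  move=> /apx_add/(_ aqB); rewrite add0r; apply: apx_ext.
  by exists 0%N => r _; rewrite subrK.
exists 1, r1 => r /H1 h; rewrite subr0 mul1r.
have q0 : 0 <= q r + B%:R.
  by rewrite -(ler0q R) rmorphD /= ratr_nat; move: h; rewrite ler_norml => /andP[+ _]; lra.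
have := quant_close r q0; set a := quant _ _ _; set Q := q r + B%:R.
have -> : ratr (q r) + B%:R = ratr Q :> R by rewrite rmorphD /= ratr_nat.
move=> /andP[]; rewrite -(ler_rat R) -(ltr_rat R) !rmorphM !rmorphXn /= !ratr_nat => h1 h2.
rewrite -[ratr Q](mulfK (_ : 2 ^+ r != 0)) ?expf_neq0 ?pnatr_eq0 // -mulrBl normrM.
have p0 : 0 < 2 ^- r :> R by exact: pow2V_gt0.
rewrite [X in _ * X](ger0_norm (ltW p0)); apply: ler_piMl; first exact: ltW.
by rewrite ler_norml; move: h1 h2; rewrite -natr1; lra.
Qed.

(** * Codes of rational points and lines *)

Section RationalCodes.

Lemma code_mxE p q (M : 'M[rat]_(p, q)) :
  code_mx M = code_seq [seq code_rat (M ab.1 ab.2) |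
    ab <- [seq (a, b) | a <- enum 'I_p, b <- enum 'I_q]].
Proof. by rewrite map_allpairs. Qed.

Definition mx_pos p q (a : 'I_p) (b : 'I_q) : nat :=
  index (a, b) [seq (a, b) | a <- enum 'I_p, b <- enum 'I_q].

Definition dec_mx p q (x : nat) (a : 'I_p) (b : 'I_q) : rat :=
  dec_rat (entry x (mx_pos a b)).

Lemma code_mxK p q (M : 'M[rat]_(p, q)) a b : dec_mx (code_mx M) a b = M a b.
Proof.
have ab : (a, b) \in [seq (a, b) | a <- enum 'I_p, b <- enum 'I_q].
  by apply/allpairsP; exists (a, b); rewrite !mem_enum.
rewrite /dec_mx code_mxE entry_code_seq (nth_map (a, b)) ?index_mem //.
by rewrite /mx_pos nth_index //= code_ratK.
Qed.

Lemma ratc_dec_mx p q f (a : 'I_p) (b : 'I_q) : comp f ->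
  ratc (fun A x => dec_mx (f A x) a b).
Proof. by move=> cf; apply/ratc_dec_rat/comp_entry. Qed.

Lemma comp_code_mx p q (M : set nat -> nat -> 'M[rat]_(p, q)) :
  (forall a b, ratc (fun A x => M A x a b)) -> comp (fun A x => code_mx (M A x)).
Proof.
move=> cM; apply: comp_ext (fun A x => esym (code_mxE (M A x))) _.
by apply: comp_code_seq => ab; apply: comp_code_rat.
Qed.

Lemma comp_quant B r f : comp r -> ratc f -> comp (fun A x => quant B (r A x) (f A x)).
Proof.
move=> cr cf; apply: comp_truncn; apply: ratc_mul.
  by apply: ratc_add => //; apply: ratc_const.
apply: (ratc_ext (f := fun A x => (2 ^ r A x)%:R)) => [A x|]; first by rewrite natrX.
by apply: ratc_nat; comp_tac.
Qed.

End RationalCodes.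

Section LineCodes.

Variable n : nat.

Definition quant_point (B r x : nat) : nat :=
  tuple_code (fun k : 'I_n => quant B r (dec_mx x k (0 : 'I_1))).

Lemma comp_quant_point B r x : comp r -> comp x ->
  comp (fun A y => quant_point B (r A y) (x A y)).
Proof.
move=> cr cx; apply: comp_tuple => k; apply: comp_quant => //.
exact: ratc_dec_mx.
Qed.

Lemma ratc_point_at_height (i : 'I_n) z P t k :
  (forall a b, ratc (fun A x => P A x a b)) -> (forall a, ratc (fun A x => t A x a)) ->
  ratc (fun A x => point_at_height i z (P A x) (t A x) k).
Proof.
move=> cP ct; apply: ratc_add => //; apply: ratc_mul.
  by apply: ratc_add; [apply: ratc_const|apply: ratc_opp].
by apply: ratc_mul => //; apply: ratc_inv.
Qed.

Definition quant_line (i : 'I_n) (z : rat) (B r x : nat) : nat :=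
  let q z' := tuple_code (fun k : 'I_n => quant B r
    (point_at_height i z' (@dec_mx n n (cfst x)) ((@dec_mx n 1 (csnd x))^~ 0) k)) in
  cpair (q z) (q (z + 1)).

Lemma comp_quant_line i z B r x : comp r -> comp x ->
  comp (fun A y => quant_line i z B (r A y) (x A y)).
Proof.
by move=> cr cx; rewrite /quant_line; comp_tac; apply: comp_tuple => k;
  apply: comp_quant => //; apply: ratc_point_at_height => *; apply: ratc_dec_mx; comp_tac.
Qed.

Definition grid_point (B r : nat) (a : 'I_n -> nat) (k : 'I_n) : rat :=
  (a k)%:R / 2 ^+ r - B%:R.

Definition line_of_points (c d : 'I_n -> rat) : rat_line n :=
  (\matrix_(k, m) proj_entry c d k m, \col_k base_entry c d k).

Definition grid_line (B r : nat) (a b : 'I_n -> nat) : rat_line n :=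
  line_of_points (grid_point B r a) (grid_point B r b).

Lemma ratc_grid_point B r (a : set nat -> nat -> 'I_n -> nat) k :
  comp r -> comp (fun A x => a A x k) -> ratc (fun A x => grid_point B (r A x) (a A x) k).
Proof.
move=> cr ca; apply: ratc_add; last exact: ratc_const.
apply: ratc_mul; first exact: ratc_nat.
apply: ratc_inv; apply: (ratc_ext (f := fun A x => (2 ^ r A x)%:R)) => [A x|].
  by rewrite natrX.
by apply: ratc_nat; comp_tac.
Qed.

Lemma comp_grid_line B r (a b : set nat -> nat -> 'I_n -> nat) : comp r ->
  (forall k, comp (fun A x => a A x k)) -> (forall k, comp (fun A x => b A x k)) ->
  comp (fun A x => code_line (grid_line B (r A x) (a A x) (b A x))).
Proof.
move=> cr ca cb.
have cc k : ratc (fun A x => grid_point B (r A x) (a A x) k) by apply: ratc_grid_point.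
have cd k : ratc (fun A x => grid_point B (r A x) (b A x) k) by apply: ratc_grid_point.
have cw k : ratc (fun A x => grid_point B (r A x) (b A x) k - grid_point B (r A x) (a A x) k).
  by apply: ratc_add => //; apply: ratc_opp.
have cP k m : ratc (fun A x =>
    proj_entry (grid_point B (r A x) (a A x)) (grid_point B (r A x) (b A x)) k m).
  apply: ratc_mul; first exact: ratc_mul.
  by apply: ratc_inv; apply: ratc_sum => j; apply: ratc_mul.
rewrite /code_line; comp_tac; apply: comp_code_mx => k m.
  by apply: ratc_ext (cP k m) => A x; rewrite mxE.
apply: (ratc_ext (f := fun A x =>
    base_entry (grid_point B (r A x) (a A x)) (grid_point B (r A x) (b A x)) k)).
  by move=> A x; rewrite mxE.
apply: ratc_add => //; apply: ratc_opp; apply: ratc_sum => j.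
exact: ratc_mul.
Qed.

End LineCodes.

(** * From real to rational lines *)

Lemma frac_part_bounds (R : realType) (s : R) : 0 <= frac_part s < 1.
Proof.
by have := floor_itv s; rewrite /frac_part subr_ge0 ltrBlDl rmorphD.
Qed.

Lemma truncn_double (R : realType) (y : R) : 0 <= y ->
  (Num.truncn (y * 2))./2 = Num.truncn y.
Proof.
move=> y0; have /andP[h1 h2] := truncn_itv y0.
have y2 : 0 <= y * 2 by rewrite mulr_ge0.
have /andP[k1 k2] := truncn_itv y2; move: k1 k2.
set a := Num.truncn (y * 2) in h1 h2 *; set b := Num.truncn y in h1 h2 *.
move=> k1 k2; have lt1 : (a < b.+1 * 2)%N.
  by rewrite -(ltr_nat R) natrM; apply: le_lt_trans k1 _; rewrite ltr_pM2r.
have lt2 : (b * 2 < a.+1)%N.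
  by rewrite -(ltr_nat R) natrM; apply: le_lt_trans k2; rewrite ler_pM2r.
by rewrite -divn2; lia.
Qed.

(** The first [r] bits are the digits of the integer that serves as height. This turns randomness
    into a bound on the complexity of the height. *)
Lemma code_binary_prefix (R : realType) (s : R) r :
  (code_str (binary_prefix s r)).+1 = (2 ^ r + Num.truncn (frac_part s * 2 ^+ r))%N.
Proof.
have /andP[f0 f1] := frac_part_bounds s.
elim: r => [|r IH].
  by rewrite expr0 mulr1 (truncn_def (n := 0%N)) ?f0 //.
rewrite /binary_prefix -[r.+1]addn1 iotaD map_cat cats1 code_str_rcons IH add0n addn1.
have := odd_double_half (Num.truncn (frac_part s * 2 ^+ r.+1)).
rewrite [in X in (X./2.*2)%N]exprSr mulrA truncn_double ?mulr_ge0 ?exprn_ge0 //.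
by rewrite expnS; lia.
Qed.

Section LineFrame.

Variables (R : realType) (n : nat).

(** The ends are taken at the integers around [s], in the first coordinate where the direction is
    nonzero. The relative height of the point is then [frac_part s], the number whose bits define
    randomness. *)
Lemma line_frame (l : set 'cV[R]_n) (s : R) : is_line l ->
  exists (i : 'I_n) (c d : 'cV[R]_n),
    [/\ l = line_through c d, c i 0 = (Num.floor s)%:~R, d i 0 = (Num.floor s)%:~R + 1 &
        line_at l s = c + frac_part s *: (d - c)].
Proof.
move=> hl; have [p [v [v0 el]]] := hl; set z : R := (Num.floor s)%:~R.
have exi : exists k, [exists i : 'I_n, (nat_of_ord i == k) && (v i 0 != 0)].
  apply: contrapT => no; move/eqP: v0; apply; apply/matrixP => i j; rewrite ord1 mxE.
  apply/eqP; apply: contra_notT no => vi; exists (nat_of_ord i); apply/existsP; exists i.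
  by rewrite eqxx.
case: (ex_minnP exi) => k /existsP[i /andP[/eqP ik vi]] min.
pose c := p + ((z - p i 0) / v i 0) *: v; pose d := c + (v i 0)^-1 *: v.
have ci : c i 0 = z by rewrite /c !mxE divfK // addrC subrK.
have di : d i 0 = z + 1 by rewrite /d mxE ci mxE mulVf.
have lc : l c by rewrite el; eexists.
have ld : l d.
  rewrite el /d /c; exists ((z - p i 0) / v i 0 + (v i 0)^-1) => //.
  by rewrite scalerDl addrA.
have cd : c != d.
  by apply/eqP => e; move: di; rewrite -e ci => /eqP;
    rewrite addrC -subr_eq subrr eq_sym oner_eq0.
have elt := line_through_two hl lc ld cd.
exists i, c, d; split=> //; rewrite {1}elt.
have es : s = z + frac_part s by rewrite /frac_part addrC subrK.
rewrite [X in line_at _ X = _]es; apply: (line_at_through _ ci di).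
move=> j ji; have [vj|vj] := eqVneq (v j 0) 0; first by rewrite /d [in RHS]mxE [X in _ + X]mxE vj mulr0 addr0.
have /min : [exists i : 'I_n, (nat_of_ord i == j) && (v i 0 != 0)].
  by apply/existsP; exists j; rewrite eqxx.
by rewrite leqNgt -ik ji.
Qed.

Lemma ratr_proj_entry (c d : 'I_n -> rat) k m :
  ratr (proj_entry c d k m) = proj_entry (fun k => ratr (c k) : R) (fun k => ratr (d k)) k m.
Proof.
rewrite /proj_entry fmorph_div rmorphM !rmorphB rmorph_sum; congr (_ / _).
by apply: eq_bigr => j _; rewrite rmorphM !rmorphB.
Qed.

Lemma ratr_base_entry (c d : 'I_n -> rat) k :
  ratr (base_entry c d k) = base_entry (fun k => ratr (c k) : R) (fun k => ratr (d k)) k.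
Proof.
rewrite /base_entry rmorphB rmorph_sum; congr (_ - _); apply: eq_bigr => m _.
by rewrite rmorphM /= ratr_proj_entry.
Qed.

Lemma represents_line_of_points (c d : 'I_n -> rat) (i : 'I_n) : c i != d i ->
  represents (line_of_points c d)
    (line_through (\col_k (ratr (c k) : R)) (\col_k (ratr (d k) : R))).
Proof.
move=> ne; have cd : \col_k (ratr (c k) : R) != \col_k (ratr (d k) : R).
  apply: contra_neq ne => /matrixP/(_ i 0); rewrite !mxE => /eqP.
  by rewrite (inj_eq (fmorph_inj _)) => /eqP.
split.
- exists (\col_k (ratr (c k) : R)), (\col_k (ratr (d k) : R) - \col_k (ratr (c k) : R)).
  by rewrite subr_eq0 eq_sym.
- rewrite line_proj_through //; apply/matrixP => k m; rewrite !mxE ratr_proj_entry.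
  by rewrite /proj_entry !mxE; congr (_ / _); apply: eq_bigr => j _; rewrite !mxE.
rewrite line_base_through //; apply/matrixP => k m; rewrite !mxE ratr_base_entry.
rewrite /base_entry !mxE; congr (_ - _); apply: eq_bigr => j _; rewrite /proj_entry !mxE.
by congr (_ / _ * _); apply: eq_bigr => ? _; rewrite !mxE.
Qed.

Lemma apx_grid_point B (a : nat -> 'I_n -> nat) (x : 'I_n -> R) k :
  apx (fun r => (a r k)%:R * 2 ^- r) (x k + B%:R) ->
  apx (fun r => ratr (grid_point B r (a r) k)) (x k).
Proof.
move=> h; have := apx_sub h (apx_const B%:R); rewrite addrK; apply: apx_ext.
exists 0%N => r _; rewrite /grid_point rmorphB fmorph_div /= !ratr_nat.
by rewrite rmorphXn /= ratr_nat.
Qed.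

Lemma apx_proj_entry (c d : nat -> 'I_n -> R) (x y : 'I_n -> R) :
  (forall k, apx (fun r => c r k) (x k)) -> (forall k, apx (fun r => d r k) (y k)) ->
  \sum_(m <- enum 'I_n) (y m - x m) * (y m - x m) != 0 -> forall k m,
  apx (fun r => proj_entry (c r) (d r) k m) (proj_entry x y k m).
Proof.
move=> hc hd w0 k m; apply: apx_mul; first by apply: apx_mul; apply: apx_sub.
by apply: apx_inv => //; apply: apx_sum => j; apply: apx_mul; apply: apx_sub.
Qed.

Lemma apx_base_entry (c d : nat -> 'I_n -> R) (x y : 'I_n -> R) :
  (forall k, apx (fun r => c r k) (x k)) -> (forall k, apx (fun r => d r k) (y k)) ->
  \sum_(m <- enum 'I_n) (y m - x m) * (y m - x m) != 0 -> forall k,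
  apx (fun r => base_entry (c r) (d r) k) (base_entry x y k).
Proof.
move=> hc hd w0 k; apply: apx_sub => //; apply: apx_sum => j.
by apply: apx_mul => //; apply: apx_proj_entry.
Qed.

Lemma apx_quant_real B (x : R) : 0 <= x + B%:R ->
  apx (fun r => (quant B r x)%:R * 2 ^- r) (x + B%:R).
Proof.
move=> x0; apply: apx_close => r; have /andP[h1 h2] := quant_close r x0.
have p0 : 0 < 2 ^+ r :> R by rewrite exprn_gt0.
rewrite -[X in _ - X](mulfK (lt0r_neq0 p0)) -mulrBl normrM normfV (ger0_norm (ltW p0)).
rewrite -[leRHS]mul1r ler_pM2r ?invr_gt0 // distrC ler_norml.
by move: h1 h2; rewrite -natr1; lra.
Qed.

Section Frame.

Variables (c d : 'cV[R]_n) (i : 'I_n) (z : int) (B : nat).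
Hypotheses (ci : c i 0 = z%:~R) (di : d i 0 = z%:~R + 1).
Hypotheses (cB : forall k, 0 < c k 0 + B%:R) (dB : forall k, 0 < d k 0 + B%:R).

Let w0 : \sum_(m <- enum 'I_n) (d m 0 - c m 0) * (d m 0 - c m 0) != 0.
Proof.
rewrite sum_enum; have -> : \sum_(m < n) (d m 0 - c m 0) * (d m 0 - c m 0) = dot (d - c) (d - c).
  by apply: eq_bigr => k _; rewrite !mxE.
rewrite gt_eqF // dot_gt0 //; apply/eqP => /matrixP/(_ i 0); rewrite !mxE di ci.
by rewrite addrC addKr => /eqP; rewrite oner_eq0.
Qed.

Let c_neq_d : c != d.
Proof.
by apply/eqP => e; move: di; rewrite -e ci => /eqP;
  rewrite addrC -subr_eq subrr eq_sym oner_eq0.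
Qed.

Lemma line_proj_frame k m : line_proj (line_through c d) k m =
  proj_entry (fun k => c k 0) (fun k => d k 0) k m.
Proof. by rewrite line_proj_through // mxE. Qed.

Lemma line_base_frame k : line_base (line_through c d) k 0 =
  base_entry (fun k => c k 0) (fun k => d k 0) k.
Proof. by rewrite line_base_through // mxE. Qed.

(** Integers lie on the grid, so coordinate [i] of the two ends is rounded without error and the
    grid points stay distinct. *)
Lemma quant_int r (y : R) (a : int) : y = a%:~R -> 0 < y + B%:R ->
  (quant B r y)%:R / 2 ^+ r - B%:R = a%:~R :> rat.
Proof.
move=> -> ya; have [N eN] : exists N : nat, (a + B%:Z)%R = N%:Z.
  have : 0 < a + B%:Z by rewrite -(ltr_int R) rmorphD.
  by case: (a + B%:Z) => N // _; exists N.
have eNF (F : numFieldType) : a%:~R + B%:R = N%:R :> F.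
  by rewrite -[N%:R]/(N%:Z%:~R) -eN rmorphD.
rewrite /quant eNF -natrX -natrM natrK natrM natrX mulfK ?expf_neq0 ?pnatr_eq0 //.
by rewrite -eNF addrK.
Qed.

(** Rounding costs a constant factor in the distance. Taking [m] to be that factor, [m] further bits
    compensate for it since [m < 2 ^ m]. *)
Lemma grid_line_within : exists m r0, forall r, (r0 <= r)%N ->
  rat_lines_within r (line_through c d)
    (grid_line B (r + m) (fun k => quant B (r + m) (c k 0)) (fun k => quant B (r + m) (d k 0))).
Proof.
pose C r := grid_point B r (fun k => quant B r (c k 0)).
pose D r := grid_point B r (fun k => quant B r (d k 0)).
have aC k : apx (fun r => ratr (C r k)) (c k 0).
  by apply: (@apx_grid_point B _ (fun k => c k 0)); apply: apx_quant_real; apply: ltW.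
have aD k : apx (fun r => ratr (D r k)) (d k 0).
  by apply: (@apx_grid_point B _ (fun k => d k 0)); apply: apx_quant_real; apply: ltW.
have [C1 [r1 H1]] := exists_apx_diff (T := ('I_n * 'I_n)%type)
  (fun km => apx_proj_entry aC aD w0 km.1 km.2) (fun km => apx_const _).
have [C2 [r2 H2]] := exists_apx_diff
  (fun k => apx_base_entry aC aD w0 k) (fun k => apx_const _).
pose m := ((n * n + n) * (C1 + C2))%N; exists m, (maxn r1 r2) => r.
rewrite geq_max => /andP[h1 h2].
have {}h1 : (r1 <= r + m)%N by apply: leq_trans h1 (leq_addr _ _).
have {}h2 : (r2 <= r + m)%N by apply: leq_trans h2 (leq_addr _ _).
have ne : C (r + m)%N i != D (r + m)%N i.
  have di' : d i 0 = (z + 1)%:~R by rewrite di rmorphD.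
  rewrite /C /D /grid_point (quant_int _ ci (cB i)) (quant_int _ di' (dB i)).
  by rewrite eqr_int; lia.
exists (line_through (\col_k (ratr (C (r + m)%N k) : R)) (\col_k (ratr (D (r + m)%N k) : R))).
  exact: represents_line_of_points ne.
have [_ eP et] := represents_line_of_points ne.
apply: le_trans (@line_dist_le _ _ _ _ ((C1 + C2)%:R * 2 ^- (r + m)) _ _) _.
- move=> k j; rewrite eP line_proj_frame !mxE ratr_proj_entry.
  apply: le_trans (H1 _ h1 (k, j)) _.
  by rewrite ler_pM2r ?pow2V_gt0 // ler_nat leq_addr.
- move=> k; rewrite et line_base_frame !mxE ratr_base_entry.
  apply: le_trans (H2 _ h2 k) _.
  by rewrite ler_pM2r ?pow2V_gt0 // ler_nat leq_addl.
rewrite mulrA -natrM -/m exprD invfM mulrCA -[leRHS]mulr1 ler_pM2l ?pow2V_gt0 //.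
by rewrite ler_pdivrMr ?exprn_gt0 // mul1r -natrX ler_nat ltnW // ltn_expl.
Qed.

Variable pl : nat -> rat_line n.
Variable r0 : nat.
Hypothesis pl_within : forall r, (r0 <= r)%N -> rat_lines_within r (line_through c d) (pl r).

Lemma apx_quant_line (k : 'I_n) :
  let lam r := quant_line i z%:~R B r (code_line (pl r)) in
  apx (fun r => (entry (cfst (lam r)) k)%:R * 2 ^- r) (c k 0 + B%:R) /\
  apx (fun r => (entry (csnd (lam r)) k)%:R * 2 ^- r) (d k 0 + B%:R).
Proof.
have aP a b : apx (fun r => ratr ((pl r).1 a b))
    (proj_entry (fun k => c k 0) (fun k => d k 0) a b : R).
  exists 1, r0 => r /pl_within[l' [_ eP _] /line_dist_entries[/(_ a b) h _]].
  by move: h; rewrite eP line_proj_frame mxE mul1r.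
have at_ a : apx (fun r => ratr ((pl r).2 a 0)) (base_entry (fun k => c k 0) (fun k => d k 0) a : R).
  exists 1, r0 => r /pl_within[l' [_ _ et] /line_dist_entries[_ /(_ a) h]].
  by move: h; rewrite et line_base_frame mxE mul1r.
have Pii : proj_entry (fun k => c k 0) (fun k => d k 0) i i != 0.
  rewrite /proj_entry mulf_neq0 ?invr_neq0 // ci di.
  by rewrite addrC addKr mulr1 oner_neq0.
have H (z' : rat) (a : R) : ratr z' = z%:~R + a -> 0 < c k 0 + a * (d k 0 - c k 0) + B%:R ->
    apx (fun r => (quant B r (point_at_height i z' (fun a b => (pl r).1 a b)
      (fun a => (pl r).2 a 0) k))%:R * 2 ^- r) (c k 0 + a * (d k 0 - c k 0) + B%:R).
  move=> ez pos; apply: apx_quant => //.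
  rewrite -(@point_at_heightE _ _ i z%:~R a (fun k => c k 0) (fun k => d k 0) k ci di w0).
  apply: (@apx_ext _ (fun r => point_at_height i (z%:~R + a) (fun a b => ratr ((pl r).1 a b))
      (fun a => ratr ((pl r).2 a 0)) k)).
    by exists 0%N => r _; rewrite /point_at_height rmorphD rmorphM rmorphB fmorph_div /= ez.
  apply: apx_add => //; apply: apx_mul.
    by apply: apx_sub => //; apply: apx_const.
  by apply: apx_mul => //; apply: apx_inv.
move=> lam; split.
  have := H z%:~R 0; rewrite ratr_int addr0 mul0r addr0 => /(_ erefl (cB k)).
  apply: apx_ext; exists 0%N => r _; rewrite /lam /quant_line cfstK entry_tuple.
  by congr (_%:R * _); rewrite /code_line !cpairE /point_at_height !code_mxK.
have ez : ratr (z%:~R + 1) = z%:~R + 1 :> R by rewrite rmorphD /= ratr_int rmorph1.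
have ed : c k 0 + 1 * (d k 0 - c k 0) = d k 0 by ring.
have := H (z%:~R + 1) 1 ez; rewrite ed => /(_ (dB k)).
apply: apx_ext; exists 0%N => r _; rewrite /lam /quant_line csndK entry_tuple.
by congr (_%:R * _); rewrite /code_line !cpairE /point_at_height !code_mxK.
Qed.

End Frame.

(** Interpolation is polynomial in approximated quantities, so its error is a constant number of
    grid units: the tolerance [E]. *)
Lemma incident_of_apx (c d x : 'I_n -> R) (h : R) B (J u lam : nat -> nat) :
  (forall r, (J r <= 2 ^ r)%N) ->
  apx (fun r => (J r)%:R * 2 ^- r) h ->
  (forall k : 'I_n, apx (fun r => (entry (u r) k)%:R * 2 ^- r) (x k + B%:R)) ->
  (forall k : 'I_n, apx (fun r => (entry (cfst (lam r)) k)%:R * 2 ^- r) (c k + B%:R)) ->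
  (forall k : 'I_n, apx (fun r => (entry (csnd (lam r)) k)%:R * 2 ^- r) (d k + B%:R)) ->
  (forall k, x k = c k + h * (d k - c k)) ->
  exists E r0, forall r, (r0 <= r)%N -> incident n E r (J r) (u r) (lam r).
Proof.
move=> Jr aJ au ac ad ex.
have aL k := apx_add (apx_mul (apx_sub (apx_const 1) aJ) (ac k)) (apx_mul aJ (ad k)).
have eL k : (1 - h) * (c k + B%:R) + h * (d k + B%:R) = x k + B%:R by rewrite ex; ring.
have aL' (k : 'I_n) : apx (fun r => (1 - (J r)%:R * 2 ^- r) * ((entry (cfst (lam r)) k)%:R * 2 ^- r) +
    (J r)%:R * 2 ^- r * ((entry (csnd (lam r)) k)%:R * 2 ^- r)) (x k + B%:R).
  by rewrite -eL.
have [E [r0 H]] := exists_apx_diff aL' au.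
exists E, r0 => r /H {}H; apply/allP => k _ /=.
have := H k; set a := entry (cfst _) k; set b := entry (csnd _) k; set v := entry (u r) k.
set P : R := 2 ^+ r; have P0 : 0 < P by rewrite exprn_gt0.
have Pn : P != 0 by rewrite gt_eqF.
have -> : (1 - (J r)%:R / P) * (a%:R / P) + (J r)%:R / P * (b%:R / P) - v%:R / P =
    ((P - (J r)%:R) * a%:R + (J r)%:R * b%:R - P * v%:R) / (P * P) by field.
rewrite normrM normfV (ger0_norm (ltW (mulr_gt0 P0 P0))) ler_pdivrMr ?mulr_gt0 //.
have -> : E%:R / P * (P * P) = E%:R * P by field.
rewrite ler_norml -!(ler_nat R) !natrD !natrM natrB // !natrX -/P.
move: (_ * b%:R) (_ * a%:R) (P * v%:R) (E%:R * P) => t1 t2 t3 t4.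
by move=> /andP[? ?]; apply/andP; split; lra.
Qed.

(** A coordinate on the grid finer by [m] bits is known up to [E]. Adding [E] keeps the correction a
    natural number. *)
Lemma apx_nat_diff B m (c : 'I_n -> R) (a : nat -> 'I_n -> nat) :
  (forall k, 0 < c k + B%:R) ->
  (forall k, apx (fun r => (a r k)%:R * 2 ^- r) (c k + B%:R)) ->
  exists E r0, forall r, (r0 <= r)%N -> forall k,
    (2 ^ m * a r k <= quant B (r + m) (c k) + E <= 2 ^ m * a r k + E + E)%N.
Proof.
move=> cB ac.
have aq k : apx (fun r => (quant B (r + m) (c k))%:R * 2 ^- (r + m)) (c k + B%:R).
  exact: (@apx_shift _ (fun r => (quant B r (c k))%:R * 2 ^- r)) (apx_quant_real (ltW (cB k))).
have [C [r0 H]] := exists_apx_diff aq ac.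
exists (C * 2 ^ m)%N, r0 => r /H {}H k.
have := H k; set q := quant _ _ _; rewrite exprD.
set P : R := 2 ^+ r; set M : R := 2 ^+ m.
have P0 : 0 < P by rewrite exprn_gt0. have M0 : 0 < M by rewrite exprn_gt0.
have Pn : P != 0 by rewrite gt_eqF. have Mn : M != 0 by rewrite gt_eqF.
have -> : q%:R / (P * M) - (a r k)%:R / P = (q%:R - M * (a r k)%:R) / (P * M).
  by field; rewrite Pn Mn.
rewrite normrM normfV (ger0_norm (ltW (mulr_gt0 P0 M0))) ler_pdivrMr ?mulr_gt0 //.
have -> : C%:R / P * (P * M) = C%:R * M by field.
rewrite ler_norml -!(ler_nat R) !natrD !natrM !natrX -/M.
move: (M * _) (C%:R * M) => t1 t2.
by move=> /andP[? ?]; apply/andP; split; lra.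
Qed.

End LineFrame.

Lemma rat_approx (R : realType) (x e : R) : 0 < e -> exists q : rat, `|ratr q - x| < e.
Proof.
move=> e0; have lt : x < x + e by rewrite ltrDl.
have [q] := rat_in_itvoo lt.
by rewrite in_itv /= => /andP[h1 h2]; exists q; rewrite ltr_norml; lra.
Qed.

Lemma rat_point_near (R : realType) n (x : 'cV[R]_n) r :
  exists p : 'cV[rat]_n, enorm (map_mx ratr p - x) < 2 ^- r.
Proof.
have e0 : 0 < 2 ^- r / n.+1%:R :> R by rewrite divr_gt0 ?pow2V_gt0.
have [q Hq] := choice (fun k : 'I_n => rat_approx (x k 0) e0).
exists (\col_k q k); apply: le_lt_trans (enorm_le_sum _) _.
apply: le_lt_trans (_ : \sum_(k < n) 2 ^- r / n.+1%:R < _) => [|].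
  by apply: ler_sum => k _; rewrite !mxE ltW.
rewrite sumr_const card_ord -[ltLHS]mulr_natr -mulrA -[ltRHS]mulr1 ltr_pM2l ?pow2V_gt0 //.
by rewrite mulrC ltr_pdivrMr // mul1r ltr_nat.
Qed.

(** * Assembly *)

Section Growth.

Implicit Types f g : nat -> nat.

Definition bigo g f : Prop := exists C r0, forall r, (r0 <= r)%N -> (f r <= C * g r)%N.

Lemma bigo_add g f f' : bigo g f -> bigo g f' -> bigo g (fun r => f r + f' r)%N.
Proof.
move=> [C [r0 H]] [C' [r1 H']]; exists (C + C')%N, (maxn r0 r1) => r.
by rewrite geq_max => /andP[/H h /H' h']; rewrite mulnDl leq_add.
Qed.

Lemma bigo_mulc g f c : bigo g f -> bigo g (fun r => c * f r)%N.
Proof.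
by move=> [C [r0 H]]; exists (c * C)%N, r0 => r /H h; rewrite -mulnA leq_mul.
Qed.

Lemma bigo_le g f f' : (exists r0, forall r, (r0 <= r)%N -> (f r <= f' r)%N) ->
  bigo g f' -> bigo g f.
Proof.
move=> [r1 le] [C [r0 H]]; exists C, (maxn r0 r1) => r.
by rewrite geq_max => /andP[/H h /le]; move/leq_trans; apply.
Qed.

Lemma bigo_refl g : bigo g g.
Proof. by exists 1%N, 0%N => r _; rewrite mul1n. Qed.

Lemma bigo_ell_const c : bigo ell (fun=> c).
Proof. by exists c, 0%N => r _; rewrite -[X in (X <= _)%N]muln1 leq_mul ?ell_gt0. Qed.

Lemma bigo_lin_const c : bigo id (fun=> c).
Proof. by exists c, 1%N => r r0; rewrite -[X in (X <= _)%N]muln1 leq_mul. Qed.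

Lemma bigo_lin_ell f : bigo ell f -> bigo id f.
Proof.
move=> [C [r0 H]]; exists (2 * C)%N, (maxn r0 1) => r; rewrite geq_max => /andP[/H h r1].
apply: leq_trans h _; rewrite (mulnC 2) -mulnA leq_mul //.
by have := ell_le_id r; lia.
Qed.

Lemma bigo_ell_lin f : bigo id f -> bigo ell (fun r => ell (f r)).
Proof.
move=> [C [r0 H]]; exists (ell C).+1, r0 => r /H /ell_leq h; apply: leq_trans h _.
apply: leq_trans (ell_mul C r) _; rewrite mulSn addnC leq_add2l.
by rewrite -[X in (X <= _)%N]muln1 leq_mul ?ell_gt0.
Qed.

Lemma bigo_ell_cpair f f' : bigo ell (fun r => ell (f r)) -> bigo ell (fun r => ell (f' r)) ->
  bigo ell (fun r => ell (cpair (f r) (f' r))).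
Proof.
move=> h h'; apply: bigo_le (bigo_mulc 2 (bigo_add h h')).
by exists 0%N => r _; apply: ell_cpair.
Qed.

(** For [t = trunc_log 2 r], the square of [t./2.+1] is at most [2 ^ t <= r]. From [4 * C <= t] one
    gets [2 * C <= t./2.+1], while [ell r <= 2 * t./2.+1]. *)
Lemma mul_ell_le C : exists r0, forall r, (r0 <= r)%N -> (C * ell r <= r)%N.
Proof.
exists (2 ^ (4 * C))%N => r hr; have r0 : (0 < r)%N by apply: leq_trans hr; rewrite expn_gt0.
have lt : (4 * C <= trunc_log 2 r)%N by apply: trunc_log_max.
have := trunc_logP (isT : 1 < 2)%N r0; rewrite /ell; set t := trunc_log 2 r in lt *.
have /leq_trans h : (t./2.+1 * t./2.+1 <= 2 ^ t)%N.
  apply: leq_trans (_ : _ <= 2 ^ t./2 * 2 ^ t./2)%N _.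
    by apply: leq_mul; apply: ltn_expl.
  by rewrite -expnD leq_exp2l // addnn -[X in (_ <= X)%N]odd_double_half leq_addl.
move=> /h; apply: leq_trans; have e : (t + 1 <= 2 * t./2.+1)%N.
  by have := odd_double_half t; case: odd => /=; lia.
apply: leq_trans (leq_mul (leqnn C) e) _; rewrite mulnA leq_mul //.
by have := odd_double_half t; case: odd => /=; lia.
Qed.

End Growth.

Lemma ell_code_seq m : exists C, forall (s : seq nat) t, size s = m ->
  (forall x, x \in s -> (ell x <= t)%N) -> (0 < t)%N -> (ell (code_seq s) <= C * t)%N.
Proof.
elim: m => [|m [C IH]]; first by exists 1%N => -[|//] t _ _ t0; rewrite mul1n.
exists (2 * C + 3)%N => -[|x s] //= t [sm] h t0.
have hs : (ell (code_seq s) <= C * t)%N.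
  by apply: IH => // y ys; apply: h; rewrite inE ys orbT.
have hx := h x (mem_head _ _).
apply: leq_trans (ellS _) _; have := ell_cpair x (code_seq s).
lia.
Qed.

Lemma ell_tuple n : exists C, forall (f : 'I_n -> nat) t, (0 < t)%N ->
  (forall k, (ell (f k) <= t)%N) -> (ell (tuple_code f) <= C * t)%N.
Proof.
have [C H] := ell_code_seq n; exists C => f t t0 h; apply: H => //.
  by rewrite size_map size_enum_ord.
by move=> _ /mapP[k _ ->].
Qed.

Lemma ell_tuple_apx (R : realType) n (f : nat -> 'I_n -> nat) (x : 'I_n -> R) :
  (forall k, apx (fun r => (f r k)%:R * 2 ^- r) (x k)) ->
  bigo id (fun r => ell (tuple_code (f r))).
Proof.
move=> af; have [C HC] := ell_tuple n.
have Mx k : exists Mr : nat * nat, forall r, (Mr.2 <= r)%N -> (f r k <= Mr.1 * 2 ^ r)%N.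
  have [M [r0 H]] := apx_bounded (af k); exists ((Num.truncn M).+1, r0) => r /H /=.
  have p0 : 0 <= 2 ^- r :> R by apply/ltW/pow2V_gt0.
  rewrite (ger0_norm (mulr_ge0 _ p0)) // ler_pdivrMr ?exprn_gt0 // => h.
  rewrite -(ler_nat R) natrM natrX; apply: le_trans h _.
  by rewrite ler_wpM2r ?exprn_ge0 // ltW // truncnS_gt.
have [Mr HM] := choice Mx; pose M := \max_k (Mr k).1.
apply: bigo_le (bigo_mulc C (bigo_add (bigo_lin_const (ell M + 1)) (bigo_refl id))).
exists (\max_k (Mr k).2) => r hr; apply: HC => [|k]; first by rewrite addnAC addn1.
have := HM k r (leq_trans (leq_bigmax k) hr) => h.
have {}h : (f r k <= M * 2 ^ r)%N by apply: leq_trans h _; rewrite leq_mul // leq_bigmax.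
apply: leq_trans (ell_leq h) _; apply: leq_trans (ell_mul _ _) _.
rewrite -addnA leq_add2l; apply: ell_le; first by rewrite addn_gt0.
by rewrite add1n ltn_exp2l.
Qed.

Section Assembly.

Variables (U : machine) (hU : universal_prefix_free U).

Lemma condK_le_ell : exists c, forall A x tau, (condK U A x tau <= c * ell x)%N.
Proof.
have [|c H] := @coding U hU (fun _ v _ y _ => y == v); first by move=> *; comp_tac.
exists (2 * c)%N => A x tau; apply: leq_trans (H A x tau 0%N x 0%N _ (eqxx _)) _.
  move=> [|a [|b ys]] //= /andP[+ _] ab; rewrite inE negb_or => /andP[/eqP[]].
  have [_ /eqP->] := ab a (mem_head _ _).
  by have [|_ /eqP->] := ab b; rewrite // !inE eqxx orbT.
have e0 : ell 0 = 1%N by []; rewrite e0; have := ell_gt0 x; nia.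
Qed.

Lemma K_map0 (f : nat -> nat -> nat) :
  (forall v s, comp v -> comp s -> comp (fun A x => f (v A x) (s A x))) ->
  exists c, forall A v s, (K U A (f v s) <= K U A s + c * (ell v + ell (K U A s)))%N.
Proof.
move=> cf; have [||c H] := K_map hU (f := fun v _ s => f v s) (g := fun _ _ _ => 0%N).
- by move=> v tau s cv ct cs; apply: cf.
- by move=> v tau cv ct; comp_tac.
by exists c => A v s; apply: (H A v 0%N s).
Qed.

End Assembly.

(** The default 0 is kept as a case of its own; there the independence hypothesis makes the
    complexity of the line logarithmic. *)
Lemma greatest_cases X : greatest X = 0%N \/ X (greatest X).
Proof.
have [[m Pm]|no] := pselect (exists m, X m /\ forall k, X k -> (k <= m)%N).
  by right; rewrite /greatest; case: (xgetI 0%N (P := [set m | X m /\ forall k, X k -> (k <= m)%N]) Pm).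
by left; apply: xgetPN => m Pm; apply: no; exists m.
Qed.

Lemma log2_le_ell (R : realType) r : (0 < r)%N -> log2 r%:R <= (ell r)%:R :> R.
Proof.
move=> r0; have ln2 : 0 < ln 2 :> R by rewrite ln_gt0 // ltr1n.
rewrite /log2 ler_pdivrMr // mulr_natl -lnXn // ler_ln ?posrE ?ltr0n ?exprn_gt0 //.
by rewrite -natrX ler_nat ltnW // ltn_ell.
Qed.

Lemma tuple_code_entry n (f : 'I_n -> nat) :
  tuple_code (fun k : 'I_n => entry (tuple_code f) k) = tuple_code f.
Proof. by rewrite /tuple_code; congr code_seq; apply/eq_map => k; rewrite entry_tuple. Qed.

Lemma valid_quant_line n i z B r x : valid_line n (@quant_line n i z B r x).
Proof. by rewrite /valid_line /quant_line !cpairE !tuple_code_entry. Qed.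

(** A rational near [s] may round to a neighbouring height. The error is at most 2 either way, so a
    correction between 0 and 4 recovers [J]. *)
Lemma quant_height (R : realType) (s : R) (q : rat) B b r :
  (Num.floor s)%:~R + B%:R = b%:R :> R -> (0 < b)%N -> `|ratr q - s| < 2 ^- r ->
  let J := Num.truncn (frac_part s * 2 ^+ r) in
  (quant B r q <= J + (2 ^ r * b + 2))%N /\ (J + 2 ^ r * b <= quant B r q + 2)%N.
Proof.
move=> eb b0 qs J; have /andP[f0 f1] := frac_part_bounds s.
have P0 : 0 < 2 ^+ r :> R by rewrite exprn_gt0.
have f2 : 0 <= frac_part s * 2 ^+ r by rewrite mulr_ge0 // ltW.
have /andP[j1 j2] := truncn_itv f2; rewrite -/J in j1 j2.
have es : s + B%:R = b%:R + frac_part s by rewrite -eb /frac_part; ring.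
have p1 : 2 ^- r <= 1 :> R by apply: pow2V_le1.
have b1 : 1 <= b%:R :> R by rewrite ler1n.
move: qs; rewrite ltr_norml => /andP[q1 q2].
have qB : 0 <= q + B%:R.
  rewrite -(ler0q R) rmorphD /= ratr_nat.
  by move: es f0 q1 b1 p1; move: (ratr q) (2 ^- r) (frac_part s) (B%:R) (b%:R) => *; lra.
have /andP[] := quant_close r qB; set a := quant B r q.
have er : ratr ((q + B%:R) * 2 ^+ r) = (ratr q + B%:R) * 2 ^+ r :> R.
  by rewrite rmorphM rmorphXn /= rmorphD /= !ratr_nat.
rewrite -(ler_rat R) -(ltr_rat R) er !ratr_nat => a1 a2.
have u1 : (ratr q + B%:R) * 2 ^+ r < (b%:R + frac_part s) * 2 ^+ r + 1.
  rewrite -es -[X in _ < _ + X](mulVf (lt0r_neq0 P0)) -mulrDl ltr_pM2r //.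
  by move: q2; move: (2 ^- r) => p; lra.
have u2 : (b%:R + frac_part s) * 2 ^+ r - 1 < (ratr q + B%:R) * 2 ^+ r.
  rewrite -es -[X in _ - X < _](mulVf (lt0r_neq0 P0)) -mulrBl ltr_pM2r //.
  by move: q1; move: (2 ^- r) => p; lra.
rewrite [(b%:R + _) * _]mulrDl in u1 u2.
have eb2 : (2 ^ r * b)%:R = b%:R * 2 ^+ r :> R by rewrite natrM natrX mulrC.
rewrite -[J.+1%:R]natr1 in j2; rewrite -[a.+1%:R]natr1 in a2.
split; rewrite -ltnS -(ltr_nat R).
  rewrite -[(J + _).+1]addn1 !natrD eb2; move: a1 u1 j2.
  by move: ((ratr q + _) * _) (b%:R * _) (frac_part s * _) => *; lra.
rewrite -[(a + 2).+1]addn1 !natrD eb2; move: a2 u2 j1.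
by move: ((ratr q + _) * _) (b%:R * _) (frac_part s * _) => *; lra.
Qed.

Lemma shift_positive (R : realType) n (c d : 'cV[R]_n) : exists B : nat,
  (forall k, 0 < c k 0 + B%:R) /\ (forall k, 0 < d k 0 + B%:R).
Proof.
exists (Num.truncn (\sum_k `|c k 0| + \sum_k `|d k 0|)).+1.
set S := \sum_k _ + _; have lt := truncnS_gt S.
have le (e : 'cV[R]_n) k : `|e k 0| <= \sum_k `|e k 0|.
  by rewrite (bigD1 k) //= lerDl sumr_ge0.
have c0 : 0 <= \sum_k `|c k 0| by apply: sumr_ge0.
have d0 : 0 <= \sum_k `|d k 0| by apply: sumr_ge0.
split=> k; [have := le c k|have := le d k];
  rewrite ler_norml => /andP[+ _]; move: lt c0 d0; rewrite /S;
  move: (\sum_k `|c k 0|) (\sum_k `|d k 0|) (_.+1%:R) => *; lra.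
Qed.

Lemma K_line_attained (R : realType) (U : machine) A n r (l : set 'cV[R]_n) p :
  rat_lines_within r l p ->
  exists2 p', rat_lines_within r l p' & K_line U A r l = K U A (code_line p').
Proof.
move=> h; have [p' ? <-] : [set K U A (code_line p) | p in rat_lines_within r l] (K_line U A r l).
  by apply: (@least_in _ (K U A (code_line p))); exists p.
by exists p'.
Qed.

Lemma K_point_attained (R : realType) (U : machine) A n r (x : 'cV[R]_n) :
  exists2 p : 'cV[rat]_n, enorm (map_mx ratr p - x) < 2 ^- r &
    K_point U A r x = K U A (code_mx p).
Proof.
have [p0 h0] := rat_point_near x r.
have [p ? <-] : [set K U A (code_mx p) |
    p in [set p : 'cV[rat]_n | enorm (map_mx ratr p - x) < 2 ^- r]] (K_point U A r x).
  by apply: (@least_in _ (K U A (code_mx p0))); exists p0.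
by exists p.
Qed.

Lemma K_line_le (R : realType) (U : machine) A n r (l : set 'cV[R]_n) p :
  rat_lines_within r l p -> (K_line U A r l <= K U A (code_line p))%N.
Proof. by move=> h; apply: least_le; exists p. Qed.

Lemma condK_line_cases (R : realType) (U : machine) A n r (l : set 'cV[R]_n) (s : R) :
  condK_line U A r l s = 0%N \/
  exists2 q, `|ratr q - s| < 2 ^- r & forall p, rat_lines_within r l p ->
    (condK_line U A r l s <= condK U A (code_line p) (code_rat q))%N.
Proof.
case: (greatest_cases [set least [set condK U A (code_line p) (code_rat q) |
    p in rat_lines_within r l] | q in [set q : rat | `|ratr q - s| < 2 ^- r]]).
  by left.
case=> q hq e; right; exists q => // p hp; rewrite /condK_line -e.
by apply: least_le; exists p.
Qed.

Lemma grid_line_ext n B r (a b a' b' : 'I_n -> nat) :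
  a =1 a' -> b =1 b' -> grid_line B r a b = grid_line B r a' b'.
Proof. by move=> /funext -> /funext ->. Qed.

Lemma addnBA_cancel t q e e' : (t <= q + e <= e')%N -> (t + (q + e - t) - e)%N = q.
Proof. by move=> /andP[h _]; rewrite subnKC // addnK. Qed.

(** * Transfer of the bound from the grid to the real line *)

Section Main.

Variables (R : realType) (U : machine) (hU : universal_prefix_free U) (n : nat).
Variables (A : set nat) (l : set 'cV[R]_n) (s : R).
Hypotheses (hl : is_line l) (hs : random U A s).
Variable C0 : nat.
Hypothesis hcond : forall r, (2 <= r)%N ->
  (K_line U A r l <= condK_line U A r l s + C0 * ell r)%N.

Lemma K_point_lower : exists C r0, forall r, (r0 <= r)%N ->
  (K_line U A r l + 2 * r <= 2 * K_point U A r (line_at l s) + C * ell r)%N.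
Proof.
have [i [c [d [el ci di ex]]]] := line_frame s hl.
set z := Num.floor s in ci di; set h := frac_part s in ex.
have /andP[h0 h1] := frac_part_bounds s; rewrite -/h in h0 h1.
have [B [cB dB]] := shift_positive c d.
set x := line_at l s in ex *.
have xE k : x k 0 = c k 0 + h * (d k 0 - c k 0) by rewrite ex !mxE.
have xB k : 0 < x k 0 + B%:R.
  have -> : x k 0 + B%:R = (1 - h) * (c k 0 + B%:R) + h * (d k 0 + B%:R) by rewrite xE; ring.
  by rewrite ltr_pwDl // ?mulr_gt0 ?subr_gt0 // mulr_ge0 // ltW.
have xi : x i 0 = s by rewrite xE ci di /h /frac_part -/z; ring.
have [b b0 eb] : exists2 b, (0 < b)%N & z%:~R + B%:R = b%:R :> R.
  have : 0 < z + B%:Z by rewrite -(ltr_int R) rmorphD /= -ci.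
  case eN : (z + B%:Z) => [N|//] N0; exists N => //.
  by rewrite -[N%:R]/(N%:Z%:~R) -eN rmorphD.
pose J r := Num.truncn (h * 2 ^+ r).
have Jr r : (J r < 2 ^ r)%N.
  by rewrite truncn_lt_nat ?mulr_ge0 ?exprn_ge0 // natrX gtr_pMl ?exprn_gt0.
have aJ : apx (fun r => (J r)%:R * 2 ^- r) h.
  have := @apx_quant_real R 0 h; rewrite addr0 => /(_ h0); apply: apx_ext.
  by exists 0%N => r _; rewrite /quant addr0.
have /choice[px Hpx] r : exists p : 'cV[rat]_n,
    enorm (map_mx ratr p - x) < 2 ^- r /\ K_point U A r x = K U A (code_mx p).
  by have [p] := K_point_attained U A r x; exists p.
have pxk r k : `|ratr (px r k 0) - x k 0| < 2 ^- r.
  apply: le_lt_trans (Hpx r).1.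
  by have := entry_le_enorm (map_mx ratr (px r) - x) k; rewrite !mxE.
pose u r := quant_point n B r (code_mx (px r)).
have uE r (k : 'I_n) : entry (u r) k = quant B r (px r k 0).
  by rewrite /u /quant_point entry_tuple code_mxK.
have au (k : 'I_n) : apx (fun r => (entry (u r) k)%:R * 2 ^- r) (x k 0 + B%:R).
  have ap : apx (fun r => ratr (px r k 0)) (x k 0) by apply: apx_close => r; apply: ltW.
  by apply: apx_ext (apx_quant ap (xB k)); exists 0%N => r _; rewrite uE.
have [m [r1 Hm]] := grid_line_within ci di cB dB; rewrite -el in Hm.
have /choice[pl Hpl] r : exists p, (r1 <= r)%N ->
    rat_lines_within r l p /\ K_line U A r l = K U A (code_line p).
  have [hr|_] := leqP r1 r; last by exists (0, 0).
  by have [p] := K_line_attained U A (Hm r hr); exists p.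
pose lam r := quant_line i z%:~R B r (code_line (pl r)).
have alam (k : 'I_n) : apx (fun r => (entry (cfst (lam r)) k)%:R * 2 ^- r) (c k 0 + B%:R) /\
    apx (fun r => (entry (csnd (lam r)) k)%:R * 2 ^- r) (d k 0 + B%:R).
  apply: (apx_quant_line (r0 := r1) ci di cB dB) => r /Hpl[hr _].
  by rewrite -el.
have [E [r2 inc]] := incident_of_apx (fun r => ltnW (Jr r)) aJ au
  (fun k => (alam k).1) (fun k => (alam k).2) xE.
have [E1 [r3 D1]] := apx_nat_diff m cB (fun k => (alam k).1).
have [E2 [r4 D2]] := apx_nat_diff m dB (fun k => (alam k).2).
(* Bounded corrections leading from the ends in [lam r] to the grid of scale [r + m], which is fine
   enough for precision [r]. *)
pose Delta r := cpair
  (tuple_code (fun k : 'I_n => quant B (r + m) (c k 0%R) + E1 - 2 ^ m * entry (cfst (lam r)) k)%N)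
  (tuple_code (fun k : 'I_n => quant B (r + m) (d k 0%R) + E2 - 2 ^ m * entry (csnd (lam r)) k)%N).
pose fl v w := code_line (@grid_line n B (cfst v + m)
  (fun k => 2 ^ m * entry (cfst w) k + entry (cfst (csnd v)) k - E1)%N
  (fun k => 2 ^ m * entry (csnd w) k + entry (csnd (csnd v)) k - E2)%N).
have cfl v w : comp v -> comp w -> comp (fun A y => fl (v A y) (w A y)).
  by move=> cv cw; apply: comp_grid_line => *; comp_tac; apply: comp_entry; comp_tac.
have [r5 flE] : exists r5, forall r, (r5 <= r)%N -> exists2 p, rat_lines_within r l p &
    fl (cpair r (Delta r)) (lam r) = code_line p.
  exists (maxn r1 (maxn r3 r4)) => r; rewrite !geq_max => /and3P[hr1 hr3 hr4].
  eexists; first exact: Hm r hr1.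
  have dc : cfst (Delta r) = tuple_code _ := cfstK _ _.
  have dd : csnd (Delta r) = tuple_code _ := csndK _ _.
  rewrite /fl (cfstK r) (csndK r) dc dd; congr (code_line _); apply: grid_line_ext => k.
    by rewrite entry_tuple (addnBA_cancel (D1 r hr3 k)).
  by rewrite entry_tuple (addnBA_cancel (D2 r hr4 k)).
have ellDelta : bigo ell (fun r => ell (Delta r)).
  have [CT HT] := ell_tuple n.
  have bound E' (q a : nat) : (2 ^ m * a <= q + E' <= 2 ^ m * a + E' + E')%N ->
      (ell (q + E' - 2 ^ m * a) <= ell (E' + E'))%N.
    by move: (2 ^ m * a)%N => t ?; apply: ell_leq; lia.
  apply: bigo_ell_cpair.
    apply: bigo_le (bigo_ell_const (CT * ell (E1 + E1))); exists r3 => r hr.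
    by apply: HT => [|k]; [exact: ell_gt0|exact/bound/D1].
  apply: bigo_le (bigo_ell_const (CT * ell (E2 + E2))); exists r4 => r hr.
  by apply: HT => [|k]; [exact: ell_gt0|exact/bound/D2].
clear D1 D2 Hm aJ.
have hu r : (quant B r (px r i 0%R) <= J r + (2 ^ r * b + 2))%N /\
    (J r + 2 ^ r * b <= quant B r (px r i 0%R) + 2)%N.
  by apply: quant_height => //; rewrite -xi.
have [k1 M1] := K_map0 hU (f := fun v w => quant_point n B v w) (fun v w => @comp_quant_point n B v w).
have [k2 M2] := K_map0 hU (f := fun v w => quant_line i z%:~R B v w)
  (fun v w => @comp_quant_line n i z%:~R B v w).
have [k3 M3] := K_map0 hU cfl.
(* A rational near [s] and a correction yield [J], and a program for [lam] given [J] can then be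
   run. This carries the hypothesis on [condK_line] over to [lam] and [J]. *)
have [||k4 M4] := K_map hU (f := fun v _ w => fl (cfst v) w)
  (g := fun v tau _ => (quant B (cfst (cfst v)) (dec_rat tau) + csnd v -
    (2 ^ cfst (cfst v) * b + 2))%N).
- by move=> v tau w cv ct cw; apply: cfl => //; comp_tac.
- by move=> v tau cv ct; comp_tac; apply: comp_quant; comp_tac; apply: ratc_dec_rat.
(* Coordinate [i] of the point is [s], so its grid value gives [J] up to a correction of at most
   4. *)
have [|k5 M5] := K_map0 hU (f := fun v w =>
    cpair (entry w i + csnd v - (2 ^ cfst v * b + 2)) w).
  by move=> v w cv cw; comp_tac; apply: comp_entry.
have [|k6 M6] := K_map0 hU (f := fun _ w => cfst w).
  by move=> v w cv cw; comp_tac.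
have [|k7 M7] := K_map0 hU (f := fun v w => (2 ^ v + w).-1).
  by move=> v w cv cw; comp_tac.
have [k8 Kell] := condK_le_ell hU.
have [kl Hl] := K_line_point hU n E.
have [cs Hs] := hs.
pose Ku r := K U A (u r); pose Kl r := K U A (lam r); pose KJ r := K U A (J r).
pose kap r := K_point U A r x; pose L r := K_line U A r l.
pose CK r := condK U A (lam r) (J r).
have linu : bigo id Ku.
  have au' (k : 'I_n) : apx (fun r => (quant B r (dec_mx (code_mx (px r)) k (0%R : 'I_1)))%:R * 2 ^- r)
      (x k 0 + B%:R).
    by apply: apx_ext (au k); exists 0%N => r _; rewrite uE code_mxK.
  apply: bigo_le (bigo_mulc k8 (ell_tuple_apx au')).
  by exists 0%N => r _; apply: Kell.
have linell : bigo id (fun r => ell (lam r)).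
  have al1 := ell_tuple_apx (fun k => (alam k).1); have al2 := ell_tuple_apx (fun k => (alam k).2).
  apply: bigo_le (bigo_mulc 2 (bigo_add al1 al2)); exists 0%N => r _.
  have e := eqP (valid_quant_line i z%:~R B r (code_line (pl r))).
  by rewrite {1}/lam {1}e; apply: ell_cpair.
have linlam : bigo id Kl.
  by apply: bigo_le (bigo_mulc k8 linell); exists 0%N => r _; apply: Kell.
have linCK : bigo id CK.
  by apply: bigo_le (bigo_mulc k8 linell); exists 0%N => r _; apply: Kell.
have linJ : bigo id KJ.
  have [c4 Kltn] := K_ltn hU.
  apply: bigo_le (bigo_add (bigo_refl id) (bigo_mulc c4 (bigo_lin_ell (bigo_refl ell)))).
  by exists 0%N => r _; apply: Kltn.
have LKl r : (r5 <= r)%N -> (L r <= Kl r + k3 * (ell (cpair r (Delta r)) + ell (Kl r)))%N.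
  move=> /flE[p wp ep]; apply: leq_trans (K_line_le U A wp) _; rewrite -ep; exact: M3.
have logr : bigo ell (fun r => ell r) by apply: bigo_refl.
have logrD : bigo ell (fun r => ell (cpair r (Delta r))) by apply: bigo_ell_cpair.
have loge3 : bigo ell (fun r => k3 * (ell (cpair r (Delta r)) + ell (Kl r)))%N.
  by apply: bigo_mulc; apply: bigo_add => //; apply: bigo_ell_lin.
have linL : bigo id L.
  apply: bigo_le (bigo_add linlam (bigo_lin_ell loge3)); exists r5 => r; exact: LKl.
(* The cap provides the linear bound required to make [ell (kap' r)] logarithmic. Where [kap]
   exceeds it, the conclusion is immediate. *)
pose kap' r := minn (kap r) (L r + r).
have linkap : bigo id kap'.
  apply: bigo_le (bigo_add linL (bigo_refl id)); exists 0%N => r _; exact: geq_minr.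
pose e1 r := (k1 * (ell r + ell (kap' r)))%N.
pose e2 r := (k2 * (ell r + ell (L r)))%N.
pose e3 r := (k3 * (ell (cpair r (Delta r)) + ell (Kl r)))%N.
pose e4 r := (k4 * (2 * (ell (cpair r (Delta r)) + 3) + ell (CK r)))%N.
pose e5 r := (k5 * (2 * (ell r + 3) + ell (Ku r)))%N.
pose e6 r := (k6 * (1 + ell (Ku r + e5 r)))%N.
pose e7 r := (k7 * (ell r + ell (KJ r)) + cs)%N.
have log1 : bigo ell e1 by apply: bigo_mulc; apply: bigo_add => //; apply: bigo_ell_lin.
have log2e : bigo ell e2 by apply: bigo_mulc; apply: bigo_add => //; apply: bigo_ell_lin.
have log4 : bigo ell e4.
  apply: bigo_mulc; apply: bigo_add; last exact: bigo_ell_lin.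
  by apply: bigo_mulc; apply: bigo_add => //; apply: bigo_ell_const.
have log5 : bigo ell e5.
  apply: bigo_mulc; apply: bigo_add; last exact: bigo_ell_lin.
  by apply: bigo_mulc; apply: bigo_add => //; apply: bigo_ell_const.
have log6 : bigo ell e6.
  apply: bigo_mulc; apply: bigo_add; first exact: bigo_ell_const.
  by apply: bigo_ell_lin; apply: bigo_add => //; apply: bigo_lin_ell.
have log7 : bigo ell e7.
  apply: bigo_add; last exact: bigo_ell_const.
  by apply: bigo_mulc; apply: bigo_add => //; apply: bigo_ell_lin.
pose N r := (e7 r + (C0 * ell r + e4 r + e2 r) + e5 r)%N.
have logN : bigo ell N.
  apply: bigo_add => //; apply: bigo_add => //; apply: bigo_add => //.
  by apply: bigo_add => //; apply: bigo_mulc.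
pose D r := (N r + ell (r + Ku r + Kl r))%N.
have logD : bigo ell D.
  apply: bigo_add => //; apply: bigo_ell_lin; apply: bigo_add => //; apply: bigo_add => //.
  exact: bigo_refl.
have [CD [r6 HD]] := logD; have [r7 H7] := mul_ell_le (kl * CD).
pose G r := (e3 r + 2 * e1 r + kl * D r + C0 * ell r + 2 * (e5 r + e6 r + e7 r))%N.
have [CG [r8 HG]] : bigo ell G.
  apply: bigo_add; last by apply: bigo_mulc; apply: bigo_add => //; apply: bigo_add.
  apply: bigo_add; last exact: bigo_mulc.
  apply: bigo_add; last exact: bigo_mulc.
  by apply: bigo_add => //; apply: bigo_mulc.
exists CG, (2 + r1 + r2 + r5 + r6 + r7 + r8)%N => r hr.
have [hr1 hr2 hr5] : [/\ (r1 <= r)%N, (r2 <= r)%N & (r5 <= r)%N] by split; lia.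
have [hr6 hr7 hr8] : [/\ (r6 <= r)%N, (r7 <= r)%N & (r8 <= r)%N] by split; lia.
have r2' : (2 <= r)%N by lia.
suff : (L r + 2 * r <= 2 * kap r + G r)%N.
  by move=> h'; apply: leq_trans h' _; rewrite leq_add2l HG.
have [gt|le] := ltnP (L r + r) (kap r).
  by rewrite -[X in (X <= _)%N]addn0; move: gt; rewrite /kap; lia.
have kE : kap' r = kap r by apply/minn_idPl.
have F1 : (Ku r <= kap r + e1 r)%N.
  by have := M1 A r (code_mx (px r)); rewrite -(Hpx r).2 /e1 kE.
have F2 : (Kl r <= L r + e2 r)%N.
  by have := M2 A r (code_line (pl r)); rewrite -(Hpl r hr1).2.
have F3 := LKl r hr5.
have ell4 dl : (dl <= 4)%N -> (ell dl <= 3)%N by move=> /ell_leq.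
have F5 : (K U A (cpair (J r) (u r)) <= Ku r + e5 r)%N.
  have [q1 q2] := hu r; pose dl := (J r + (2 ^ r * b + 2) - quant B r (px r i 0%R))%N.
  have hd : (ell dl <= 3)%N by apply: ell4; rewrite /dl; clear -q2; lia.
  have := M5 A (cpair r dl) (u r); rewrite (cfstK r) (csndK r) uE.
  have -> : (quant B r (px r i 0%R) + dl - (2 ^ r * b + 2) = J r)%N.
    by rewrite /dl subnKC // addnK.
  move=> h'; apply: leq_trans h' _; rewrite leq_add2l leq_mul // leq_add2r.
  by apply: leq_trans (ell_cpair _ _) _; rewrite leq_mul // leq_add2l.
have F6 : (KJ r <= K U A (cpair (J r) (u r)) + e6 r)%N.
  have := M6 A 0%N (cpair (J r) (u r)); rewrite (cfstK (J r)) => h'.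
  apply: leq_trans h' _; rewrite leq_add2l leq_mul // leq_add //.
  exact: ell_leq.
have F7 : (r <= KJ r + e7 r)%N.
  have e : code_str (binary_prefix s r) = (2 ^ r + J r).-1.
    by rewrite -(code_binary_prefix s r).
  by apply: leq_trans (Hs r) _; rewrite e /e7 addnA leq_add2r; apply: (M7 A r (J r)).
(* In the default case [L r] is logarithmic, and [kap r] is at least [r] up to a logarithm because
   the point computes the random height. *)
have [hc0|[q hq1 hq2]] := condK_line_cases U A r l s.
  have F0 := hcond r2'; rewrite hc0 -/(L r) in F0.
  by move: F0 F1 F5 F6 F7; rewrite /G; clear; lia.
have FC : (Kl r <= CK r + N r)%N.
  have [p wp ep] := flE r hr5.
  have [q1 q2] : (quant B r q <= J r + (2 ^ r * b + 2))%N /\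
      (J r + 2 ^ r * b <= quant B r q + 2)%N := quant_height eb b0 hq1.
  pose dl := (J r + (2 ^ r * b + 2) - quant B r q)%N.
  have hd : (ell dl <= 3)%N by apply: ell4; rewrite /dl; clear -q2; lia.
  have F0 := hcond r2'; have F0' := hq2 p wp.
  have F4 : (condK U A (code_line p) (code_rat q) <= CK r + e4 r)%N.
    have := M4 A (cpair (cpair r (Delta r)) dl) (code_rat q) (lam r).
    rewrite (csndK (cpair r (Delta r))) (cfstK (cpair r (Delta r))) ep (cfstK r) code_ratK.
    have -> : (quant B r q + dl - (2 ^ r * b + 2) = J r)%N.
      by rewrite /dl subnKC // addnK.
    move=> h'; apply: leq_trans h' _; rewrite leq_add2l leq_mul // leq_add2r.
    by apply: leq_trans (ell_cpair _ _) _; rewrite leq_mul // leq_add2l.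
  by move: F0 F0' F4 F2; rewrite /N -/(L r); clear; lia.
have := Hl A (N r) r (J r) (u r) (lam r) (Jr r) (valid_quant_line _ _ _ _ _) (inc r hr2).
rewrite -/(KJ r) -/(Ku r) -/(Kl r) -/(CK r) => /(_ _ FC) {}Hl.
have {}Hl : (Kl r + 2 * r <= 2 * Ku r + kl * D r)%N.
  apply: Hl.
  - by move: F7; rewrite /N; clear; lia.
  - by move: F5; rewrite /N; clear; lia.
  apply: leq_trans (H7 r hr7); rewrite -mulnA leq_mul //.
  exact: HD.
by move: Hl F1 F3; rewrite -/(e3 r) /G; clear; lia.
Qed.

End Main.

Theorem theorem1 (R : realType) (U : machine) (hU : universal_prefix_free U)
    (n : nat) (hn : (1 <= n)%N) (A : set nat)
    (l : set 'cV[R]_n) (hl : is_line l) (s : R) (hs : random U A s)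
    (hcond : exists C : R, forall r : nat, (2 <= r)%N ->
       (condK_line U A r l s)%:R >= (K_line U A r l)%:R - C * log2 r%:R) :
  forall eps : R, 0 < eps ->
    exists r0 : nat, forall r : nat, (r0 <= r)%N ->
      (K_point U A r (line_at l s))%:R
        >= (K_line U A r l)%:R / 2 + r%:R - eps * r%:R :> R.
Proof.
(* [C0] bounds [C] from above whatever its sign, and [log2] is at most [ell], so the hypothesis
   passes to natural numbers. *)
move=> eps eps0; have [C hC] := hcond; pose C0 := (Num.truncn `|C|).+1.
have hC0 r : (2 <= r)%N -> (K_line U A r l <= condK_line U A r l s + C0 * ell r)%N.
  move=> r2; rewrite -(ler_nat R) natrD natrM -lerBlDr; apply: le_trans (hC r r2).
  rewrite lerD2l lerN2; have r0 : (0 < r)%N by apply: leq_trans r2.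
  have lg0 : 0 <= log2 r%:R :> R.
    by rewrite divr_ge0 // ln_ge0 // ler1n.
  apply: le_trans (ler_wpM2r lg0 (ler_norm C)) _; apply: ler_pM => //.
    by apply/ltW/truncnS_gt.
  exact: log2_le_ell.
have [G [r0 HG]] := K_point_lower hU hl hs hC0.
pose M := (Num.truncn (G%:R / eps)).+1; have [r1 HM] := mul_ell_le M.
exists (maxn r0 r1) => r; rewrite geq_max => /andP[/HG {}HG /HM {}HM].
have GM : G%:R <= eps * M%:R :> R by rewrite mulrC -ler_pdivrMr //; apply/ltW/truncnS_gt.
have GL : G%:R * (ell r)%:R <= eps * r%:R :> R.
  apply: le_trans (ler_wpM2r _ GM) _ => //; rewrite -mulrA ler_pM2l // -natrM ler_nat //.
have r_ge0 : 0 <= eps * r%:R by rewrite mulr_ge0 // ltW.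
move: HG; rewrite -(ler_nat R) !natrD !natrM; move: GL r_ge0.
move: (eps * _) (G%:R * _) => a g; lra.
Qed.
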